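(* Let $n\ge1$, $1\le M\le n$, and let $\underline{s}\in\mathbb{R}^n$ with $s_i>\frac12$ for $i\neq M$ and $s_M>0$. The covariance function of the Wishart family $(\gamma^{(M)}_{\underline{s},y})_{y\in P_G}$ on $Q_G$ is, for $y\in P_G$, $$v(y)=\sum_{i=1}^{M-1}(s_i-s_{i+1})\,\mathbb{P}\bigl[((y_{\{1:i\}})^{-1})^0\bigr]+s_M\,\mathbb{P}(y^{-1})+\sum_{i=M+1}^{n}(s_i-s_{i-1})\,\mathbb{P}\bigl[((y_{\{i:n\}})^{-1})^0\bigr].$$
   Context: $G=A_n$ is the path graph $1-2-\cdots-n$ on $V=\{1,\dots,n\}$; $E=\{(i,j): |i-j|\le 1\}$. $S_n$ is the space of real symmetric $n\times n$ matrices, $Z_G=\{y\in S_n:y_{ij}=0\text{ if }(i,j)\notin E\}$; $P_G$ is the set of positive definite $y\in Z_G$. $I_G$ is the dual space of $Z_G$, realised as the space of incomplete symmetric matrices $\eta=(\eta_{ij})_{(i,j)\in E}$, with $\langle y,\eta\rangle=\mathrm{tr}(y\eta)=\sum_{(i,j)\in E}y_{ij}\eta_{ij}$. $Q_G=\{\eta\in I_G:\langle y,\eta\rangle>0\ \forall y\in\overline{P_G}\setminus\{0\}\}$. $\pi:S_n\to I_G$ keeps the entries indexed by $E$. $d\eta$ is Lebesgue measure on $I_G$. For $I\subset V$, a subscript $I$ denotes the submatrix with rows and columns in $I$; $\{i:j\}=\{i,\dots,j\}$; $|\cdot|$ is the determinant. For a matrix $K$ indexed by $B\subset V$, $K^0$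 is the $n\times n$ matrix with $(K^0)_{ij}=K_{ij}$ if $i,j\in B$ and $0$ otherwise. For $A\in S_n$, $\mathbb{P}(A):Z_G\to I_G$ is $\mathbb{P}(A)u=\pi(AuA)$. With $s_0=s_{n+1}=0$, for $\eta\in Q_G$, $$\delta^{(M)}_{\underline{s}}(\eta)=\frac{\prod_{i=1}^{M-1}|\eta_{\{i:i+1\}}|^{s_i}\prod_{i=M+1}^{n}|\eta_{\{i-1:i\}}|^{s_i}}{\prod_{i=2}^{M-1}\eta_{ii}^{s_{i-1}}\cdot\eta_{MM}^{s_{M-1}-s_M+s_{M+1}}\cdot\prod_{i=M+1}^{n-1}\eta_{ii}^{s_{i+1}}};$$ $\varphi_{A_1}(\eta)=\eta^{-1}$, and for $n\ge2$, $\varphi_{A_n}(\eta)=\prod_{i=1}^{n-1}|\eta_{\{i,i+1\}}|^{-3/2}\prod_{i=2}^{n-1}\eta_{ii}$. For $y\in P_G$, $\gamma^{(M)}_{\underline{s},y}$ is the probability measure on $Q_G$ with density proportional to $e^{-\mathrm{tr}(y\eta)}\delta^{(M)}_{\underline{s}}(\eta)\varphi_{A_n}(\eta)$ with respect to $d\eta$, and $m^{(M)}_{\underline{s}}(y)$ is its mean. The covariance operator $v(y):Z_G\to I_G$ is defined by $\langle z',v(y)z\rangle=\mathrm{Cov}(\langle z,X\rangle,\langle z',X\rangle)$ for $X\sim\gamma^{(M)}_{\underline{s},y}$; equivalently $v(y)$ is minus the differential of $m^{(M)}_{\underline{s}}$ at $y$. *)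

(* Defs.v *)
From HB Require Import structures.
From mathcomp Require Import all_boot all_order all_algebra.
From mathcomp Require Import all_classical all_reals all_analysis.

Set Implicit Arguments.
Unset Strict Implicit.
Unset Printing Implicit Defensive.

Import Order.TTheory GRing.Theory Num.Theory.
Import numFieldNormedType.Exports.
Local Open Scope classical_set_scope.
Local Open Scope ring_scope.

(** * Lebesgue measure on ['rV[R]_m] *)

Section rV_measurable.
Context {R : realType} (m : nat).

Let coors : 'I_m -> 'rV[R]_m -> R := fun i u => u 0 i.

Let rV_set0 : g_sigma_preimage coors set0.
Proof. exact: sigma_algebra0. Qed.

Let rV_setC A : g_sigma_preimage coors A -> g_sigma_preimage coors (~` A).
Proof. exact: sigma_algebraC. Qed.

Let rV_bigcup (F : _^nat) : (forall i, g_sigma_preimage coors (F i)) ->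
  g_sigma_preimage coors (\bigcup_i (F i)).
Proof. exact: sigma_algebra_bigcup. Qed.

HB.instance Definition _ := @isMeasurable.Build default_measure_display
  'rV[R]_m (g_sigma_preimage coors) rV_set0 rV_setC rV_bigcup.

Lemma measurable_rVP d (T : measurableType d) (f : T -> 'rV[R]_m) :
  (forall i, measurable_fun setT (fun x => f x 0 i)) -> measurable_fun setT f.
Proof.
move=> mf.
suff : g_sigma_preimage (fun i => coors i \o f) `<=` measurable.
  rewrite g_sigma_preimage_comp => prefS _ A mA.
  by apply: prefS; exists A.
apply: smallest_sub; first exact: sigma_algebra_measurable.
case: m f mf @coors => [|k] f mf coors'; first by rewrite big_ord0.
rewrite -bigcup_mkord_ord; apply: bigcup_sub => i Ii.
by move=> A [B mB <-]; exact: mf.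
Qed.

Lemma measurable_coord_rV (i : 'I_m) :
  measurable_fun setT (fun u : 'rV[R]_m => u 0 i).
Proof.
move=> _ Y mY; rewrite setTI; apply: sub_sigma_algebra => /=.
rewrite -bigcup_seq/=; exists i => /=; first by rewrite mem_index_enum.
by exists Y => //; rewrite setTI.
Qed.

End rV_measurable.

Section lebesgue_rV_step.
Context {R : realType} (m : nat).

Definition cons_rV (p : measurableTypeR R * 'rV[R]_m) : 'rV[R]_m.+1 :=
  row_mx (p.1)%:M p.2 : 'rV[R]_(1 + m).

Lemma cons_rV0 p : cons_rV p 0 ord0 = p.1.
Proof.
have -> : ord0 = lshift m (0 : 'I_1) by exact/val_inj.
by rewrite /cons_rV (row_mxEl (p.1)%:M p.2 0 0) mxE eqxx.
Qed.

Lemma cons_rVS p (i : 'I_m) : cons_rV p 0 (lift ord0 i) = p.2 0 i.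
Proof.
have -> : lift ord0 i = rshift 1 i by exact/val_inj.
by rewrite /cons_rV (row_mxEr (p.1)%:M p.2 0 i).
Qed.

Let measurable_cons_rV : measurable_fun setT cons_rV.
Proof.
apply: measurable_rVP => i.
have [j ->|->] := unliftP ord0 i.
  under eq_fun do rewrite cons_rVS.
  apply: (@measurableT_comp _ _ _ _ _ _ (fun u : 'rV[R]_m => u 0 j)) => //.
  exact: measurable_coord_rV.
by under eq_fun do rewrite cons_rV0; exact: measurable_fst.
Qed.

HB.instance Definition _ :=
  isMeasurableFun.Build _ _ _ _ cons_rV measurable_cons_rV.

Variable mu : {sigma_finite_measure set 'rV[R]_m -> \bar R}.

Definition lebesgue_rV_step : set 'rV[R]_m.+1 -> \bar R :=
  pushforward (lebesgue_measure \x mu)%E cons_rV.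

Let step0 : lebesgue_rV_step set0 = 0%E.
Proof. exact: measure0. Qed.

Let step_ge0 A : (0 <= lebesgue_rV_step A)%E.
Proof. exact: measure_ge0. Qed.

Let step_sigma_additive : semi_sigma_additive lebesgue_rV_step.
Proof. exact: measure_semi_sigma_additive. Qed.

HB.instance Definition _ := isMeasure.Build _ _ _ lebesgue_rV_step
  step0 step_ge0 step_sigma_additive.

Let uncons (u : 'rV[R]_m.+1) : measurableTypeR R * 'rV[R]_m :=
  (u 0 ord0, \row_i u 0 (lift ord0 i)).

Let cons_rVK : cancel cons_rV uncons.
Proof.
move=> [x u]; congr pair; first exact: cons_rV0.
by apply/rowP => i; rewrite mxE cons_rVS.
Qed.

Let unconsK : cancel uncons cons_rV.
Proof.
move=> u; apply/rowP => i; have [j ->|->] := unliftP ord0 i.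
  by rewrite cons_rVS mxE.
by rewrite cons_rV0.
Qed.

Let measurable_uncons : measurable_fun setT uncons.
Proof.
apply: measurable_fun_pair; first exact: measurable_coord_rV.
apply: measurable_rVP => i; under eq_fun do rewrite mxE.
exact: measurable_coord_rV.
Qed.

Let step_sigma_finite : sigma_finite setT lebesgue_rV_step.
Proof.
have /sigma_finiteP[F [TF ndF Foo]] := sigma_finiteT (@lebesgue_measure R).
have /sigma_finiteP[G [TG ndG Goo]] := sigma_finiteT mu.
exists (fun k => uncons @^-1` (F k `*` G k)).
  rewrite -preimage_bigcup [X in _ @^-1` X](_ : _ = setT) ?preimage_setT//.
  rewrite -setXTT TF TG; apply/seteqP; split => -[x u].
    by move=> [k _ []/= ? ?]; split; exists k.
  move=> [/= [k _ Fkx] [l _ Glu]]; exists (maxn k l) => //; split.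
    by move: x Fkx; exact/subsetPset/ndF/leq_maxl.
  by move: u Glu; exact/subsetPset/ndG/leq_maxr.
move=> k; have [mF Fk] := Foo k; have [mG Gk] := Goo k.
have mFG : measurable (F k `*` G k) by exact: measurableX.
split; first by rewrite -[X in measurable X]setTI; exact: measurable_uncons.
rewrite /lebesgue_rV_step /pushforward -comp_preimage.
rewrite (_ : uncons \o cons_rV = id); last exact/funext/cons_rVK.
by rewrite preimage_id product_measure1E// lte_mul_pinfty// ge0_fin_numE.
Qed.

HB.instance Definition _ := Measure_isSigmaFinite.Build _ _ _
  lebesgue_rV_step step_sigma_finite.

End lebesgue_rV_step.

Fixpoint lebesgue_rV (R : realType) (m : nat) :
    {sigma_finite_measure set 'rV[R]_m -> \bar R} :=
  if m is m'.+1 then lebesgue_rV_step (lebesgue_rV R m')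
  else @dirac _ 'rV[R]_0 0 R.

Lemma lebesgue_rV_box (R : realType) (m : nat)
    (A : 'I_m -> set (measurableTypeR R)) :
  (forall i, measurable (A i)) ->
  lebesgue_rV R m [set u | forall i, A i (u 0 i)] =
  (\prod_(i < m) lebesgue_measure (A i))%E.
Proof.
elim: m A => [|m IH] A mA.
  by rewrite big_ord0 /= diracE mem_set//=; case.
have mB : measurable [set u : 'rV[R]_m | forall i, A (lift ord0 i) (u 0 i)].
  have -> : [set u : 'rV[R]_m | forall i, A (lift ord0 i) (u 0 i)] =
      \bigcap_(i in setT) ((fun u : 'rV[R]_m => u 0 i) @^-1` A (lift ord0 i)).
    by apply/seteqP; split => u h i; [move=> _|]; exact: h.
  apply: fin_bigcap_measurable => // i _; rewrite -[X in measurable X]setTI.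
  by apply: measurable_coord_rV => //; exact: mA.
rewrite big_ord_recl -IH//.
rewrite -(product_measure1E (@lebesgue_measure R) (lebesgue_rV R m))//.
congr ((lebesgue_measure \x lebesgue_rV R m)%E _).
apply/seteqP; split => -[x u] /=.
  move=> h; split; first by have := h ord0; rewrite cons_rV0.
  by move=> i; have := h (lift ord0 i); rewrite cons_rVS.
move=> [hx hu] i; have [j ->|->] := unliftP ord0 i.
  by rewrite cons_rVS.
by rewrite cons_rV0.
Qed.

(** * Symmetric and incomplete symmetric matrices on the path graph

    Vertices are the elements of ['I_n]; the ordinal [i] is the vertex
    [i.+1] of the path [1 - 2 - ... - n].  Natural-number subscripts are
    always the 1-based labels. *)

(* [u]_k for a 1-based label [k], extended by 0 outside [1 .. m]. *)
Definition rV_at (R : realType) (m : nat) (u : 'rV[R]_m) (k : nat) : R :=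
  if k is k'.+1 then oapp (u 0) 0 (insub k') else 0.

Section path_graph.
Variables (R : realType) (n : nat).

Definition pathE (i j : 'I_n) : bool := (i <= j.+1)%N && (j <= i.+1)%N.

Definition Z_G : set 'M[R]_n :=
  [set y | y^T = y /\ forall i j, ~~ pathE i j -> y i j = 0].

Definition posdef (m : nat) (y : 'M[R]_m) : Prop :=
  y^T = y /\ forall u : 'rV[R]_m, u != 0 -> 0 < (u *m y *m u^T) 0 0.

Definition P_G : set 'M[R]_n := [set y | Z_G y /\ posdef y].

(* An incomplete symmetric matrix [eta] is given by its free entries: the
   diagonal eta_11, ..., eta_nn followed by the off-diagonal entries
   eta_12, ..., eta_(n-1)n. *)
Definition I_G : Type := 'rV[R]_(n + n.-1).
HB.instance Definition _ := GRing.Lmodule.on I_G.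
HB.instance Definition _ := Measurable.on I_G.

Definition d_eta : {sigma_finite_measure set I_G -> \bar R} :=
  lebesgue_rV R (n + n.-1).

(* Entry (i, j) of [eta], (i, j) an edge; 0 is only a filler off the edges. *)
Definition ient (eta : I_G) (i j : nat) : R :=
  if i == j then rV_at (lsubmx eta) i
  else if j == i.+1 then rV_at (rsubmx eta) i
  else if i == j.+1 then rV_at (rsubmx eta) j
  else 0.

Definition imx (eta : I_G) : 'M[R]_n := \matrix_(i, j) ient eta i.+1 j.+1.

Lemma path_next_subproof (k : 'I_n.-1) : (k.+1 < n)%N.
Proof. by rewrite -ltn_predRL. Qed.

Definition proj_IG (A : 'M[R]_n) : I_G :=
  row_mx (\row_i A i i)
    (\row_k A (widen_ord (leq_pred n) k) (Ordinal (path_next_subproof k))).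

(* <y, eta> = tr (y eta) *)
Definition pairing (y : 'M[R]_n) (eta : I_G) : R :=
  \sum_i \sum_(j | pathE i j) y i j * imx eta i j.

Definition Q_G : set I_G :=
  [set eta | forall y, closure P_G y -> y != 0 -> 0 < pairing y eta].

(* {i : j} *)
Definition interval_set (i j : nat) : {set 'I_n} :=
  [set k : 'I_n | (i <= k.+1 <= j)%N]%SET.

(* A_B *)
Definition psubmx (B : {set 'I_n}) (A : 'M[R]_n) : 'M[R]_#|B| :=
  mxsub enum_val enum_val A.

(* K^0 *)
Definition pad0 (B : {set 'I_n}) (K : 'M[R]_#|B|) : 'M[R]_n :=
  \sum_(a < #|B|) \sum_(b < #|B|) K a b *: delta_mx (enum_val a) (enum_val b).

(* P(A) u = pi (A u A) *)
Definition quadP (A : 'M[R]_n) : 'M[R]_n -> I_G :=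
  fun u => proj_IG (A *m u *m A).

(** * Wishart distributions *)

(* |eta_{i : i+1}| *)
Definition minor2 (eta : I_G) (i : nat) : R :=
  \det (psubmx (interval_set i i.+1) (imx eta)).

(* [rV_at s] satisfies s_0 = s_(n+1) = 0. *)
Definition delta_M (M : nat) (s : 'rV[R]_n) (eta : I_G) : R :=
  (\prod_(1 <= i < M) minor2 eta i `^ rV_at s i
     * \prod_(M.+1 <= i < n.+1) minor2 eta i.-1 `^ rV_at s i)
  / (\prod_(2 <= i < M) ient eta i i `^ rV_at s i.-1
     * ient eta M M `^ (rV_at s M.-1 - rV_at s M + rV_at s M.+1)
     * \prod_(M.+1 <= i < n) ient eta i i `^ rV_at s i.+1).

Definition phi_An (eta : I_G) : R :=
  if n == 1%N then (ient eta 1 1)^-1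
  else \prod_(1 <= i < n) minor2 eta i `^ (- (3 / 2))
       * \prod_(2 <= i < n) ient eta i i.

Definition wishart_weight (M : nat) (s : 'rV[R]_n) (y : 'M[R]_n)
    (eta : I_G) : R :=
  expR (- pairing y eta) * delta_M M s eta * phi_An eta.

(* As [gamma] has total mass 1, [c] is the inverse of the (necessarily positive
   and finite) integral of the weight over [Q_G]; so [gamma] is unique on
   measurable sets. *)
Definition is_wishart (M : nat) (s : 'rV[R]_n) (y : 'M[R]_n)
    (gamma : probability I_G R) : Prop :=
  exists c : R, forall A, measurable A ->
    gamma A = (c%:E * \int[d_eta]_(eta in A `&` Q_G)
                        (wishart_weight M s y eta)%:E)%E.

(* Square integrability guarantees that all the covariances exist. *)
Definition is_covariance_operator (gamma : probability I_G R)
    (v : 'M[R]_n -> I_G) : Prop :=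
  (forall z, Z_G z -> pairing z \in Lfun gamma 2%:E) /\
  (forall z z', Z_G z -> Z_G z' ->
     (pairing z' (v z))%:E = covariance gamma (pairing z) (pairing z')).

End path_graph.

(* Main.v *)
Require Import Defs.
From HB Require Import structures.
From mathcomp Require Import all_boot all_order all_algebra.
From mathcomp Require Import all_classical all_reals all_analysis.
From mathcomp Require Import measurable_realfun zify ring lra.

Import Order.TTheory GRing.Theory Num.Theory.
Import numFieldNormedType.Exports.
Local Open Scope classical_set_scope.
Local Open Scope ring_scope.

(**
The path is a tree, and it is rooted here at the vertex M.  Let a_i and b_i be
the diagonal and off-diagonal entries of eta.  The cone Q_G is the region where
all the a_i and all the minors a_i a_(i+1) - b_i^2 are positive ([Q_G_ediag],
[Q_G_minor], [region_Q_G]), and there the Wishart weight is a product of one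
factor for the root and one factor for each edge ([tree_weight_expR]).  The edge
between a vertex with entry a and its neighbour r on the side of the root has
the factor
  exp(-(al a + 2 be b)) (a r - b^2)^(sg - 3/2) r^(1 - sg).
Integrating a (a shifted Gamma integral) and b (a Gaussian integral) leaves
c al^(-sg) exp(be^2 r / al), in which the powers of r have cancelled
([integral_arm_marg]).  This only replaces the parameter al' of the neighbour by
al' - be^2 / al, which is one step of Gaussian elimination on y.  Going from
both leaves to the root ([integral_root_arm]) gives the Laplace transform
  L(y) = C (product of the p_i^(-s_i)),
where the p_i are the pivots of y for this order of elimination and C does not
depend on y ([integral_tree_weight], [laplace_wishartE]).  Normalising the
weight by L(y) yields the Wishart distribution.

If X has this distribution, then E exp(-t <z, X>) = L(y + t z) / L(y) for small
t, so the variance of <z, X> is the second derivative of log L(y + t z) at 0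
([variance_of_mgf]), that is, the sum of the s_i times minus the second
derivative of log p_i.  The derivatives of the pivots obey a scalar recursion
along the path ([is_derive_elim_gain]).

On the side of matrices, let Y be the inverse of y on the vertices that are
already eliminated, padded by zeros.  The bordering formula says that Y grows by
w w^T / p at the next vertex, where p is the pivot and w the vector obtained by
eliminating that vertex.  Hence tr(z Y z Y) grows by
2 w^T z Y z w / p + (w^T z w / p)^2, and the recursions for w and Y show that
the first term is -p''/p and the second is (p'/p)^2: the growth is exactly minus
the second derivative of log p ([chain_quad] along the arms, [root_quad] at the
root).  Summation by parts ([sum_by_parts]) then turns the weights s_i of the
growths into the weights s_i - s_(i+1), s_M and s_i - s_(i-1) of the statement,
and polarisation passes from variances to covariances ([wishart_covariance]).
*)

Set Implicit Arguments.
Unset Strict Implicit.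
Unset Printing Implicit Defensive.

(** * Gamma integrals on the half-line *)

Section affine_substitution.
Context {R : realType}.
Notation mu := (@lebesgue_measure R).
Variables (a b : R).
Hypothesis a_gt0 : 0 < a.

Definition affine (x : measurableTypeR R) : measurableTypeR R := a * x + b.

Let measurable_affine : measurable_fun setT affine.
Proof. by apply: measurable_funD => //; apply: measurable_funM. Qed.


Let affine_image : {measure set (measurableTypeR R) -> \bar R} :=
  measure_function_pushforward__canonical__measure_function_Measure
    mu measurable_affine.

Let a_nng : {nonneg R} := NngNum (ltW a_gt0).

Let lebesgue_affine (A : set R) : measurable A ->
  mu A = mscale a_nng affine_image A.
Proof.
move=> mA; apply: lebesgue_measure_unique => // _ [[u v]] _ <-.
rewrite -[RHS]/(a%:E * mu (affine @^-1` `]u, v]%classic))%E.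
rewrite (_ : _ @^-1` _ = `](u - b) / a, (v - b) / a]%classic); last first.
  apply/seteqP; split=> x /=; rewrite !in_itv /= /affine;
    by rewrite ltr_pdivrMr// ler_pdivlMr// ltrBlDr lerBrDr mulrC.
rewrite !lebesgue_measure_itv /= !lte_fin ltr_pM2r ?invr_gt0// ltrD2r.
case: ifP => _; last by rewrite mule0.
rewrite -!EFinB -EFinM; congr EFin.
by field; rewrite gt_eqF.
Qed.

(** Lebesgue measure and [a] times its image under [x |-> a * x + b] agree on
half-open intervals, hence everywhere. *)
Lemma ge0_integral_affine (f : R -> \bar R) : measurable_fun setT f ->
  (forall x, (0 <= f x)%E) ->
  (\int[mu]_x f x = a%:E * \int[mu]_x f (a * x + b)%R)%E.
Proof.
move=> mf f0.
rewrite (eq_measure_integral (mscale a_nng affine_image)).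
  by rewrite ge0_integral_mscale// ge0_integral_pushforward.
by move=> A mA _; exact: lebesgue_affine.
Qed.

End affine_substitution.

Section measurable_tools.
Context {d} {T : measurableType d} {R : realType}.

Lemma measurable_gt0 (f : T -> R) : measurable_fun setT f ->
  measurable_fun setT (fun t => (0 < f t)%R%:R : R).
Proof.
move=> mf.
have -> : (fun t => (0 < f t)%R%:R) = \1_(f @^-1` `]0, +oo[) :> (T -> R).
  by apply/funext => t; rewrite indicE; congr (_%:R); congr nat_of_bool;
    apply/idP/idP; rewrite inE/= in_itv/= andbT.
apply: measurable_indic; rewrite -[X in measurable X]setTI.
exact: mf.
Qed.

Lemma measurable_powRc (f : T -> R) (p : R) : measurable_fun setT f ->
  measurable_fun setT (fun t => f t `^ p).
Proof. by move=> mf; apply: (measurableT_comp (measurable_powR p)). Qed.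

Lemma measurable_expRc (f : T -> R) : measurable_fun setT f ->
  measurable_fun setT (fun t => expR (f t)).
Proof. by move=> mf; apply: (measurableT_comp (@measurable_expR R)). Qed.

End measurable_tools.

Section gamma.
Context {R : realType}.
Notation mu := (@lebesgue_measure R).

Definition gamma_fun (k x : R) : R := (0 < x)%R%:R * (expR (- x) * x `^ (k - 1)).

Lemma gamma_fun_ge0 k x : 0 <= gamma_fun k x.
Proof. by rewrite !mulr_ge0// ?expR_ge0 ?powR_ge0. Qed.

Lemma measurable_gamma_fun k : measurable_fun setT (gamma_fun k).
Proof.
apply: measurable_funM; first exact: measurable_gt0.
apply: measurable_funM; first exact: measurable_expRc.
exact: measurable_powRc.
Qed.

(** Euler's Gamma integral.  The indicator in [gamma_fun] extends it to the whole
line, so that affine substitutions need no change of domain. *)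
Definition gammaI (k : R) : \bar R := \int[mu]_x (gamma_fun k x)%:E.

Lemma powR_integral_unit_le (k : R) (n : nat) : 0 < k ->
  (\int[mu]_(x in `[(n.+2%:R^-1)%R, 1%R]) (x `^ (k - 1))%:E <= (k^-1)%:E)%E.
Proof.
move=> k0; have n0 : 0 < n.+2%:R^-1 :> R by rewrite invr_gt0.
have n1 : n.+2%:R^-1 < 1 :> R by rewrite invf_lt1// ltr1n.
have dF (x : R) : 0 < x -> is_derive x 1 (fun x => k^-1 * x `^ k) (x `^ (k - 1)).
  move=> x0; have := is_derive1_powR k x0 => dp.
  by have := is_deriveZ k^-1 dp; rewrite scalerA mulVf ?gt_eqF// scale1r.
have cF (x : R) : 0 < x -> {for x, continuous (fun x => k^-1 * x `^ k)}.
  move=> x0; apply/differentiable_continuous/derivable1_diffP.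
  by have [] := dF _ x0.
rewrite (@continuous_FTC2 _ _ (fun x => k^-1 * x `^ k) _ _ n1).
- rewrite powR1 mulr1 -EFinB lee_fin gerBl mulr_ge0 ?powR_ge0// invr_ge0 ltW//.
- apply: derivable_within_continuous => x; rewrite in_itv/= => /andP[nx _].
  have x0 : 0 < x by exact: lt_le_trans nx.
  by have [] := is_derive1_powR (k - 1) x0.
- split.
  + by move=> x; rewrite in_itv/= => /andP[/(lt_trans n0)/dF[]].
  + by apply: cvg_at_right_filter; exact: cF.
  + by apply: cvg_at_left_filter; exact: cF.
- move=> x; rewrite in_itv/= => /andP[/(lt_trans n0) x0 _].
  by rewrite derive1E; have [_ ->] := dF _ x0.
Qed.

(** The singularity at 0 is integrable: the integrals over [1/(n+2), 1] are at most
1/k, and monotone convergence passes to the limit. *)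
Lemma powR_integral_01_lty (k : R) : 0 < k ->
  (\int[mu]_(x in `]0%R, 1%R]) (x `^ (k - 1))%:E < +oo)%E.
Proof.
move=> k0; apply: (@le_lt_trans _ _ (k^-1)%:E); last exact: ltry.
pose F (n : nat) : set (measurableTypeR R) := `[n.+2%:R^-1, 1]%classic.
have -> : (`]0%R, 1%R]%classic : set R) = \bigcup_n F n.
  apply/seteqP; split => x /=.
    rewrite in_itv/= => /andP[x0 x1]; have [n xn] := ltr_add_invr x0.
    exists n => //=; rewrite /F /= in_itv/= x1 andbT.
    rewrite ltW// (le_lt_trans _ xn)// add0r.
    by rewrite lef_pV2 ?posrE// ler_nat.
  move=> [n _] /=; rewrite /F /= !in_itv/= => /andP[nx ->]; rewrite andbT.
  by apply: lt_le_trans nx; rewrite invr_gt0.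
have ndF : {homo F : n m / (n <= m)%N >-> (n <= m)%O}.
  move=> n m nm; apply/subsetPset => x; rewrite /F /= !in_itv/= => /andP[nx ->].
  by rewrite andbT (le_trans _ nx)// lef_pV2 ?posrE// ler_nat.
have cvgI := @ge0_nondecreasing_set_cvg_integral _ (measurableTypeR R) R F
  (fun x => (x `^ (k - 1))%:E) mu ndF.
rewrite -(cvg_lim _ (cvgI _ _ _))//.
- apply: lime_le; last by apply: nearW => n; exact: powR_integral_unit_le.
  by apply/cvg_ex; eexists; apply: cvgI => // [n|n|n x _];
    [exact: measurable_itv
    |apply/measurable_EFinP/measurable_funTS; exact: measurable_powRc
    |rewrite lee_fin powR_ge0].
- by move=> n; exact: measurable_itv.
- move=> n; apply/measurable_EFinP/measurable_funTS; exact: measurable_powRc.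
- by move=> n x _; rewrite lee_fin powR_ge0.
Qed.

(** A power is beaten by half of the exponential decay.  The bound is a multiple of
an exponential density, whose integral is 1. *)
Lemma gamma_fun_le (k x : R) (m : nat) : k - 1 <= m.+1%:R -> 1 <= x ->
  gamma_fun k x <= (m.+1)`!%:R * 2 ^+ m.+2 * exponential_pdf (1 / 2) x.
Proof.
move=> km x1; have x0 : 0 < x by exact: lt_le_trans x1.
rewrite /gamma_fun x0 mulr1n [leLHS]mul1r (exponential_pdfE _ (ltW x0)).
have xk : x `^ (k - 1) <= x ^+ m.+1.
  by rewrite -powR_mulrn ?(ltW x0)// ler_powR.
have h2 : x ^+ m.+1 <= (m.+1)`!%:R * 2 ^+ m.+1 * expR (x / 2).
  have := @expR_ge1Dxn _ (x / 2) m _; rewrite divr_ge0 ?(ltW x0)// => /(_ isT) h.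
  rewrite -mulrA -ler_pdivrMl ?ltr0n ?fact_gt0//.
  rewrite -ler_pdivrMl ?exprn_gt0// (le_trans _ h)//.
  rewrite expr_div_n; set F := (m.+1)`!%:R; set E := 2 ^+ _.
  have F0 : F != 0 by rewrite gt_eqF// ltr0n fact_gt0.
  have E0 : E != 0 by rewrite gt_eqF// exprn_gt0.
  rewrite (_ : E^-1 * _ = x ^+ m.+1 / E / F) ?lerDr//.
  by field; rewrite F0 E0.
rewrite (le_trans (ler_wpM2l _ (le_trans xk h2))) ?expR_ge0//.
rewrite [leLHS](_ : _ = m.+1`!%:R * 2 ^+ m.+2 *
  (1 / 2 * (expR (- x) * expR (x / 2)))); last by rewrite [2 ^+ m.+2]exprS; field.
apply: ler_wpM2l; first by rewrite mulr_ge0 ?exprn_ge0.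
apply: ler_wpM2l => //; rewrite -expRD ler_expR; lra.
Qed.

Lemma gammaI_lty k : 0 < k -> (gammaI k < +oo)%E.
Proof.
move=> k0; set m := Num.bound `|k - 1|.
have km : k - 1 <= m.+1%:R.
  apply: le_trans (ler_norm _) _; apply: ltW.
  by apply: lt_le_trans (archi_boundP (normr_ge0 _)) _; rewrite ler_nat.
have mg D : measurable_fun D (fun x => (gamma_fun k x)%:E).
  by apply/measurable_EFinP/measurable_funTS; exact: measurable_gamma_fun.
have g0 x : (0 <= (gamma_fun k x)%:E)%E by rewrite lee_fin gamma_fun_ge0.
pose C : R := (m.+1)`!%:R * 2 ^+ m.+2.
have C0 : 0 <= C by rewrite mulr_ge0 ?exprn_ge0.
pose p1 (x : R) : \bar R := if x \in `]0, 1]%R then (x `^ (k - 1))%:E else 0%E.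
pose p2 (x : R) : \bar R := (C * exponential_pdf (1 / 2) x)%:E.
have half0 : 0 < 1 / 2 :> R by [].
have mp1 : measurable_fun setT p1.
  apply: measurable_fun_if => //=.
  - apply: (measurable_fun_bool true); rewrite setTI.
    rewrite (_ : _ @^-1` _ = `]0, 1]%classic)//.
  - apply/measurable_EFinP/measurable_funTS; exact: measurable_powRc.
have p1_0 x : (0 <= p1 x)%E by rewrite /p1; case: ifP => // _; rewrite lee_fin powR_ge0.
have mp2 : measurable_fun setT p2.
  apply/measurable_EFinP/measurable_funM => //.
  exact: measurable_exponential_pdf.
have p2_0 x : (0 <= p2 x)%E.
  by rewrite lee_fin mulr_ge0// exponential_pdf_ge0.
have le12 x : ((gamma_fun k x)%:E <= p1 x + p2 x)%E.
  have [x0|x0] := leP x 0.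
    by rewrite /gamma_fun ltNge x0/= mul0r adde_ge0.
  have [x1|x1] := leP x 1.
    apply: (@le_trans _ _ (p1 x)); last by rewrite leeDl.
    rewrite /p1 in_itv/= x0 x1 lee_fin /gamma_fun x0 mulr1n mul1r.
    by rewrite ler_piMl ?powR_ge0// -expR0 ler_expR oppr_le0 ltW.
  apply: (@le_trans _ _ (p2 x)); last by rewrite leeDr.
  by rewrite lee_fin gamma_fun_le// ltW.
apply: (@le_lt_trans _ _ (\int[mu]_x (p1 x + p2 x))%E).
  apply: ge0_le_integral => //; [exact: mg|exact: emeasurable_funD].
rewrite ge0_integralD// lte_add_pinfty//.
  rewrite (_ : \int[mu]_x p1 x = \int[mu]_(x in `]0%R, 1%R]) (x `^ (k - 1))%:E)%E.
    exact: powR_integral_01_lty.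
  rewrite [RHS]integral_mkcond; apply: eq_integral => x _.
  by rewrite patchE /p1 mem_setE.
rewrite /p2; under eq_integral do rewrite EFinM.
rewrite ge0_integralZl//.
- by rewrite integral_exponential_pdf// mule1 ltry.
- by apply/measurable_EFinP; exact: measurable_exponential_pdf.
- by move=> x _; rewrite lee_fin exponential_pdf_ge0.
Qed.

Lemma gammaI_gt0 k : (0 < gammaI k)%E.
Proof.
have g0 x : (0 <= (gamma_fun k x)%:E)%E by rewrite lee_fin gamma_fun_ge0.
have mg D : measurable_fun D (fun x => (gamma_fun k x)%:E).
  by apply/measurable_EFinP/measurable_funTS; exact: measurable_gamma_fun.
rewrite lt_neqAle integral_ge0// andbT eq_sym; apply/eqP => I0.
have : (\int[mu]_x `|(gamma_fun k x)%:E| = 0)%E.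
  by rewrite -[RHS]I0; apply: eq_integral => x _; rewrite gee0_abs.
move/ae_eq_integral_abs => /(_ measurableT (mg _)) [N [mN N0 sN]].
(* The integrand has no zero on ]0, 1[, which has measure 1. *)
have : (mu `]0%R, 1%R[%classic <= mu N)%E.
  apply: le_measure; rewrite ?inE// => x /=; rewrite in_itv/= => /andP[x0 _].
  apply: sN => /= /(_ I) [] /eqP; rewrite /gamma_fun x0 mulr1n mul1r.
  by rewrite mulf_eq0 gt_eqF ?expR_gt0// gt_eqF ?powR_gt0.
by rewrite N0 lebesgue_measure_itv/= lte01 oppr0 adde0 lee_fin ler10.
Qed.

Lemma gammaI_fin k : 0 < k -> gammaI k \is a fin_num.
Proof.
by move=> k0; rewrite ge0_fin_numE ?gammaI_lty// ltW// gammaI_gt0.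
Qed.

Lemma fine_gammaI_gt0 k : 0 < k -> 0 < fine (gammaI k).
Proof. by move=> k0; rewrite fine_gt0// gammaI_gt0 gammaI_lty. Qed.

End gamma.

(** * The factor of an edge, and one step of elimination *)

Section arm_kernel.
Context {R : realType}.
Notation mu := (@lebesgue_measure R).
Implicit Types al be sg a r b h x : R.

Definition gt0_ind x : R := (0 < x)%R%:R.

Lemma gt0_ind_ge0 x : 0 <= gt0_ind x. Proof. exact: ler0n. Qed.

Lemma gt0_indT x : 0 < x -> gt0_ind x = 1. Proof. by rewrite /gt0_ind => ->. Qed.

Lemma gt0_indF x : x <= 0 -> gt0_ind x = 0.
Proof. by rewrite /gt0_ind ltNge => ->. Qed.

(** The factor of an edge: [a] is the diagonal entry at the end away from the root,
[r] the one at the end nearer to the root, [b] the entry in between.  The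
indicators are the conditions by which this edge restricts the cone. *)
Definition arm_fun al be sg a r b : R :=
  gt0_ind a * gt0_ind r * gt0_ind (a * r - b ^+ 2) *
  (expR (- (al * a + 2 * be * b))
   * ((a * r - b ^+ 2) `^ (sg - 3 / 2) * r `^ (1 - sg))).

Lemma arm_fun_ge0 al be sg a r b : 0 <= arm_fun al be sg a r b.
Proof. by rewrite !mulr_ge0 ?gt0_ind_ge0 ?expR_ge0 ?powR_ge0. Qed.

Lemma measurable_arm_fun d (T : measurableType d) al be sg (fa fr fb : T -> R) :
  measurable_fun setT fa -> measurable_fun setT fr -> measurable_fun setT fb ->
  measurable_fun setT (fun t => arm_fun al be sg (fa t) (fr t) (fb t)).
Proof.
move=> ma mr mb.
have mm : measurable_fun setT (fun t => fa t * fr t - fb t ^+ 2).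
  by apply: measurable_funB; [exact: measurable_funM|exact: measurable_funX].
repeat apply: measurable_funM; try exact: measurable_gt0.
- apply: measurable_expRc; apply: measurable_funN.
  by apply: measurable_funD; apply: measurable_funM.
- exact: measurable_powRc.
- exact: measurable_powRc.
Qed.

(** An exponential of the entry [a] only shifts the parameter [al]: this is what
chains the integrations along the path. *)
Lemma arm_funMexp al be sg a r b h :
  arm_fun al be sg a r b * (gt0_ind a * expR (h * a)) =
  arm_fun (al - h) be sg a r b.
Proof.
rewrite /arm_fun; set P := _ `^ _ * _.
have pp : gt0_ind a * gt0_ind a = gt0_ind a by rewrite /gt0_ind; case: (0 < a); rewrite ?mulr1 ?mulr0.
have ee : expR (- (al * a + 2 * be * b)) * expR (h * a) =
    expR (- ((al - h) * a + 2 * be * b)).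
  by rewrite -expRD; congr expR; ring.
by rewrite -ee -[in RHS]pp; ring.
Qed.

Definition root_fun al sg r : R := gt0_ind r * (expR (- (al * r)) * r `^ (sg - 1)).

Lemma root_fun_ge0 al sg r : 0 <= root_fun al sg r.
Proof. by rewrite !mulr_ge0 ?gt0_ind_ge0 ?expR_ge0 ?powR_ge0. Qed.

Lemma measurable_root_fun d (T : measurableType d) al sg (fr : T -> R) :
  measurable_fun setT fr ->
  measurable_fun setT (fun t => root_fun al sg (fr t)).
Proof.
move=> mr; apply: measurable_funM; first exact: measurable_gt0.
apply: measurable_funM; last exact: measurable_powRc.
by apply: measurable_expRc; apply: measurable_funN; exact: measurable_funM.
Qed.

Lemma root_funMexp al sg r h :
  root_fun al sg r * (gt0_ind r * expR (h * r)) = root_fun (al - h) sg r.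
Proof.
rewrite /root_fun; set P := _ `^ _.
have pp : gt0_ind r * gt0_ind r = gt0_ind r by rewrite /gt0_ind; case: (0 < r); rewrite ?mulr1 ?mulr0.
have ee : expR (- (al * r)) * expR (h * r) = expR (- ((al - h) * r)).
  by rewrite -expRD; congr expR; ring.
by rewrite -ee -[in RHS]pp; ring.
Qed.

Definition root_cst sg : R := fine (gammaI sg).

Lemma gt0_indM x y : 0 < x -> gt0_ind (x * y) = gt0_ind y.
Proof. by move=> x0; rewrite /gt0_ind pmulr_rgt0. Qed.

Lemma integral_root_fun al sg : 0 < al -> 0 < sg ->
  (\int[mu]_r (root_fun al sg r)%:E = (root_cst sg * al `^ (- sg))%:E)%E.
Proof.
move=> al0 sg0; have ial0 : 0 < al^-1 by rewrite invr_gt0.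
rewrite (@ge0_integral_affine _ al^-1 0 ial0); last 2 first.
- by apply/measurable_EFinP; exact: measurable_root_fun.
- by move=> x; rewrite lee_fin root_fun_ge0.
under eq_integral => x _.
  rewrite addr0 (_ : root_fun _ _ _ = al `^ (1 - sg) * gamma_fun sg x); first over.
  rewrite /root_fun gt0_indM// mulVKf ?gt_eqF// /gamma_fun -/(gt0_ind x).
  have [x0|x0] := leP x 0; first by rewrite gt0_indF// !mul0r mulr0.
  rewrite powRM ?(ltW x0) ?(ltW ial0)//.
  rewrite (_ : al^-1 `^ (sg - 1) = al `^ (1 - sg)); first by ring.
  rewrite -(powR_inv1 (ltW al0)) -powRrM; congr (_ `^ _); ring.
under eq_integral do rewrite EFinM.
rewrite ge0_integralZl//.
- rewrite -/(gammaI sg) -[gammaI sg]fineK ?gammaI_fin// -!EFinM; congr EFin.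
  rewrite /root_cst mulrA -{1}(powR_inv1 (ltW al0)) -powRD; last first.
    by rewrite (gt_eqF al0) implybT.
  by rewrite mulrC; congr (_ * _ `^ _); ring.
- by apply/measurable_EFinP; exact: measurable_gamma_fun.
- by move=> x _; rewrite lee_fin gamma_fun_ge0.
- by rewrite lee_fin powR_ge0.
Qed.

(** Under [a = x / al + b ^+ 2 / r] the minor [a * r - b ^+ 2] becomes
[(r / al) * x], and a Gamma integral remains. *)
Lemma integral_arm_child al be sg r b : 0 < al -> 1 / 2 < sg -> 0 < r ->
  (\int[mu]_a (arm_fun al be sg a r b)%:E =
   (fine (gammaI (sg - 1 / 2)) * al `^ (1 / 2 - sg) * r `^ (- (1 / 2))
    * expR (- (al / r * b ^+ 2 + 2 * be * b)))%:E)%E.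
Proof.
move=> al0 sg0 r0; have ial0 : 0 < al^-1 by rewrite invr_gt0.
have r_neq0 : r != 0 by rewrite gt_eqF.
have al_neq0 : al != 0 by rewrite gt_eqF.
rewrite (@ge0_integral_affine _ al^-1 (b ^+ 2 / r) ial0); last 2 first.
- by apply/measurable_EFinP; exact: measurable_arm_fun.
- by move=> x; rewrite lee_fin arm_fun_ge0.
set E := expR _.
under eq_integral => x _.
  rewrite (_ : arm_fun _ _ _ _ _ _ =
    (al `^ (3 / 2 - sg) * r `^ (- (1 / 2)) * E) * gamma_fun (sg - 1 / 2) x).
    over.
  rewrite /arm_fun /gamma_fun -/(gt0_ind x).
  rewrite (_ : (al^-1 * x + b ^+ 2 / r) * r - b ^+ 2 = (r / al) * x); last first.
    by field; rewrite r_neq0 al_neq0.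
  rewrite (gt0_indM _ (divr_gt0 r0 al0)).
  have [x0|x0] := leP x 0; first by rewrite (gt0_indF x0) !(mul0r, mulr0).
  rewrite gt0_indT; last first.
    by rewrite ltr_pwDl ?mulr_gt0// divr_ge0 ?sqr_ge0 ?(ltW r0).
  rewrite !gt0_indT// powRM ?(ltW x0) ?divr_ge0 ?(ltW r0) ?(ltW al0)//.
  rewrite powRM ?(ltW r0) ?(ltW ial0)//.
  rewrite (_ : al^-1 `^ (sg - 3 / 2) = al `^ (3 / 2 - sg)); last first.
    by rewrite -(powR_inv1 (ltW al0)) -powRrM; congr (_ `^ _); ring.
  rewrite (_ : sg - 1 / 2 - 1 = sg - 3 / 2); last by field.
  rewrite (_ : - (1 / 2) = (sg - 3 / 2) + (1 - sg)); last by field.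
  rewrite [r `^ (_ + (1 - sg))]powRD; last by rewrite r_neq0 implybT.
  rewrite (_ : expR _ = expR (- x) * E); first by ring.
  by rewrite /E -expRD; congr expR; field; rewrite r_neq0 al_neq0.
under eq_integral do rewrite EFinM.
have g0 : 0 < sg - 1 / 2 by rewrite subr_gt0.
rewrite ge0_integralZl//.
- rewrite -/(gammaI _) -[gammaI _]fineK ?gammaI_fin// -!EFinM; congr EFin.
  rewrite (_ : 1 / 2 - sg = -1 + (3 / 2 - sg)); last by field.
  rewrite [al `^ (-1 + _)]powRD; last by rewrite al_neq0 implybT.
  by rewrite powR_inv1 ?(ltW al0)//; ring.
- by apply/measurable_EFinP; exact: measurable_gamma_fun.
- by move=> x _; rewrite lee_fin gamma_fun_ge0.
- by rewrite lee_fin !mulr_ge0 ?powR_ge0 ?expR_ge0.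
Qed.

(** Completing the square, then scaling by the square root of [u]. *)
Lemma integral_gauss_quad u v : 0 < u ->
  (\int[mu]_b (expR (- (u * b ^+ 2 + 2 * v * b)))%:E =
   (u `^ (- (1 / 2)) * Num.sqrt pi * expR (v ^+ 2 / u))%:E)%E.
Proof.
move=> u0; have u_neq0 : u != 0 by rewrite gt_eqF.
set k := u `^ (- (1 / 2)).
have k0 : 0 < k by rewrite powR_gt0.
have kk : k * k = u^-1.
  rewrite /k -powRD; last by rewrite u_neq0 implybT.
  by rewrite -(powR_inv1 (ltW u0)); congr (_ `^ _); field.
have k2 : u * (k * k) = 1 by rewrite kk mulfV.
rewrite (@ge0_integral_affine _ k (- (v / u)) k0); last 2 first.
- apply/measurable_EFinP; apply: measurable_expRc; apply: measurable_funN.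
  by apply: measurable_funD; apply: measurable_funM => //; exact: measurable_funX.
- by move=> x; rewrite lee_fin expR_ge0.
under eq_integral => x _.
  rewrite (_ : expR _ = expR (v ^+ 2 / u) * gauss_fun x); first over.
  rewrite /gauss_fun -expRD; congr expR.
  transitivity (v ^+ 2 / u - (u * (k * k)) * x ^+ 2); last by rewrite k2 mul1r.
  by field.
under eq_integral do rewrite EFinM.
rewrite ge0_integralZl//.
- by rewrite integralT_gauss -!EFinM; congr EFin; ring.
- by apply/measurable_EFinP; exact: measurable_gauss_fun.
- by move=> x _; rewrite lee_fin gauss_fun_ge0.
Qed.

Definition arm_marg al be sg a r : \bar R :=
  (\int[mu]_b (arm_fun al be sg a r b)%:E)%E.

Lemma arm_marg_ge0 al be sg a r : (0 <= arm_marg al be sg a r)%E.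
Proof. by apply: integral_ge0 => b _; rewrite lee_fin arm_fun_ge0. Qed.

Lemma arm_marg_npos al be sg a r : r <= 0 -> arm_marg al be sg a r = 0%E.
Proof.
move=> r0; rewrite /arm_marg; apply: integral0_eq => b _.
by rewrite /arm_fun (gt0_indF r0) mulr0 !mul0r.
Qed.

Lemma measurable_arm_marg d (T : measurableType d) al be sg (fa fr : T -> R) :
  measurable_fun setT fa -> measurable_fun setT fr ->
  measurable_fun setT (fun t => arm_marg al be sg (fa t) (fr t)).
Proof.
move=> ma mr.
apply: (@measurable_fun_fubini_tonelli_F _ _ _ (measurableTypeR R) R mu
  (fun p : T * measurableTypeR R => (arm_fun al be sg (fa p.1) (fr p.1) p.2)%:E)).
- apply/measurable_EFinP; apply: measurable_arm_fun.
  + by apply: measurableT_comp => //; exact: measurable_fst.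
  + by apply: measurableT_comp => //; exact: measurable_fst.
  + exact: measurable_snd.
- by move=> p; rewrite lee_fin arm_fun_ge0.
Qed.

Lemma arm_margMexp al be sg a r h :
  (arm_marg al be sg a r * (gt0_ind a * expR (h * a))%:E =
   arm_marg (al - h) be sg a r)%E.
Proof.
rewrite /arm_marg -ge0_integralZr//.
- by apply: eq_integral => b _; rewrite -EFinM arm_funMexp.
- by apply/measurable_EFinP; exact: measurable_arm_fun.
- by move=> b _; rewrite lee_fin arm_fun_ge0.
- by rewrite lee_fin mulr_ge0 ?gt0_ind_ge0 ?expR_ge0.
Qed.

Definition arm_cst sg : R := fine (gammaI (sg - 1 / 2)) * Num.sqrt pi.

Lemma arm_cst_gt0 sg : 1 / 2 < sg -> 0 < arm_cst sg.
Proof.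
by move=> s0; rewrite mulr_gt0 ?fine_gammaI_gt0 ?subr_gt0// sqrtr_gt0 pi_gt0.
Qed.

(** One step of elimination.  The Gamma integral leaves the power -1/2 of [r], the
Gaussian integral gives 1/2, so that the result is a pure exponential of [r]. *)
Lemma integral_arm_marg al be sg r : 0 < al -> 1 / 2 < sg ->
  (\int[mu]_a arm_marg al be sg a r =
   (arm_cst sg * al `^ (- sg) * (gt0_ind r * expR (be ^+ 2 / al * r)))%:E)%E.
Proof.
move=> al0 sg0; have [r0|r0] := leP r 0.
  rewrite gt0_indF// mul0r mulr0; apply: integral0_eq => a _.
  exact: arm_marg_npos.
have al_neq0 : al != 0 by rewrite gt_eqF.
have r_neq0 : r != 0 by rewrite gt_eqF.
rewrite gt0_indT// mul1r.
pose f := (fun p : measurableTypeR R * measurableTypeR R =>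
  (arm_fun al be sg p.1 r p.2)%:E).
rewrite (@fubini_tonelli _ _ (measurableTypeR R) (measurableTypeR R) R mu mu f); last 2 first.
- by apply/measurable_EFinP; apply: measurable_arm_fun.
- by move=> p; rewrite lee_fin arm_fun_ge0.
under eq_integral do rewrite /f /= integral_arm_child// EFinM.
have g0 : 0 < fine (gammaI (sg - 1 / 2)).
  by rewrite fine_gammaI_gt0// subr_gt0.
rewrite ge0_integralZl//.
- rewrite integral_gauss_quad ?divr_gt0// -EFinM; congr EFin.
  rewrite /arm_cst powRM ?(ltW al0) ?invr_ge0 ?(ltW r0)//.
  rewrite (_ : r^-1 `^ _ = r `^ (1 / 2)); last first.
    by rewrite -(powR_inv1 (ltW r0)) -powRrM; congr (_ `^ _); ring.
  rewrite (_ : be ^+ 2 / (al / r) = be ^+ 2 / al * r); last first.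
    by field; rewrite al_neq0 r_neq0.
  have hr : r `^ (- (1 / 2)) * r `^ (1 / 2) = 1.
    by rewrite -powRD ?r_neq0 ?implybT// addNr powRr0.
  have ha : al `^ (1 / 2 - sg) * al `^ (- (1 / 2)) = al `^ (- sg).
    rewrite -powRD ?al_neq0 ?implybT//; congr (_ `^ _); ring.
  rewrite -ha -[RHS]mulr1 -[X in _ = _ * X]hr; ring.
- apply/measurable_EFinP; apply: measurable_expRc; apply: measurable_funN.
  by apply: measurable_funD; apply: measurable_funM => //; exact: measurable_funX.
- by rewrite lee_fin !mulr_ge0 ?powR_ge0// ltW.
Qed.

End arm_kernel.

(** * Iterated integrals over row vectors *)

Arguments rV_at : simpl never.

Section integral_rV.
Context {R : realType}.
Notation mu := (@lebesgue_measure R).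

Lemma measurable_cons_rV m : measurable_fun setT (@cons_rV R m).
Proof.
apply: measurable_rVP => i.
have [j ->|->] := unliftP ord0 i.
  under eq_fun do rewrite cons_rVS.
  apply: (measurableT_comp (measurable_coord_rV j)).
  exact: measurable_snd.
by under eq_fun do rewrite cons_rV0; exact: measurable_fst.
Qed.

Lemma ge0_integral_rVS m (f : 'rV[R]_m.+1 -> \bar R) :
  measurable_fun setT f -> (forall u, (0 <= f u)%E) ->
  (\int[lebesgue_rV R m.+1]_u f u =
   \int[mu]_x \int[lebesgue_rV R m]_u f (cons_rV (x, u)))%E.
Proof.
move=> mf f0.
have := @ge0_integral_pushforward _ _ _ _ R (@cons_rV R m)
  (@measurable_cons_rV m) (mu \x lebesgue_rV R m)%E setT f measurableT mf.
move=> /(_ (fun u _ => f0 u)) ->.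
rewrite preimage_setT -(@fubini_tonelli1 _ _ (measurableTypeR R) _ R mu (lebesgue_rV R m) (f \o (@cons_rV R m)))//.
- exact: measurableT_comp (@measurable_cons_rV m).
- by move=> x /=.
Qed.

Lemma ge0_integral_rVS_swap m (f : 'rV[R]_m.+1 -> \bar R) :
  measurable_fun setT f -> (forall u, (0 <= f u)%E) ->
  (\int[lebesgue_rV R m.+1]_u f u =
   \int[lebesgue_rV R m]_u \int[mu]_x f (cons_rV (x, u)))%E.
Proof.
move=> mf f0; rewrite ge0_integral_rVS//.
rewrite (@fubini_tonelli _ _ (measurableTypeR R) _ R mu (lebesgue_rV R m) (f \o (@cons_rV R m)))//.
- exact: measurableT_comp (@measurable_cons_rV m).
- by move=> x /=.
Qed.

Lemma integral_rV0 (f : 'rV[R]_0 -> \bar R) :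
  (\int[lebesgue_rV R 0]_u f u = f 0%R)%E.
Proof.
have fE : f = cst (f 0) by apply/funext => u; rewrite /cst (thinmx0 u).
rewrite integral_dirac//; first by rewrite diracT mul1e.
by rewrite fE; exact: measurable_cst.
Qed.

Lemma measurable_cons_rVc d (T : measurableType d) m
    (fx : T -> R) (fu : T -> 'rV[R]_m) :
  measurable_fun setT fx -> measurable_fun setT fu ->
  measurable_fun setT (fun t => cons_rV (fx t, fu t)).
Proof.
move=> mx mu'; apply: (measurableT_comp (@measurable_cons_rV m)).
exact: measurable_fun_pair.
Qed.

Lemma measurable_row_mxc d (T : measurableType d) p q
    (fu : T -> 'rV[R]_p) (fv : T -> 'rV[R]_q) :
  measurable_fun setT fu -> measurable_fun setT fv ->
  measurable_fun setT (fun t => row_mx (fu t) (fv t)).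
Proof.
move=> mu' mv; apply: measurable_rVP => i; case: (split_ordP i) => j ->.
- under eq_fun do rewrite row_mxEl.
  exact: (measurableT_comp (measurable_coord_rV j)).
- under eq_fun do rewrite row_mxEr.
  exact: (measurableT_comp (measurable_coord_rV j)).
Qed.

Lemma row_mx_cons p q (x : R) (u : 'rV[R]_p) (v : 'rV[R]_q) :
  row_mx (cons_rV (x, u)) v = cons_rV (x, row_mx u v) :> 'rV[R]_(p + q).+1.
Proof.
apply/rowP => i; have [j ->|->] := unliftP ord0 i.
- rewrite cons_rVS /=; case: (split_ordP j) => k ->.
  + rewrite row_mxEl -(cons_rVS (x, u)) -(row_mxEl (cons_rV (x, u)) v).
    by congr (_ _ _); exact/val_inj.
  + rewrite row_mxEr -(row_mxEr (cons_rV (x, u)) v).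
    by congr (_ _ _); exact/val_inj.
- rewrite cons_rV0 -[RHS](cons_rV0 (x, u)) -(row_mxEl (cons_rV (x, u)) v).
  by congr (_ _ _); exact/val_inj.
Qed.

(** Induction on [p]: both sides have the same first coordinate. *)
Lemma ge0_integral_row_mx p q (f : 'rV[R]_(p + q) -> \bar R) :
  measurable_fun setT f -> (forall u, (0 <= f u)%E) ->
  (\int[lebesgue_rV R (p + q)]_w f w =
   \int[lebesgue_rV R p]_u \int[lebesgue_rV R q]_v f (row_mx u v))%E.
Proof.
elim: p f => [|p IH] f mf f0.
  rewrite integral_rV0; apply: eq_integral => v _.
  by rewrite row_thin_mx.
have -> : (\int[lebesgue_rV R (p.+1 + q)]_w f w =
  \int[mu]_x \int[lebesgue_rV R (p + q)]_w f (cons_rV (x, w)))%E.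
  exact: ge0_integral_rVS.
rewrite ge0_integral_rVS; last 2 first.
- apply: (@measurable_fun_fubini_tonelli_F _ _ _ _ R (lebesgue_rV R q)
    (fun p => f (row_mx p.1 p.2))) => //.
  apply: (measurableT_comp mf); apply: measurable_row_mxc;
    [exact: measurable_fst|exact: measurable_snd].
- by move=> u; apply: integral_ge0.
apply: eq_integral => x _; rewrite IH//.
- by under eq_integral do under eq_integral do rewrite -row_mx_cons.
- apply: (measurableT_comp mf); apply: measurable_cons_rVc => //.
Qed.

Lemma rV_at_ord m (u : 'rV[R]_m) (i : 'I_m) : rV_at u i.+1 = u 0 i.
Proof. by rewrite /rV_at valK. Qed.

Lemma rV_at_ge m (u : 'rV[R]_m) k : (m <= k)%N -> rV_at u k.+1 = 0.
Proof. by move=> mk; rewrite /rV_at insubF// ltnNge mk. Qed.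

Lemma rV_at_cons1 m x (u : 'rV[R]_m) : rV_at (cons_rV (x, u)) 1 = x.
Proof. by rewrite (rV_at_ord _ (ord0 : 'I_m.+1)) cons_rV0. Qed.

Lemma rV_at_consS m x (u : 'rV[R]_m) k :
  rV_at (cons_rV (x, u)) k.+2 = rV_at u k.+1.
Proof.
have [km|mk] := ltnP k m; last by rewrite !rV_at_ge.
rewrite (rV_at_ord u (Ordinal km)) -(cons_rVS (x, u)) -rV_at_ord.
by congr rV_at.
Qed.

Lemma measurable_rV_at d (T : measurableType d) m (fu : T -> 'rV[R]_m) k :
  measurable_fun setT fu -> measurable_fun setT (fun t => rV_at (fu t) k).
Proof.
move=> mfu; case: k => [|k]; first exact: measurable_cst.
have [km|mk] := ltnP k m.
  under eq_fun do rewrite (rV_at_ord _ (Ordinal km)).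
  exact: (measurableT_comp (measurable_coord_rV _)).
by under eq_fun do rewrite rV_at_ge//; exact: measurable_cst.
Qed.

Lemma emeasurable_prod d (T : measurableType d) k (f : nat -> T -> \bar R) :
  (forall i, measurable_fun setT (f i)) ->
  measurable_fun setT (fun t => \prod_(i < k) f i t)%E.
Proof.
move=> mf; elim: k => [|k IH].
  by under eq_fun do rewrite big_ord0; exact: measurable_cst.
under eq_fun do rewrite big_ord_recr/=.
exact: emeasurable_funM.
Qed.

(** For a fixed diagonal each off-diagonal entry occurs in the factor of its own
edge only; this lemma integrates all of them at once. *)
Lemma ge0_integral_rV_prod k (f : nat -> R -> \bar R) :
  (forall i, measurable_fun setT (f i)) -> (forall i x, (0 <= f i x)%E) ->
  (\int[lebesgue_rV R k]_u \prod_(i < k) f i (rV_at u i.+1) =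
   \prod_(i < k) \int[mu]_x f i x)%E.
Proof.
move=> + f0; elim: k f f0 => [|k IH] f f0 mf.
  by rewrite integral_rV0 !big_ord0.
have mprod m (g : nat -> R -> \bar R) : (forall i, measurable_fun setT (g i)) ->
    measurable_fun setT (fun u : 'rV[R]_m => \prod_(i < m) g i (rV_at u i.+1))%E.
  move=> mg; apply: (@emeasurable_prod _ _ m (fun i u => g i (rV_at u i.+1))) => i.
  by apply: (measurableT_comp (mg i)); exact: measurable_rV_at.
rewrite ge0_integral_rVS; last 2 first.
- exact: mprod.
- by move=> u; exact: prode_ge0.
rewrite big_ord_recl [X in (_ * X)%E](_ : _ =
    \prod_(i < k) \int[mu]_x f i.+1 x)%E; last exact: eq_bigr.
rewrite -(IH (fun i => f i.+1))//.
rewrite -ge0_integralZr//; last 2 first.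
- exact: mf.
- by apply: integral_ge0 => u _; exact: prode_ge0.
apply: eq_integral => x _.
rewrite -ge0_integralZl//.
- apply: eq_integral => u _; rewrite big_ord_recl rV_at_cons1; congr (_ * _)%E.
  by apply: eq_bigr => i _; rewrite rV_at_consS.
- by apply: (mprod k (fun i => f i.+1)).
- by move=> u _; exact: prode_ge0.
Qed.

End integral_rV.

(** * Integration from the leaves to the root *)

Section pivots.
Context {R : realType}.
Implicit Types al be : nat -> R.

(** The amount that eliminating the vertices before [j] subtracts from the diagonal
entry [al j] of the tridiagonal matrix with diagonal [al] and off-diagonal [be]. *)
Fixpoint elim_gain al be (j : nat) : R :=
  if j is i.+1 then be i ^+ 2 / (al i - elim_gain al be i) else 0.

Definition pivot al be j : R := al j - elim_gain al be j.

Lemma elim_gainS al be j : elim_gain al be j.+1 = be j ^+ 2 / pivot al be j.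
Proof. by []. Qed.

End pivots.

Section arms.
Context {R : realType}.
Notation mu := (@lebesgue_measure R).
Variables (alR beR sgR : nat -> R).

(** The neighbour on the side of the root, which is the root itself for the first
vertex of the arm. *)
Definition pred_coord m (r : R) (u : 'rV[R]_m) (i : nat) : R :=
  if i is j.+1 then rV_at u j.+1 else r.

(** Parameters are numbered from the leaf and coordinates from the root: elimination
starts at the leaf, while the measure is peeled off at the vertex next to the root. *)
Definition right_arm k (r : R) (u : 'rV[R]_k) : \bar R :=
  (\prod_(i < k) arm_marg (alR (k - i.+1)) (beR (k - i.+1)) (sgR (k - i.+1))
     (rV_at u i.+1) (pred_coord r u i))%E.

Definition arm_factor (al be sg : nat -> R) j : R :=
  arm_cst (sg j) * pivot al be j `^ (- sg j).

Lemma right_arm_ge0 k r (u : 'rV[R]_k) : (0 <= right_arm r u)%E.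
Proof. by apply: prode_ge0 => i _; exact: arm_marg_ge0. Qed.

Lemma measurable_right_arm d (T : measurableType d) k (fr : T -> R)
    (fu : T -> 'rV[R]_k) :
  measurable_fun setT fr -> measurable_fun setT fu ->
  measurable_fun setT (fun t => right_arm (fr t) (fu t)).
Proof.
move=> mr mu'; apply: (@emeasurable_prod _ _ _ k (fun i t =>
  arm_marg (alR (k - i.+1)) (beR (k - i.+1)) (sgR (k - i.+1))
     (rV_at (fu t) i.+1) (pred_coord (fr t) (fu t) i))) => i.
apply: measurable_arm_marg; first exact: measurable_rV_at.
by case: i => [|i] //=; exact: measurable_rV_at.
Qed.

Lemma right_armS k r x (u : 'rV[R]_k) :
  right_arm r (cons_rV (x, u)) =
  (arm_marg (alR k) (beR k) (sgR k) x r * right_arm x u)%E.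
Proof.
have gen (F : nat -> R -> R -> \bar R) :
    (\prod_(i < k.+1) F (k.+1 - i.+1)%N (rV_at (cons_rV (x, u)) i.+1)
       (pred_coord r (cons_rV (x, u)) i) =
     F k x r * \prod_(i < k) F (k - i.+1)%N (rV_at u i.+1) (pred_coord x u i))%E.
  rewrite big_ord_recl rV_at_cons1 subn1 /=; congr (_ * _)%E.
  apply: eq_bigr => i _; rewrite /bump /= add1n subSS rV_at_consS.
  by case: i => -[|i] ik //=; rewrite ?rV_at_cons1 ?rV_at_consS.
exact: (gen (fun j => arm_marg (alR j) (beR j) (sgR j))).
Qed.

(** By induction the rest of the arm contributes an exponential of the entry next to
the root, which turns the parameter of that entry into its pivot. *)
Lemma integral_right_arm k r :
  (forall j, (j < k)%N -> 0 < pivot alR beR j) ->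
  (forall j, (j < k)%N -> 1 / 2 < sgR j) -> 0 < r ->
  (\int[lebesgue_rV R k]_u right_arm r u =
   (\prod_(j < k) arm_factor alR beR sgR j * expR (elim_gain alR beR k * r))%:E)%E.
Proof.
elim: k r => [|k IH] r p0 s0 r0.
  rewrite integral_rV0 /right_arm !big_ord0 mul0r expR0 mulr1//.
rewrite ge0_integral_rVS; last 2 first.
- exact: measurable_right_arm.
- exact: right_arm_ge0.
set C := \prod_(j < k) arm_factor alR beR sgR j.
have C0 : 0 <= C.
  apply: prodr_ge0 => j _; rewrite mulr_ge0 ?powR_ge0// ltW// arm_cst_gt0// s0//.
  by rewrite ltnW// ltnS.
transitivity (\int[mu]_x (C%:E *
    arm_marg (pivot alR beR k) (beR k) (sgR k) x r))%E.
  apply: eq_integral => x _.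
  under eq_integral do rewrite right_armS.
  rewrite ge0_integralZl//; last 3 first.
  - exact: measurable_right_arm.
  - by move=> u _; exact: right_arm_ge0.
  - exact: arm_marg_ge0.
  have [x0|x0] := leP x 0.
    (* For [x <= 0] the induction hypothesis fails, but the indicator in the factor
       of the edge vanishes. *)
    have z al : arm_marg al (beR k) (sgR k) x r = 0%E.
      rewrite /arm_marg; apply: integral0_eq => b _.
      by rewrite /arm_fun (gt0_indF x0) !mul0r.
    by rewrite !z mul0e mule0.
  rewrite IH//; last 2 first.
  - by move=> j jk; exact/p0/ltnW.
  - by move=> j jk; exact/s0/ltnW.
  rewrite -/C EFinM muleCA; congr (_ * _)%E.
  by rewrite /pivot -arm_margMexp gt0_indT// mul1r.
rewrite ge0_integralZl//; last 2 first.
- exact: measurable_arm_marg.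
- by move=> x _; exact: arm_marg_ge0.
rewrite integral_arm_marg ?p0 ?s0// -EFinM; congr EFin.
by rewrite big_ord_recr -/C gt0_indT// mul1r elim_gainS /arm_factor mulrA.
Qed.

Variables (alL beL sgL : nat -> R) (alr sgr : R).

Definition root_arm_rest o m k (u : 'rV[R]_(m + k).+1) : \bar R :=
  (\prod_(i < m) arm_marg (alL (o + i)) (beL (o + i)) (sgL (o + i))
      (rV_at u i.+1) (rV_at u i.+2) *
   ((root_fun alr sgr (rV_at u m.+1))%:E *
   \prod_(i < k) arm_marg (alR (k - i.+1)) (beR (k - i.+1)) (sgR (k - i.+1))
      (rV_at u (m + i).+2) (rV_at u (m + i).+1)))%E.

(** The first factor is what the [o] vertices already eliminated on the left leave
behind. *)
Definition root_arm o m k (u : 'rV[R]_(m + k).+1) : \bar R :=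
  ((gt0_ind (rV_at u 1) * expR (elim_gain alL beL o * rV_at u 1))%:E *
   root_arm_rest o u)%E.

Lemma root_arm_rest_ge0 o m k u : (0 <= @root_arm_rest o m k u)%E.
Proof.
apply: mule_ge0; first by apply: prode_ge0 => i _; exact: arm_marg_ge0.
apply: mule_ge0; first by rewrite lee_fin root_fun_ge0.
by apply: prode_ge0 => i _; exact: arm_marg_ge0.
Qed.

Lemma root_arm0 o k x (u : 'rV[R]_k) :
  @root_arm o 0 k (cons_rV (x, u)) =
  ((gt0_ind x * expR (elim_gain alL beL o * x))%:E *
   ((root_fun alr sgr x)%:E * right_arm x u))%E.
Proof.
rewrite /root_arm /root_arm_rest big_ord0 mul1e rV_at_cons1; congr (_ * (_ * _))%E.
have gen (F : nat -> R -> R -> \bar R) :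
    (\prod_(i < k) F (k - i.+1)%N (rV_at (cons_rV (x, u)) (0 + i).+2)
       (rV_at (cons_rV (x, u)) (0 + i).+1) =
     \prod_(i < k) F (k - i.+1)%N (rV_at u i.+1) (pred_coord x u i))%E.
  apply: eq_bigr => i _; rewrite add0n rV_at_consS.
  by case: i => -[|i] ik; rewrite ?rV_at_cons1 ?rV_at_consS.
exact: (gen (fun j => arm_marg (alR j) (beR j) (sgR j))).
Qed.

Lemma root_armS o m k x (u : 'rV[R]_(m + k).+1) :
  @root_arm o m.+1 k (cons_rV (x, u)) =
  ((gt0_ind x * expR (elim_gain alL beL o * x))%:E *
   (arm_marg (alL o) (beL o) (sgL o) x (rV_at u 1) *
    root_arm_rest o.+1 u))%E.
Proof.
rewrite /root_arm /root_arm_rest rV_at_cons1 rV_at_consS; congr (_ * _)%E.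
have gen (F G : nat -> R -> R -> \bar R) (c : \bar R) :
    (\prod_(i < m.+1) F (o + i)%N (rV_at (cons_rV (x, u)) i.+1)
       (rV_at (cons_rV (x, u)) i.+2) *
     (c * \prod_(i < k) G (k - i.+1)%N (rV_at (cons_rV (x, u)) (m.+1 + i).+2)
       (rV_at (cons_rV (x, u)) (m.+1 + i).+1)) =
     F o x (rV_at u 1) * (\prod_(i < m) F (o.+1 + i)%N (rV_at u i.+1) (rV_at u i.+2) *
       (c * \prod_(i < k) G (k - i.+1)%N (rV_at u (m + i).+2) (rV_at u (m + i).+1))))%E.
  rewrite big_ord_recl addn0 rV_at_cons1 rV_at_consS -muleA; congr (_ * (_ * (_ * _)))%E.
    by apply: eq_bigr => i _; rewrite lift0 !rV_at_consS addSnnS.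
  by apply: eq_bigr => i _; rewrite addSn !rV_at_consS.
exact: (gen (fun j => arm_marg (alL j) (beL j) (sgL j))
  (fun j => arm_marg (alR j) (beR j) (sgR j))).
Qed.

Lemma root_arm_ge0 o m k u : (0 <= @root_arm o m k u)%E.
Proof.
apply: mule_ge0; last exact: root_arm_rest_ge0.
by rewrite lee_fin mulr_ge0 ?gt0_ind_ge0 ?expR_ge0.
Qed.

Lemma measurable_root_arm d (T : measurableType d) o m k
    (fu : T -> 'rV[R]_(m + k).+1) :
  measurable_fun setT fu -> measurable_fun setT (fun t => root_arm o (fu t)).
Proof.
move=> mu'; rewrite /root_arm /root_arm_rest.
have mat i : measurable_fun setT (fun t => rV_at (fu t) i) by exact: measurable_rV_at.
apply: emeasurable_funM.
  apply/measurable_EFinP; apply: measurable_funM; first exact: measurable_gt0.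
  by apply: measurable_expRc; exact: measurable_funM.
apply: emeasurable_funM.
  apply: (@emeasurable_prod _ _ _ m (fun i t => arm_marg (alL (o + i))
    (beL (o + i)) (sgL (o + i)) (rV_at (fu t) i.+1) (rV_at (fu t) i.+2))) => i.
  exact: measurable_arm_marg.
apply: emeasurable_funM.
  by apply/measurable_EFinP; exact: measurable_root_fun.
apply: (@emeasurable_prod _ _ _ k (fun i t => arm_marg (alR (k - i.+1))
  (beR (k - i.+1)) (sgR (k - i.+1)) (rV_at (fu t) (m + i).+2)
  (rV_at (fu t) (m + i).+1))) => i.
exact: measurable_arm_marg.
Qed.

(** Induction on the length of the left arm: its first coordinate is a leaf, which is
integrated first, and [o] increases.  Once the arm is exhausted the first
coordinate is the root, which receives the exponentials of both arms. *)
Lemma integral_root_arm o m k :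
  (forall j, (o <= j < o + m)%N -> 0 < pivot alL beL j) ->
  (forall j, (o <= j < o + m)%N -> 1 / 2 < sgL j) ->
  (forall j, (j < k)%N -> 0 < pivot alR beR j) ->
  (forall j, (j < k)%N -> 1 / 2 < sgR j) ->
  0 < alr - elim_gain alL beL (o + m) - elim_gain alR beR k -> 0 < sgr ->
  (\int[lebesgue_rV R (m + k).+1]_u root_arm o u =
   (\prod_(o <= j < o + m) arm_factor alL beL sgL j *
    (root_cst sgr *
      (alr - elim_gain alL beL (o + m) - elim_gain alR beR k) `^ (- sgr) *
     \prod_(j < k) arm_factor alR beR sgR j))%:E)%E.
Proof.
elim: m o => [|m IH] o pL sL pR sR pr sr.
  rewrite addn0 in pr *; rewrite big_geq// mul1r.
  rewrite ge0_integral_rVS; last 2 first.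
  - exact: measurable_root_arm.
  - exact: root_arm_ge0.
  set C := \prod_(j < k) _.
  have C0 : 0 <= C.
    by apply: prodr_ge0 => j _; rewrite mulr_ge0 ?powR_ge0// ltW// arm_cst_gt0// sR.
  set p := alr - _ - _ in pr *.
  transitivity (\int[mu]_x (C%:E * (root_fun p sgr x)%:E))%E.
    apply: eq_integral => x _.
    under eq_integral => u _.
      rewrite (_ : root_arm _ _ =
        (root_fun (alr - elim_gain alL beL o) sgr x)%:E * right_arm x u)%E.
        over.
      by rewrite root_arm0 muleA -EFinM [X in (X%:E * _)%E]mulrC root_funMexp.
    rewrite ge0_integralZl//; last 3 first.
    - exact: measurable_right_arm.
    - by move=> u _; exact: right_arm_ge0.
    - by rewrite lee_fin root_fun_ge0.
    have [x0|x0] := leP x 0.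
      by rewrite /root_fun (gt0_indF x0) !mul0r mul0e mule0.
    rewrite integral_right_arm// -/C [X in (_ * X)%E]EFinM muleCA; congr (_ * _)%E.
    by rewrite -EFinM /p -[in RHS]root_funMexp gt0_indT// mul1r.
  rewrite ge0_integralZl//; last 2 first.
  - by apply/measurable_EFinP; exact: measurable_root_fun.
  - by move=> x _; rewrite lee_fin root_fun_ge0.
  by rewrite integral_root_fun// -EFinM mulrC.
have pr' : 0 < alr - elim_gain alL beL (o.+1 + m) - elim_gain alR beR k.
  by rewrite addSnnS.
have oo : (o <= o < o + m.+1)%N by rewrite leqnn addnS ltnS leq_addr.
have sub j : (o.+1 <= j < o.+1 + m)%N -> (o <= j < o + m.+1)%N.
  by rewrite addSnnS => /andP[/ltnW -> ->].
have {}IH := IH o.+1 (fun j jm => pL _ (sub _ jm)) (fun j jm => sL _ (sub _ jm))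
  pR sR pr' sr.
rewrite [in RHS]addnS (big_ltn (_ : (o < (o + m).+1)%N)) ?ltnS ?leq_addr//.
rewrite addSn in IH.
rewrite -mulrA EFinM -IH.
rewrite -ge0_integralZl//; last 3 first.
- exact: measurable_root_arm.
- by move=> u _; exact: root_arm_ge0.
- by rewrite lee_fin mulr_ge0 ?powR_ge0// ltW// arm_cst_gt0// sL.
have -> : (\int[lebesgue_rV R (m.+1 + k).+1]_u root_arm o u =
  \int[lebesgue_rV R (m + k).+1]_u \int[mu]_x root_arm o
    (cons_rV (x, u) : 'rV_(m.+1 + k).+1))%E.
  apply: ge0_integral_rVS_swap; first exact: measurable_root_arm.
  exact: root_arm_ge0.
apply: eq_integral => u _.
set rest := root_arm_rest o.+1 u.
have rest0 : (0 <= rest)%E by exact: root_arm_rest_ge0.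
under eq_integral => x _.
  rewrite (_ : root_arm _ _ =
    (arm_marg (pivot alL beL o) (beL o) (sgL o) x (rV_at u 1) * rest))%E.
    over.
  by rewrite root_armS muleA [(_%:E * _)%E]muleC arm_margMexp.
rewrite ge0_integralZr//; last 2 first.
- exact: measurable_arm_marg.
- by move=> x _; exact: arm_marg_ge0.
rewrite integral_arm_marg ?pL ?sL// EFinM -muleA; congr (_ * _)%E.
Qed.

End arms.

(** * Entries, pairings and minors on the path *)

Section entries.
Context {R : realType} {N : nat}.
Notation n := N.+1.
Implicit Types (y z : 'M[R]_n) (eta : I_G R n).

Definition ydiag y (i : nat) : R := y (inord i) (inord i).
Definition yoff y (i : nat) : R := y (inord i) (inord i.+1).
Definition ediag eta (i : nat) : R := ient eta i.+1 i.+1.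
Definition eoff eta (i : nat) : R := ient eta i.+1 i.+2.

Lemma ientC eta i j : ient eta i j = ient eta j i.
Proof.
rewrite /ient eq_sym; case: (j =P i) => [-> //|_].
by case: (j =P i.+1) => [ji|_]; case: (i =P j.+1) => [ij|_] //; lia.
Qed.

Lemma ediagE eta i : ediag eta i = rV_at (lsubmx eta) i.+1.
Proof. by rewrite /ediag /ient eqxx. Qed.

Lemma eoffE eta i : eoff eta i = rV_at (rsubmx eta) i.+1.
Proof. by rewrite /eoff /ient ltn_eqF// eqxx. Qed.

Lemma pathE_cases (i j : 'I_n) :
  pathE i j = [|| i == j :> nat, j == i.+1 :> nat | i == j.+1 :> nat].
Proof.
by rewrite /pathE; move: (nat_of_ord i) (nat_of_ord j) => {}i {}j; lia.
Qed.

Lemma sum_upper (F : nat -> nat -> R) :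
  \sum_(i < n) \sum_(j < n | (j == i.+1 :> nat)%N) F i j = \sum_(i < N) F i i.+1.
Proof.
rewrite big_ord_recr /= [X in _ + X]big_pred0 ?addr0; last first.
  by move=> j /=; rewrite ltn_eqF.
apply: eq_bigr => i _.
have iN : (i.+1 < n)%N by rewrite ltnS.
rewrite (big_pred1 (Ordinal iN)) // => j /=.
Qed.

Lemma sum_path (F : nat -> nat -> R) : (forall i j, F i j = F j i) ->
  \sum_(i < n) \sum_(j < n | pathE i j) F i j =
  \sum_(i < n) F i i + 2 * \sum_(i < N) F i i.+1.
Proof.
move=> FC.
transitivity (\sum_(i < n) (F i i + \sum_(j < n | (j == i.+1 :> nat)%N) F i j +
   \sum_(j < n | (i == j.+1 :> nat)%N) F i j)).
  apply: eq_bigr => i _; under eq_bigl do rewrite pathE_cases.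
  rewrite (bigD1 i) ?eqxx //= -addrA; congr (_ + _).
  rewrite (bigID (fun j : 'I_n => j == i.+1 :> nat)) /=; congr (_ + _);
    apply: eq_bigl => j; rewrite -(val_eqE j i) /=;
    by move: (nat_of_ord i) (nat_of_ord j) => {}i {}j; lia.
rewrite !big_split /= -addrA; congr (_ + _).
rewrite sum_upper (exchange_big_dep xpredT) //= [X in _ + X](_ : _ = \sum_(i < N) F i i.+1).
  by rewrite mulr_natl mulr2n.
rewrite -sum_upper; apply: eq_bigr => i _; apply: eq_bigr => j _; exact: FC.
Qed.

Lemma pairing_sum y eta : Z_G y ->
  pairing y eta = \sum_(i < n) ydiag y i * ediag eta i +
                  2 * \sum_(i < N) yoff y i * eoff eta i.
Proof.
move=> [yT _].
have yC i j : y i j = y j i by rewrite -[in LHS]yT mxE.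
transitivity (\sum_(i < n) \sum_(j < n | pathE i j)
    y (inord i) (inord j) * ient eta i.+1 j.+1).
  by apply: eq_bigr => i _; apply: eq_bigr => j _; rewrite !inord_val mxE.
rewrite (@sum_path (fun i j => y (inord i) (inord j) * ient eta i.+1 j.+1))//.
by move=> i j; rewrite yC ientC.
Qed.

Lemma quad_sum y (u : nat -> R) : Z_G y ->
  ((\row_i u i) *m y *m (\row_i u i)^T) 0 0 =
  \sum_(i < n) ydiag y i * u i ^+ 2 + 2 * \sum_(i < N) yoff y i * (u i * u i.+1).
Proof.
move=> [yT y0].
have yC i j : y i j = y j i by rewrite -[in LHS]yT mxE.
transitivity (\sum_(i < n) \sum_(j < n | pathE i j)
    y (inord i) (inord j) * (u i * u j)).
  rewrite mxE; under eq_bigr => j _ do rewrite !mxE big_distrl/=.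
  rewrite exchange_big /=; apply: eq_bigr => i _.
  rewrite [LHS](bigID (fun j => pathE i j)) /= [X in _ + X]big1 ?addr0.
    by apply: eq_bigr => j _; rewrite !inord_val !mxE; ring.
  by move=> j /y0 yij; rewrite yij mulr0 mul0r.
rewrite (@sum_path (fun i j => y (inord i) (inord j) * (u i * u j))).
  by congr (_ + _); apply: eq_bigr => i _; rewrite /ydiag expr2.
by move=> i j; rewrite yC [u i * _]mulrC.
Qed.

End entries.

Section minors.
Context {R : realType}.

(** The enumeration of a set of two vertices is only known up to order, and the minor
does not depend on it. *)
Lemma det2_mxsub p k (hk : k = 2%N) (f : 'I_k -> 'I_p) (A : 'M[R]_p) :
  exists u v : 'I_k, u != v /\
  \det (mxsub f f A) = A (f u) (f u) * A (f v) (f v) - A (f u) (f v) * A (f v) (f u).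
Proof.
subst k; exists 0, 1; split => //.
rewrite (expand_det_row _ 0) !big_ord_recl big_ord0 addr0 /cofactor !det_mx11 !mxE.
rewrite /= !expr0 !expr1 !mul1r mulN1r mulrN.
by congr (_ * A (f _) (f _) - A (f _) (f _) * A (f _) (f _)); apply/val_inj.
Qed.

Lemma minor2E N (eta : I_G R N.+1) i : (i < N)%N ->
  minor2 eta i.+1 = ediag eta i * ediag eta i.+1 - eoff eta i ^+ 2.
Proof.
move=> iN.
have i1 : (i < N.+1)%N by rewrite ltnW.
have i2 : (i.+1 < N.+1)%N by rewrite ltnS.
have BE : interval_set N.+1 i.+1 i.+2 = [set Ordinal i1; Ordinal i2]%SET.
  by apply/setP => j; rewrite !inE -!val_eqE /= !ltnS eqn_leq [in RHS]leq_eqVlt;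
   have := (j : nat); lia.
have nq : Ordinal i1 != Ordinal i2 by rewrite -val_eqE /= ltn_eqF.
have cB : #|interval_set N.+1 i.+1 i.+2| = 2%N by rewrite BE cards2 nq.
have [u [v [uv]]] := det2_mxsub cB enum_val (imx eta).
rewrite /minor2 /psubmx => ->.
have : enum_val u != enum_val v by rewrite (inj_eq enum_val_inj).
have := enum_valP u; have := enum_valP v.
move: (enum_val u) (enum_val v) => a b.
rewrite BE !inE => /orP[]/eqP -> /orP[]/eqP ->; rewrite ?eqxx// => _;
  rewrite !mxE /ediag /eoff /= [ient _ i.+2 i.+1]ientC expr2 //.
by rewrite mulrC.
Qed.

End minors.

(** * The cone Q_G as a region of positive minors *)

Section closure_P_G.
Context {R : realType} {n : nat}.
Implicit Types y : 'M[R]_n.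

Lemma closure_sub_closed (A B : set 'M[R]_n) : closed B -> A `<=` B ->
  closure A `<=` B.
Proof. by move=> cB AB; rewrite (closure_id B).1//; exact: closure_subset. Qed.

Lemma closed_preimage (f : 'M[R]_n -> R) (C : set R) :
  continuous f -> closed C -> closed (f @^-1` C).
Proof. by move=> cf cC; apply: closed_comp => // y _; exact: cf. Qed.

Lemma continuous_sumr (T : topologicalType) k (F : 'I_k -> T -> R) :
  (forall i, continuous (F i)) -> continuous (fun x => \sum_i F i x).
Proof.
elim: k F => [|k IH] F cF.
  rewrite (_ : (fun _ => _) = cst 0); first by move=> x; exact: cvg_cst.
  by apply/funext => x; rewrite big_ord0.
rewrite (_ : (fun _ => _) = (fun x => F ord0 x + \sum_(i < k) F (lift ord0 i) x)).
  by move=> x; apply: cvgD; [exact: cF|exact: IH].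
by apply/funext => x; rewrite big_ord_recl.
Qed.

Lemma continuous_quad (u : 'rV[R]_n) :
  continuous (fun y : 'M[R]_n => (u *m y *m u^T) 0 0).
Proof.
have -> : (fun y : 'M[R]_n => (u *m y *m u^T) 0 0) =
    (fun y => \sum_j (\sum_i u 0 i * y i j) * u 0 j).
  by apply/funext => y; rewrite mxE; apply: eq_bigr => j _; rewrite !mxE.
apply: continuous_sumr => j y; apply: continuousM; last exact: cst_continuous.
apply: (@continuous_sumr _ _ (fun i (y : 'M[R]_n) => u 0 i * y i j)) => i {}y.
apply: continuousM; first exact: cst_continuous.
exact: coord_continuous.
Qed.

Lemma closure_P_G_psd y : closure (@P_G R n) y ->
  Z_G y /\ forall u : 'rV[R]_n, 0 <= (u *m y *m u^T) 0 0.
Proof.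
move=> cy; split; last first.
  move=> u; have := @closure_sub_closed (@P_G R n)
    ((fun y : 'M[R]_n => (u *m y *m u^T) 0 0) @^-1` [set x | 0 <= x]) _ _ y cy.
  apply; first by apply: closed_preimage; [exact: continuous_quad|exact: closed_ge].
  move=> z [_ [_ pz]] /=; have [->|u0] := eqVneq u 0; last exact/ltW/pz.
  by rewrite !mul0mx mxE.
have c0 : closed [set 0 : R] by exact: closed_eq.
split.
- apply/matrixP => i j; rewrite mxE; apply/eqP; rewrite -subr_eq0; apply/eqP.
  have := @closure_sub_closed (@P_G R n)
    ((fun y : 'M[R]_n => y j i - y i j) @^-1` [set 0]) _ _ y cy.
  apply.
    apply: closed_preimage => // x; apply: continuousB; exact: coord_continuous.
  by move=> z [[zT _] _] /=; rewrite -[in z i j]zT mxE subrr.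
- move=> i j ij; have := @closure_sub_closed (@P_G R n)
    ((fun y : 'M[R]_n => y i j) @^-1` [set 0]) _ _ y cy.
  apply; first by apply: closed_preimage => // x; exact: coord_continuous.
  by move=> z [[_ z0] _] /=; exact: z0.
Qed.

(** Adding a small multiple of the identity makes a positive semidefinite matrix
positive definite. *)
Lemma closure_P_G_rank1 (u : 'rV[R]_n) : Z_G (u^T *m u) ->
  closure (@P_G R n) (u^T *m u).
Proof.
move=> Zu B /nbhs_ballP [e /= e0 eB].
pose y := u^T *m u + (e / 2)%:M.
have e20 : 0 < e / 2 by rewrite divr_gt0.
have sym (z : 'M[R]_n) : z = z^T -> z^T = z by [].
exists y; split; last first.
  apply: eB; split=> // i j; rewrite /ball/= /y !mxE opprD addNKr normrN.
  case: (i == j); rewrite ?mulr1n ?mulr0n ?normr0//.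
  by rewrite gtr0_norm// ltr_pdivrMr// ltr_pMr// ltr1n.
have [uT u0] := Zu.
split; first split.
- by rewrite linearD /= uT tr_scalar_mx.
- move=> i j ij; rewrite !mxE -[X in X + _](_ : (u^T *m u) i j = _); last by rewrite mxE.
  rewrite u0// add0r; case: eqP ij => [->|]; rewrite ?mulr0n//.
  by rewrite /pathE leqnSn.
- split; first by rewrite linearD /= uT tr_scalar_mx.
  move=> v v0; rewrite mulmxDr mulmxDl mxE ltr_wpDl//.
    rewrite mulmxA -mulmxA -[v *m u^T]trmxK trmx_mul trmxK mxE.
    by rewrite big_ord1 !mxE -expr2 sqr_ge0.
  rewrite mul_mx_scalar -scalemxAl mxE mulr_gt0//.
  rewrite mxE lt_neqAle sumr_ge0 ?andbT//; last first.
    by move=> i _; rewrite !mxE -expr2 sqr_ge0.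
  apply: contra_neq v0 => /esym/eqP; rewrite psumr_eq0; last first.
    by move=> i _; rewrite !mxE -expr2 sqr_ge0.
  move=> /allP h; apply/rowP => i; have := h i (mem_index_enum _).
  by rewrite !mxE -expr2 sqrf_eq0 => /eqP.
Qed.

End closure_P_G.

Section Q_G_region.
Context {R : realType} {N : nat}.
Notation n := N.+1.
Implicit Types (y z : 'M[R]_n) (eta : I_G R n).

Lemma Z_G_rank1 (i : nat) (a b : R) :
  let u := (\row_(j < n) ((j == i :> nat)%:R * a + (j == i.+1 :> nat)%:R * b)) in
  Z_G (u^T *m u).
Proof.
move=> u; split; first by rewrite trmx_mul trmxK.
move=> j k jk; rewrite mxE big_ord1 !mxE.
move: jk; rewrite pathE_cases; move: (nat_of_ord j) (nat_of_ord k) => {}j {}k jk.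
case: (j =P i) => ji; case: (j =P i.+1) => ji';
  case: (k =P i) => ki; case: (k =P i.+1) => ki';
  first [exfalso; lia | by rewrite !(mul0r, mulr0, addr0)].
Qed.

Lemma pairing_rank1 (i : nat) (a b : R) eta :
  let U := fun j : nat => (j == i)%:R * a + (j == i.+1)%:R * b in
  let u := \row_(j < n) U j in
  pairing (u^T *m u) eta =
  \sum_(j < n) U j ^+ 2 * ediag eta j +
  2 * \sum_(j < N) U j * U j.+1 * eoff eta j.
Proof.
move=> U u; rewrite pairing_sum; last exact: Z_G_rank1.
congr (_ + _ * _); apply: eq_bigr => j _; rewrite /ydiag /yoff mxE big_ord1 !mxE.
  by rewrite inordK.
have jN := ltn_ord j.
by rewrite !inordK// ltnS ltnW.
Qed.

Lemma Q_G_ediag eta i : Q_G eta -> (i < n)%N -> 0 < ediag eta i.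
Proof.
move=> Qe iN; have Zu := @Z_G_rank1 i 1 0.
have := Qe _ (closure_P_G_rank1 Zu); rewrite pairing_rank1.
rewrite (bigD1 (Ordinal iN)) //= eqxx !mulr0 addr0 mulr1 expr1n mul1r.
rewrite big1 ?addr0; last first.
  by move=> j; rewrite -val_eqE /= => /negbTE ->; rewrite !mul0r mulr0 addr0 expr0n mul0r.
rewrite big1 ?mulr0 ?addr0; last first.
  move=> j _; rewrite !mulr0 !addr0 !mulr1; case: eqP => [->|_]; last by rewrite !mul0r.
  by rewrite gtn_eqF// mulr0 mul0r.
apply; apply/eqP => /matrixP/(_ (Ordinal iN) (Ordinal iN)).
rewrite !mxE big_ord1 !mxE /= eqxx !mulr0 !addr0 !mulr1 => /eqP.
by rewrite oner_eq0.
Qed.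

(** Against the rank-one matrix of the vector with entries [- eoff eta i] and
[ediag eta i] at the two ends of the edge, the pairing is [ediag eta i] times the
minor. *)
Lemma Q_G_minor eta i : Q_G eta -> (i < N)%N ->
  0 < ediag eta i * ediag eta i.+1 - eoff eta i ^+ 2.
Proof.
move=> Qe iN.
have i1 : (i < n)%N by rewrite ltnW.
have i2 : (i.+1 < n)%N by [].
have Ai := Q_G_ediag Qe i1.
set a := - eoff eta i; set b := ediag eta i.
have Zu := @Z_G_rank1 i a b.
have := Qe _ (closure_P_G_rank1 Zu); rewrite pairing_rank1.
rewrite (bigD1 (Ordinal i1)) //= (bigD1 (Ordinal i2)) /=; last first.
  by rewrite -val_eqE /= gtn_eqF.
rewrite big1 ?addr0; last first.
  move=> j; rewrite -!val_eqE /= => /andP[/negbTE -> /negbTE ->].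
  by rewrite !mul0r addr0 expr0n mul0r.
rewrite (bigD1 (Ordinal iN)) //= big1 ?addr0; last first.
  move=> j; rewrite -!val_eqE /= => ji; rewrite (negbTE ji) mul0r add0r.
  case: eqP => [->|_]; last by rewrite !mul0r.
  by rewrite [i.+2 == i]gtn_eqF// [i.+2 == i.+1]gtn_eqF// !mul0r addr0 mulr0 mul0r.
rewrite !eqxx [i == i.+1]ltn_eqF// [i.+1 == i]gtn_eqF// !mul0r !mul1r addr0 add0r.
rewrite [X in (_ -> 0 < X) -> _](_ : _ = b * (b * ediag eta i.+1 - eoff eta i ^+ 2)); last first.
  by rewrite /a -/b; ring.
rewrite pmulr_rgt0//; apply; apply/eqP => /matrixP/(_ (Ordinal i2) (Ordinal i2)).
rewrite !mxE big_ord1 !mxE /= eqxx [i.+1 == i]gtn_eqF// mul0r add0r mul1r => /eqP.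
by rewrite mulf_eq0 orbb gt_eqF.
Qed.

(** For [y] in the closure of P_G take u_i = +-sqrt(a_i), with signs that make every
y_(i,i+1) u_i u_(i+1) nonpositive.  As |b_i| < sqrt(a_i a_(i+1)), the pairing is at
least the quadratic form of [y] at u, which is nonnegative, and it is larger
unless [y] is diagonal. *)
Lemma region_Q_G eta :
  (forall i, (i < n)%N -> 0 < ediag eta i) ->
  (forall i, (i < N)%N -> 0 < ediag eta i * ediag eta i.+1 - eoff eta i ^+ 2) ->
  Q_G eta.
Proof.
move=> A0 D0 y /closure_P_G_psd [Zy psd] y0.
have diag0 i : 0 <= y i i.
  have := psd (delta_mx 0 i); rewrite -rowE mxE (bigD1 i) //= big1 ?addr0.
    by rewrite !mxE !eqxx mulr1.
  by move=> j ji; rewrite !mxE (negbTE ji) andbF mulr0.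
rewrite pairing_sum//.
(* [Num.sg] vanishes at 0, whereas the squares of these signs have to be 1. *)
pose sg (x : R) : R := if 0 <= x then 1 else -1.
have sg2 x : sg x * sg x = 1 by rewrite /sg; case: ifP; rewrite ?mulr1 ?mulrNN ?mulr1.
have sgM x : x * sg x = `|x|.
  rewrite /sg; case: leP => x0; first by rewrite mulr1 ger0_norm.
  by rewrite mulrN1 ltr0_norm.
pose s i : R := \prod_(k < i) (- sg (yoff y k)).
have s2 i : s i * s i = 1.
  rewrite /s; elim: i => [|i IH]; first by rewrite big_ord0 mulr1.
  by rewrite big_ord_recr /= mulrACA IH mulrNN sg2 mulr1.
pose u i := s i * Num.sqrt (ediag eta i).
have u2 i : (i < n)%N -> u i ^+ 2 = ediag eta i.
  by move=> iN; rewrite /u expr2 mulrACA s2 mul1r -expr2 sqr_sqrtr// ltW// A0.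
have yu i : (i < N)%N -> yoff y i * (u i * u i.+1) =
    - (`|yoff y i| * Num.sqrt (ediag eta i * ediag eta i.+1)).
  move=> iN; rewrite sqrtrM; last by rewrite ltW// A0// ltnW.
  rewrite /u /s big_ord_recr /= -/(s i) -sgM.
  transitivity (- ((s i * s i) * (yoff y i * sg (yoff y i) *
    (Num.sqrt (ediag eta i) * Num.sqrt (ediag eta i.+1))))); first by ring.
  by rewrite s2 mul1r.
have be i : (i < N)%N ->
    yoff y i * (u i * u i.+1) <= yoff y i * eoff eta i ?= iff (yoff y i == 0).
  move=> iN; rewrite yu//; apply/leifP; case: eqP => [->|/eqP b0].
    by rewrite normr0 !mul0r oppr0.
  rewrite ltrNl (le_lt_trans (ler_norm _))// normrN normrM ltr_pM2l ?normr_gt0//.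
  by have := D0 _ iN; have := sqr_ge0 (eoff eta i);
    rewrite -sqrtr_sqr => ? ?; rewrite ltr_sqrt; lra.
have := psd (\row_i u i); rewrite quad_sum// => q0.
have q1 : \sum_(i < n) ydiag y i * u i ^+ 2 = \sum_(i < n) ydiag y i * ediag eta i.
  by apply: eq_bigr => i _; rewrite u2.
have q2 : \sum_(i < N) yoff y i * (u i * u i.+1) <= \sum_(i < N) yoff y i * eoff eta i
    ?= iff [forall i : 'I_N, yoff y i == 0].
  have := @leif_sum _ _ xpredT (fun i : 'I_N => yoff y i == 0)
    (fun i : 'I_N => yoff y i * (u i * u i.+1)) (fun i : 'I_N => yoff y i * eoff eta i).
  move=> /(_ (fun i _ => be i (ltn_ord i))) h.
  by rewrite (_ : [forall i : 'I_N, _] = [forall (i : 'I_N | xpredT i), yoff y i == 0]).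
(* For diagonal [y] the pairing is a sum of nonnegative terms, so that [y != 0] is
   what makes it positive. *)
rewrite q1 in q0; have [/forallP b0|nb] := boolP [forall i : 'I_N, yoff y i == 0].
  rewrite [X in 2 * X]big1 ?mulr0 ?addr0; last by move=> i _; rewrite (eqP (b0 i)) mul0r.
  have d0 (i : 'I_n) : 0 <= ydiag y i * ediag eta i.
    by rewrite mulr_ge0 ?diag0// ltW// A0.
  rewrite lt_neqAle sumr_ge0// andbT; apply: contra y0 => /eqP/esym/eqP.
  rewrite psumr_eq0// => /allP e0; apply/eqP/matrixP => i j; rewrite mxE.
  have [ij|/Zy.2//] := boolP (pathE i j).
  have yC k l : y k l = y l k by rewrite -[in LHS]Zy.1 mxE.
  have off (k : nat) : (k < N)%N -> y (inord k) (inord k.+1) = 0.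
    by move=> kN; apply/eqP; exact: (b0 (Ordinal kN)).
  move: ij; rewrite pathE_cases => /or3P[/eqP|/eqP|/eqP] ij.
  - have <- : i = j by exact: val_inj.
    have := e0 i (mem_index_enum _); rewrite mulf_eq0 (gt_eqF (A0 _ _))// orbF.
    by rewrite /ydiag inord_val => /eqP.
  - have := off i; rewrite -ij !inord_val; apply.
    by have := ltn_ord j; rewrite ij ltnS.
  - have := off j; rewrite -ij !inord_val yC; apply.
    by have := ltn_ord i; rewrite ij ltnS.
apply: le_lt_trans q0 _; rewrite ltrD2l ltr_pM2l//.
by rewrite (lt_leif q2).
Qed.

End Q_G_region.

(** * The Wishart weight as a product over the rooted path *)

Section exponents.
Context {R : realType}.

Lemma sum_nat_shift (F : nat -> R) a c :
  \sum_(a <= i < a + c) F i = \sum_(i < c) F (a + i)%N.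
Proof.
rewrite -{1}[a]add0n big_addn addKn big_mkord.
by apply: eq_bigr => i _; rewrite addnC.
Qed.

(** The exponents of the minors (with logarithms [d]) and of the diagonal entries
(with logarithms [l]): on the left as they stand in the density, on the right
distributed over the edges directed to the root [m.+1].  If an arm is empty, the
boundary values of [S] make the exponent of the root come out right. *)
Lemma weight_exponent (m k : nat) (S d l : nat -> R) :
  S 0%N = 0 -> S (m + k).+2 = 0 ->
  \sum_(1 <= i < m.+1) S i * d i + \sum_(m.+2 <= i < (m + k).+2) S i * d i.-1
  - (\sum_(2 <= i < m.+1) S i.-1 * l i + (S m - S m.+1 + S m.+2) * l m.+1
     + \sum_(m.+2 <= i < (m + k).+1) S i.+1 * l i)
  + (if (m + k).+1 == 1%N then - l 1%N
     else \sum_(1 <= i < (m + k).+1) (- (3 / 2)) * d i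
          + \sum_(2 <= i < (m + k).+1) l i)
  = \sum_(i < m) ((S i.+1 - 3 / 2) * d i.+1 + (1 - S i.+1) * l i.+2)
    + (S m.+1 - 1) * l m.+1
    + \sum_(i < k) ((S (m + i).+2 - 3 / 2) * d (m + i).+1
                    + (1 - S (m + i).+2) * l (m + i).+1).
Proof.
move=> S0 Sn.
have r1 F c : \sum_(1 <= i < c.+1) F i = \sum_(i < c) F i.+1 :> R.
  by rewrite -[c.+1]/(1 + c)%N sum_nat_shift.
have r2 F c : \sum_(2 <= i < c.+2) F i = \sum_(i < c) F i.+2 :> R.
  by rewrite -[c.+2]/(2 + c)%N sum_nat_shift.
have rm F c : \sum_(m.+2 <= i < (m + c).+2) F i = \sum_(i < c) F (m + i).+2 :> R.
  by rewrite -[(m + c).+2]/(m.+2 + c)%N sum_nat_shift.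
have dpart : \sum_(1 <= i < (m + k).+1) (- (3 / 2)) * d i =
    \sum_(i < m) (- (3 / 2)) * d i.+1 + \sum_(i < k) (- (3 / 2)) * d (m + i).+1.
  by rewrite r1 big_split_ord.
have part1 : \sum_(i < m) ((S i.+1 - 3 / 2) * d i.+1 + (1 - S i.+1) * l i.+2) =
    \sum_(i < m) S i.+1 * d i.+1 + \sum_(i < m) (- (3 / 2)) * d i.+1
    + \sum_(i < m) (1 - S i.+1) * l i.+2.
  by rewrite -!big_split; apply: eq_bigr => i _ /=; ring.
have part2 : \sum_(i < k) ((S (m + i).+2 - 3 / 2) * d (m + i).+1
      + (1 - S (m + i).+2) * l (m + i).+1) =
    \sum_(i < k) S (m + i).+2 * d (m + i).+1 + \sum_(i < k) (- (3 / 2)) * d (m + i).+1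
    + \sum_(i < k) (1 - S (m + i).+2) * l (m + i).+1.
  by rewrite -!big_split; apply: eq_bigr => i _ /=; ring.
rewrite {}part1 {}part2 r1 rm dpart.
case: m S0 Sn r1 r2 rm dpart => [|m] S0 Sn r1 r2 rm dpart.
  rewrite !big_ord0 (big_geq (leqnSn 1)) S0.
  case: k Sn dpart => [|k] Sn dpart.
    rewrite !add0n in Sn *.
    by rewrite /= !big_ord0 (big_geq (leqnSn 1)) Sn; ring.
  rewrite /= !add0n !r2 !big_ord_recl.
  have -> : \sum_(i < k) (1 - S (0 + lift ord0 i).+2) * l (0 + lift ord0 i).+1 =
    \sum_(i < k) l i.+2 - \sum_(i < k) S i.+3 * l i.+2.
    by rewrite -sumrB; apply: eq_bigr => i _; rewrite add0n lift0; ring.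
  rewrite !add0n; ring.
have rhs1 : \sum_(i < m.+1) (1 - S i.+1) * l i.+2 =
    \sum_(i < m) l i.+2 - \sum_(i < m) S i.+1 * l i.+2 + (1 - S m.+1) * l m.+2.
  by rewrite big_ord_recr /= -sumrB; congr (_ + _); apply: eq_bigr => i _; ring.
rewrite rhs1 [\sum_(2 <= i < m.+2) _]r2 (_ : ((m.+1 + k).+1 == 1%N) = false)//.
case: k Sn dpart => [|k] Sn dpart.
  rewrite !addn0 in Sn *.
  by rewrite !big_ord0 r2 (big_geq (leqnSn m.+2)) Sn /=; ring.
rewrite !addnS rm addSn r2.
have -> : \sum_(i < (m + k).+1) l i.+2 = \sum_(i < m) l i.+2 + l m.+2 +
    \sum_(i < k) l (m + i).+3.
  rewrite -addnS big_split_ord big_ord_recl /= addn0 addrA; congr (_ + _).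
  by apply: eq_bigr => i _; rewrite /bump /= add1n addnS.
have -> : \sum_(i < k.+1) (1 - S (m.+1 + i).+2) * l (m.+1 + i).+1 =
    (1 - S m.+3) * l m.+2 + (\sum_(i < k) l (m + i).+3
      - \sum_(i < k) S (m.+1 + i).+3 * l (m.+1 + i).+2).
  rewrite big_ord_recl addn0 -sumrB; congr (_ + _); apply: eq_bigr => i _.
  by rewrite lift0 !addSn addnS; ring.
by ring.
Qed.

End exponents.

Section weight.
Context {R : realType} (m k : nat).
Notation n := (m + k).+1.
Implicit Types (y z : 'M[R]_n) (s : 'rV[R]_n) (eta : I_G R n).

(** The factors vanish off the cone, so that an integral over Q_G becomes one over
the whole space. *)
Definition tree_weight s y eta : R :=
  gt0_ind (ediag eta 0) *
  (\prod_(i < m) arm_fun (ydiag y i) (yoff y i) (rV_at s i.+1)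
     (ediag eta i) (ediag eta i.+1) (eoff eta i) *
   (root_fun (ydiag y m) (rV_at s m.+1) (ediag eta m) *
    \prod_(i < k) arm_fun (ydiag y (m + i).+1) (yoff y (m + i)) (rV_at s (m + i).+2)
     (ediag eta (m + i).+1) (ediag eta (m + i)) (eoff eta (m + i)))).

Lemma prod_expR c (F : 'I_c -> R) :
  \prod_(i < c) expR (F i) = expR (\sum_(i < c) F i).
Proof. by rewrite (big_morph (@expR R) (@expRD R) (@expR0 R)). Qed.

Lemma prod_nat_expR (a b : nat) (F : nat -> R) :
  \prod_(a <= i < b) expR (F i) = expR (\sum_(a <= i < b) F i).
Proof. by rewrite (big_morph (@expR R) (@expRD R) (@expR0 R)). Qed.

Lemma powR_expR (x p : R) : 0 < x -> x `^ p = expR (p * ln x).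
Proof. by move=> x0; rewrite /powR gt_eqF. Qed.

Lemma prod_nat_powR (a b : nat) (f g : nat -> R) :
  (forall i, (a <= i < b)%N -> 0 < f i) ->
  \prod_(a <= i < b) f i `^ g i = expR (\sum_(a <= i < b) g i * ln (f i)).
Proof.
by move=> f0; rewrite -prod_nat_expR; apply: eq_big_nat => i /f0 fi; exact: powR_expR.
Qed.

Lemma sum_tree (F : nat -> R) :
  \sum_(i < n) F i = \sum_(i < m) F i + (F m + \sum_(i < k) F (m + i).+1).
Proof.
rewrite -addnS big_split_ord big_ord_recl /= addn0; congr (_ + (_ + _)).
by apply: eq_bigr => i _; rewrite /bump /= add1n addnS.
Qed.

Lemma arm_fun_neq0 al be sg (a r b : R) : arm_fun al be sg a r b != 0 ->
  [/\ 0 < a, 0 < r & 0 < a * r - b ^+ 2].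
Proof.
rewrite /arm_fun; have [a0|a0] := leP a 0; first by rewrite (gt0_indF a0) !mul0r eqxx.
have [r0|r0] := leP r 0; first by rewrite (gt0_indF r0) mulr0 !mul0r eqxx.
have [d0|d0] := leP (a * r - b ^+ 2) 0; last by [].
by rewrite (gt0_indF d0) mulr0 !mul0r eqxx.
Qed.

Lemma tree_weight_region s y eta : tree_weight s y eta != 0 -> Q_G eta.
Proof.
rewrite /tree_weight mulf_eq0 negb_or => /andP[_].
rewrite mulf_eq0 negb_or => /andP[/prodf_neq0 hL].
rewrite mulf_eq0 negb_or => /andP[hr /prodf_neq0 hR].
have {}hr : 0 < ediag eta m.
  move: hr; rewrite /root_fun; have [r0|//] := leP (ediag eta m) 0.
  by rewrite (gt0_indF r0) mul0r eqxx.
have {}hL i : (i < m)%N -> [/\ 0 < ediag eta i, 0 < ediag eta i.+1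
    & 0 < ediag eta i * ediag eta i.+1 - eoff eta i ^+ 2].
  by move=> im; apply: arm_fun_neq0 (hL (Ordinal im) isT).
have {}hR i : (i < k)%N -> [/\ 0 < ediag eta (m + i).+1, 0 < ediag eta (m + i)
    & 0 < ediag eta (m + i).+1 * ediag eta (m + i) - eoff eta (m + i) ^+ 2].
  by move=> ik; apply: arm_fun_neq0 (hR (Ordinal ik) isT).
apply: region_Q_G => i.
- rewrite ltnS => iN; have [/hL[]//|mi] := ltnP i m.
  have [->//|im] := eqVneq i m.
  have ik : (i - m.+1 < k)%N by lia.
  by have [+ _ _] := hR _ ik; rewrite (_ : (m + (i - m.+1)).+1 = i)//; lia.
- move=> iN; have [/hL[]//|mi] := ltnP i m.
  have ik : (i - m < k)%N by lia.
  by have [_ _] := hR _ ik; rewrite subnKC// mulrC.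
Qed.

Lemma tree_weight_expR s y eta : Q_G eta -> Z_G y ->
  tree_weight s y eta = wishart_weight m.+1 s y eta.
Proof.
move=> Qe Zy.
have A0 i : (i < n)%N -> 0 < ediag eta i by exact: Q_G_ediag.
have D0 i : (i < m + k)%N -> 0 < ediag eta i * ediag eta i.+1 - eoff eta i ^+ 2.
  exact: Q_G_minor.
have I0 i : (0 < i < n.+1)%N -> 0 < ient eta i i.
  by case: i => [//|i] /= iN; exact: A0.
have M0 i : (0 < i < n)%N -> 0 < minor2 eta i.
  by case: i => [//|i] /= iN; rewrite minor2E//; exact: D0.
pose S := rV_at s; pose d i := ln (minor2 eta i); pose l i := ln (ient eta i i).
have lE i : (i < n)%N -> expR (l i.+1) = ediag eta i.
  by move=> iN; rewrite lnK// posrE A0.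
have left i : (i < m)%N -> arm_fun (ydiag y i) (yoff y i) (S i.+1)
     (ediag eta i) (ediag eta i.+1) (eoff eta i) =
   expR (- (ydiag y i * ediag eta i + 2 * yoff y i * eoff eta i)
         + ((S i.+1 - 3 / 2) * d i.+1 + (1 - S i.+1) * l i.+2)).
  move=> im; have iN : (i < m + k)%N by lia.
  rewrite /arm_fun !gt0_indT ?A0 ?D0//; try lia.
  rewrite !mul1r [in RHS]expRD; congr (_ * _).
  by rewrite -(minor2E _ iN) !powR_expR -?expRD// ?M0// A0.
have right i : (i < k)%N -> arm_fun (ydiag y (m + i).+1) (yoff y (m + i))
     (S (m + i).+2) (ediag eta (m + i).+1) (ediag eta (m + i)) (eoff eta (m + i)) =
   expR (- (ydiag y (m + i).+1 * ediag eta (m + i).+1 +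
            2 * yoff y (m + i) * eoff eta (m + i))
         + ((S (m + i).+2 - 3 / 2) * d (m + i).+1 + (1 - S (m + i).+2) * l (m + i).+1)).
  move=> ik; have iN : (m + i < m + k)%N by lia.
  rewrite /arm_fun [ediag eta (m + i).+1 * ediag eta (m + i)]mulrC.
  rewrite !gt0_indT ?A0 ?D0//; try lia.
  rewrite !mul1r [in RHS]expRD; congr (_ * _).
  rewrite -(minor2E _ iN) !powR_expR -?expRD// ?M0//.
  by apply: A0; lia.
have root : root_fun (ydiag y m) (S m.+1) (ediag eta m) =
    expR (- (ydiag y m * ediag eta m) + (S m.+1 - 1) * l m.+1).
  have mN : (m < n)%N by lia.
  by rewrite /root_fun gt0_indT ?A0// mul1r expRD powR_expR// A0.
rewrite /tree_weight gt0_indT ?A0// mul1r.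
under eq_bigr do rewrite left//.
under [in X in _ * (_ * X)]eq_bigr do rewrite right//.
rewrite root !prod_expR -!expRD.
have deltaE : delta_M m.+1 s eta =
  expR (\sum_(1 <= i < m.+1) S i * d i + \sum_(m.+2 <= i < (m + k).+2) S i * d i.-1
  - (\sum_(2 <= i < m.+1) S i.-1 * l i + (S m - S m.+1 + S m.+2) * l m.+1
     + \sum_(m.+2 <= i < (m + k).+1) S i.+1 * l i)).
  rewrite /delta_M !prod_nat_powR; last first.
  - by move=> i im; apply: M0; lia.
  - by move=> i im; apply: M0; lia.
  - by move=> i im; apply: I0; lia.
  - by move=> i im; apply: I0; lia.
  rewrite powR_expR; last by apply: I0; lia.
  by rewrite -!expRD -expRN -expRD.
have phiE : phi_An eta =
  expR (if (m + k).+1 == 1%N then - l 1%N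
     else \sum_(1 <= i < (m + k).+1) (- (3 / 2)) * d i
          + \sum_(2 <= i < (m + k).+1) l i).
  rewrite /phi_An; case: eqP => _.
    by rewrite expRN lnK// posrE; apply: I0; lia.
  rewrite prod_nat_powR; last by move=> i im; apply: M0; lia.
  rewrite expRD; congr (_ * _); rewrite -prod_nat_expR.
  apply: eq_big_nat => i im; rewrite lnK// posrE; apply: I0; lia.
rewrite /wishart_weight deltaE phiE -mulrA -!expRD; congr expR.
rewrite weight_exponent; last 2 first.
- by [].
- exact: rV_at_ge.
have split c (F G H : nat -> R) :
    \sum_(i < c) (- (F i + G i) + H i) =
    \sum_(i < c) H i - \sum_(i < c) F i - \sum_(i < c) G i.
  by rewrite -!sumrB; apply: eq_bigr => i _; ring.
rewrite (split m (fun i => ydiag y i * ediag eta i)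
  (fun i => 2 * yoff y i * eoff eta i)
  (fun i => (S i.+1 - 3 / 2) * d i.+1 + (1 - S i.+1) * l i.+2)).
rewrite (split k (fun i => ydiag y (m + i).+1 * ediag eta (m + i).+1)
  (fun i => 2 * yoff y (m + i) * eoff eta (m + i))
  (fun i => (S (m + i).+2 - 3 / 2) * d (m + i).+1 + (1 - S (m + i).+2) * l (m + i).+1)).
rewrite pairing_sum// (sum_tree (fun i => ydiag y i * ediag eta i)) big_split_ord /=.
rewrite mulrDr !mulr_sumr.
under [\sum_(i < m) 2 * _]eq_bigr do rewrite mulrA.
under [\sum_(i < k) 2 * _]eq_bigr do rewrite mulrA.
ring.
Qed.

End weight.

(** * The Laplace transform of the Wishart weight *)

Section laplace.
Context {R : realType} (m k : nat).
Notation n := (m + k).+1.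
Implicit Types (y z : 'M[R]_n) (s : 'rV[R]_n) (eta : I_G R n).

(** The right arm is numbered from its leaf, the last vertex of the path. *)
Definition rdiag y (j : nat) : R := ydiag y (m + k - j).
Definition roff y (j : nat) : R := y (inord (m + k - j)) (inord (m + k - j.+1)).
Definition root_pivot y : R :=
  ydiag y m - elim_gain (ydiag y) (yoff y) m - elim_gain (rdiag y) (roff y) k.

Definition pos_pivots y : Prop :=
  [/\ forall j, (j < m)%N -> 0 < pivot (ydiag y) (yoff y) j,
      forall j, (j < k)%N -> 0 < pivot (rdiag y) (roff y) j & 0 < root_pivot y].

Definition shape_ok s : Prop :=
  [/\ forall j, (j < m)%N -> 1 / 2 < rV_at s j.+1,
      forall j, (j < k)%N -> 1 / 2 < rV_at s (m + k - j).+1 & 0 < rV_at s m.+1].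

Definition laplace_wishart s y : R :=
  \prod_(j < m) arm_factor (ydiag y) (yoff y) (fun j => rV_at s j.+1) j *
  (root_cst (rV_at s m.+1) * root_pivot y `^ (- rV_at s m.+1) *
   \prod_(j < k) arm_factor (rdiag y) (roff y) (fun j => rV_at s (m + k - j).+1) j).

Lemma tree_weight_ge0 s y eta : 0 <= tree_weight s y eta.
Proof.
rewrite mulr_ge0 ?gt0_ind_ge0// mulr_ge0 ?prodr_ge0// => [i _|]; first exact: arm_fun_ge0.
by rewrite mulr_ge0 ?root_fun_ge0// prodr_ge0// => i _; exact: arm_fun_ge0.
Qed.

Lemma measurable_prodr d (T : measurableType d) c (F : 'I_c -> T -> R) :
  (forall i, measurable_fun setT (F i)) ->
  measurable_fun setT (fun t => \prod_(i < c) F i t).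
Proof.
elim: c F => [|c IH] F mF.
  by under eq_fun do rewrite big_ord0; exact: measurable_cst.
under eq_fun do rewrite big_ord_recl.
by apply: measurable_funM => //; exact: IH.
Qed.

Lemma measurable_ediag i : measurable_fun setT (fun eta => ediag eta i).
Proof.
under eq_fun do rewrite ediagE; apply: measurable_rV_at; apply: measurable_rVP => j.
by under eq_fun do rewrite mxE; exact: measurable_coord_rV.
Qed.

Lemma measurable_eoff i : measurable_fun setT (fun eta => eoff eta i).
Proof.
under eq_fun do rewrite eoffE; apply: measurable_rV_at; apply: measurable_rVP => j.
by under eq_fun do rewrite mxE; exact: measurable_coord_rV.
Qed.

Lemma measurable_tree_weight s y : measurable_fun setT (tree_weight s y).
Proof.
have me := measurable_ediag; have mo := measurable_eoff.
apply: measurable_funM; first exact: measurable_gt0.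
apply: measurable_funM.
  by apply: measurable_prodr => i; exact: measurable_arm_fun.
apply: measurable_funM; first exact: measurable_root_fun.
by apply: measurable_prodr => i; exact: measurable_arm_fun.
Qed.

Lemma ediag_row (a : 'rV[R]_n) (b : 'rV[R]_(m + k)) i :
  ediag (row_mx a b : I_G R n) i = rV_at a i.+1.
Proof. by rewrite ediagE; congr rV_at; exact: row_mxKl. Qed.

Lemma eoff_row (a : 'rV[R]_n) (b : 'rV[R]_(m + k)) i :
  eoff (row_mx a b : I_G R n) i = rV_at b i.+1.
Proof. by rewrite eoffE; congr rV_at; exact: row_mxKr. Qed.

(** For a fixed diagonal the off-diagonal entries separate. *)
Lemma integral_tree_off s y (a : 'rV[R]_n) : y^T = y ->
  (\int[lebesgue_rV R (m + k)]_b (tree_weight s y (row_mx a b : I_G R n))%:E =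
   root_arm (rdiag y) (roff y) (fun j => rV_at s (m + k - j).+1)
     (ydiag y) (yoff y) (fun j => rV_at s j.+1) (ydiag y m) (rV_at s m.+1) 0 a)%E.
Proof.
move=> yT; pose L (i : nat) (b : R) : R := arm_fun (ydiag y i) (yoff y i) (rV_at s i.+1)
  (rV_at a i.+1) (rV_at a i.+2) b.
pose Rt (i : nat) (b : R) : R := arm_fun (ydiag y (m + i).+1) (yoff y (m + i))
  (rV_at s (m + i).+2) (rV_at a (m + i).+2) (rV_at a (m + i).+1) b.
pose f (i : nat) (b : R) : R := if (i < m)%N then L i b else Rt (i - m)%N b.
have mL i : measurable_fun setT (L i).
  by apply: measurable_arm_fun => //; exact: measurable_cst.
have mR i : measurable_fun setT (Rt i).
  by apply: measurable_arm_fun => //; exact: measurable_cst.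
have mf i : measurable_fun setT (fun b => (f i b)%:E).
  apply/measurable_EFinP; have [im|im] := ltnP i m.
    by rewrite (_ : f i = L i)//; apply/funext => b; rewrite /f im.
  rewrite (_ : f i = Rt (i - m)%N)//.
  by apply/funext => b; rewrite /f ltnNge im.
have f0 i b : (0 <= (f i b)%:E)%E.
  by rewrite lee_fin /f; case: ifP => _; exact: arm_fun_ge0.
set c : R := gt0_ind (rV_at a 1) * root_fun (ydiag y m) (rV_at s m.+1) (rV_at a m.+1).
have c0 : 0 <= c by rewrite mulr_ge0 ?gt0_ind_ge0 ?root_fun_ge0.
transitivity (\int[lebesgue_rV R (m + k)]_b
    (c%:E * \prod_(i < m + k) (f i (rV_at b i.+1))%:E))%E.
  apply: eq_integral => b _; rewrite prodEFin -EFinM; congr EFin.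
  rewrite /tree_weight ediag_row /c big_split_ord /=.
  rewrite (_ : \prod_(i < m) arm_fun _ _ _ _ _ _ =
    \prod_(i < m) f i (rV_at b i.+1)); last first.
    by apply: eq_bigr => i _; rewrite /f ltn_ord !ediag_row eoff_row.
  rewrite (_ : \prod_(i < k) arm_fun _ _ _ _ _ _ =
    \prod_(i < k) f (m + i)%N (rV_at b (m + i).+1)); last first.
    apply: eq_bigr => i _; rewrite /f ltnNge leq_addr /= addKn.
    by rewrite !ediag_row eoff_row.
  by rewrite ediag_row; ring.
rewrite ge0_integralZl//; last 2 first.
- apply: (@emeasurable_prod _ _ _ (m + k) (fun i (b : 'rV[R]_(m + k)) => (f i (rV_at b i.+1))%:E)) => i.
  by apply: (measurableT_comp (mf i)); exact: measurable_rV_at.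
- by move=> b _; exact: prode_ge0.
rewrite (@ge0_integral_rV_prod _ (m + k) (fun i b => (f i b)%:E))//.
rewrite big_split_ord /= /root_arm /root_arm_rest mul0r expR0 mulr1.
rewrite /c EFinM -muleA; congr (_ * _)%E; rewrite muleCA; congr (_ * (_ * _))%E.
- by apply: eq_bigr => i _; rewrite add0n /f ltn_ord.
- apply: eq_bigr => i _; rewrite /rdiag /roff.
  have ik := ltn_ord i.
  have -> : (m + k - (k - i.+1) = (m + i).+1)%N by lia.
  have -> : (m + k - (k - i.+1).+1 = m + i)%N by lia.
  have -> : y (inord (m + i).+1) (inord (m + i)) = yoff y (m + i).
    by rewrite -[in LHS]yT mxE.
  rewrite /arm_marg; apply: eq_integral => b _.
  by rewrite /f ltnNge leq_addr /= addKn.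
Qed.

Lemma integral_tree_weight s y : y^T = y -> shape_ok s -> pos_pivots y ->
  (\int[d_eta R n]_eta (tree_weight s y eta)%:E = (laplace_wishart s y)%:E)%E.
Proof.
move=> yT [sL sR sr] [pL pR pr].
have -> : (\int[d_eta R n]_eta (tree_weight s y eta)%:E =
  \int[lebesgue_rV R (m + k).+1]_a \int[lebesgue_rV R (m + k)]_b
    (tree_weight s y (row_mx a b : I_G R n))%:E)%E.
  apply: (@ge0_integral_row_mx _ (m + k).+1 (m + k)
    (fun eta => (tree_weight s y eta)%:E)).
  - by apply/measurable_EFinP; exact: measurable_tree_weight.
  - by move=> u; rewrite lee_fin tree_weight_ge0.
under eq_integral do rewrite integral_tree_off//.
rewrite integral_root_arm//.
- by rewrite /laplace_wishart add0n big_mkord.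
Qed.

End laplace.

(** * Variance from the moment generating function *)

Lemma is_derive_linear (R : realType) (c u : R) :
  is_derive u 1 (fun u : R => - (u * c)) (- c).
Proof.
rewrite (_ : (fun u : R => - (u * c)) = (- c) \*: (id : R -> R)); last first.
  by apply/funext => x /=; rewrite /GRing.scale /= mulrC mulNr.
by have := is_deriveZ (- c) (is_derive_id u 1); rewrite /GRing.scale /= mulr1.
Qed.

Section moments.
Context {d} {T : measurableType d} {R : realType} (P : probability T R).
Variables (X : T -> R) (e : R) (phi phi1 : R -> R) (kappa : R).
Hypothesis mX : measurable_fun setT X.
Hypothesis e0 : 0 < e.
Hypothesis mgf : forall t : R, `|t| < e ->
  (\int[P]_x (expR (- (t * X x)))%:E = (phi t)%:E)%E.
Hypothesis dphi : forall t : R, `|t| < e -> is_derive t 1 phi (phi1 t).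
Hypothesis dphi1 : is_derive (0 : R) 1 phi1 kappa.

Let dom (x : T) : R := expR (e / 2 * X x) + expR (- (e / 2 * X x)).

Let integrable_expR (t : R) : `|t| < e ->
  P.-integrable setT (fun x => (expR (- (t * X x)))%:E).
Proof.
move=> te; apply/integrableP; split.
  by apply/measurable_EFinP; apply: measurableT_comp => //;
    apply: measurable_funN; apply: measurable_funM.
under eq_integral do rewrite /= ger0_norm ?expR_ge0//.
by rewrite mgf// ltry.
Qed.

Let integrable_dom : P.-integrable setT (EFin \o dom).
Proof.
have e2 : `|e / 2| < e.
  by rewrite gtr0_norm ?divr_gt0// ltr_pdivrMr// ltr_pMr// ltr1n.
have -> : EFin \o dom = (fun x => (expR (- (- (e / 2) * X x)))%:E +
    (expR (- (e / 2 * X x)))%:E)%E.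
  by apply/funext => x; rewrite /dom /= mulNr opprK EFinD.
by apply: integrableD => //; apply: integrable_expR; rewrite ?normrN.
Qed.

Let dom_ge0 x : 0 <= dom x.
Proof. by rewrite addr_ge0 ?expR_ge0. Qed.

(** Of the rate [e / 2] in the dominating function [dom], half serves to dominate [t]
and half to absorb up to two powers of [X], at rate [e / 8] each. *)
Let pow_expR_le (j : nat) (t : R) x : (j <= 2)%N -> `|t| < e / 4 ->
  `|X x ^+ j * expR (- (t * X x))| <= (8 / e) ^+ j * dom x.
Proof.
move=> j2 te; rewrite normrM normrX [`|expR _|]ger0_norm ?expR_ge0//.
have xe : `|X x| <= 8 / e * expR (e / 8 * `|X x|).
  rewrite -ler_pdivrMl ?divr_gt0// invf_div.
  by apply: le_trans (expR_ge1Dx _); rewrite lerDr.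
have xej : `|X x| ^+ j <= (8 / e) ^+ j * expR (e / 4 * `|X x|).
  have /le_trans -> // : `|X x| ^+ j <= (8 / e * expR (e / 8 * `|X x|)) ^+ j.
    by rewrite lerXn2r// nnegrE mulr_ge0 ?expR_ge0// divr_ge0// ltW.
  rewrite exprMn ler_wpM2l ?exprn_ge0 ?divr_ge0 ?(ltW e0)//.
  rewrite -expRM_natl ler_expR mulrA ler_wpM2r//.
  have : j%:R <= 2 :> R by rewrite ler_nat.
  by have := e0; nra.
rewrite (le_trans (ler_wpM2r _ xej)) ?expR_ge0// -[leLHS]mulrA ler_wpM2l//.
  by rewrite exprn_ge0 ?divr_ge0 ?(ltW e0).
rewrite -expRD.
have h : e / 4 * `|X x| + - (t * X x) <= e / 2 * `|X x|.
  have : - (t * X x) <= `|t| * `|X x| by rewrite -normrM -normrN ler_norm.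
  have : `|t| * `|X x| <= e / 4 * `|X x| by rewrite ler_wpM2r// ltW.
  have -> : e / 2 * `|X x| = e / 4 * `|X x| + e / 4 * `|X x| by field.
  lra.
rewrite (le_trans (_ : _ <= expR (e / 2 * `|X x|))) ?ler_expR//.
have [x0|x0] := leP 0 (X x).
  by rewrite ger0_norm// lerDl expR_ge0.
by rewrite ltr0_norm// mulrN lerDr expR_ge0.
Qed.

Let I : set R := `]- (e / 4), (e / 4)[.

Let I_norm (t : R) : I t <-> `|t| < e / 4.
Proof. by rewrite /I /= in_itv/= ltr_norml. Qed.

Let measurable_pow j (t : R) : measurable_fun setT (fun x => X x ^+ j * expR (- (t * X x))).
Proof.
apply: measurable_funM; first exact: measurable_funX.
by apply: measurableT_comp => //; apply: measurable_funN; apply: measurable_funM.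
Qed.

Let integrable_pow (j : nat) (t : R) : (j <= 2)%N -> `|t| < e / 4 ->
  P.-integrable setT (EFin \o (fun x => X x ^+ j * expR (- (t * X x)))).
Proof.
move=> j2 te.
apply: (@le_integrable _ _ _ P setT _ _ (fun x => ((8 / e) ^+ j)%:E * (dom x)%:E)%E) => //.
- by apply/measurable_EFinP; exact: measurable_pow.
- move=> x _ /=; rewrite lee_fin (le_trans (pow_expR_le _ j2 te))//.
  by rewrite ler_norm.
- exact: integrableZl.
Qed.

Let mom (j : nat) (t : R) : R := \int[P]_x (X x ^+ j * expR (- (t * X x)))%R.

Let mom_derive (j : nat) (t : R) : (j <= 1)%N -> `|t| < e / 4 ->
  is_derive t 1 (mom j) (- mom j.+1 t).
Proof.
move=> j1 te.
have j2 : (j <= 2)%N by rewrite (leq_trans j1).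
pose f (t : R) x := X x ^+ j * expR (- (t * X x)).
have df (u : R) x : is_derive u 1 (fun u => f u x) (- (X x ^+ j.+1 * expR (- (u * X x)))).
  have h : is_derive u 1 (expR \o (fun u : R => - (u * X x)))
      (expR (- (u * X x)) * - X x).
    by apply: is_derive1_comp; exact: is_derive_linear.
  have := is_deriveZ (X x ^+ j) h; rewrite /GRing.scale /= => {}h.
  rewrite exprS (_ : - _ = X x ^+ j * (expR (- (u * X x)) * - X x))//.
  by ring.
have Ia : I t by apply/I_norm.
have d1 u x : partial1of2 f u x = - (X x ^+ j.+1 * expR (- (u * X x))).
  by rewrite partial1of2E; have [_ ->] := df u x.
have := @cvg_differentiation_under_integral _ _ _ P f setT measurableT t _ _ Ia _ _
  (fun x => (8 / e) ^+ j.+1 * dom x) _ _ _.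
have a1 x : `]- (e / 4), (e / 4)[%classic x -> P.-integrable setT (EFin \o f x).
  by move/I_norm; exact: integrable_pow.
have a2 x y : `]- (e / 4), (e / 4)[%classic x -> setT y -> derivable (f ^~ y) x 1.
  by move=> _ _; have [] := df x y.
have a3 y : 0 <= (8 / e) ^+ j.+1 * dom y.
  by rewrite mulr_ge0// exprn_ge0// divr_ge0// ltW.
have a4 : P.-integrable setT (EFin \o (fun x => (8 / e) ^+ j.+1 * dom x)).
  exact: (@integrableZl _ _ _ P setT measurableT ((8 / e) ^+ j.+1) _ integrable_dom).
have a5 x y : `]- (e / 4), (e / 4)[%classic x -> setT y ->
    `|partial1of2 f x y| <= (8 / e) ^+ j.+1 * dom y.
  by move/I_norm => xe _; rewrite d1 normrN pow_expR_le.
move=> /(_ a1 a2 a3 a4 a5) h.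
have lim : \int[P]_y partial1of2 f t y = - mom j.+1 t.
  transitivity (\int[P]_y (-1 * (X y ^+ j.+1 * expR (- (t * X y)))))%R.
    by apply: eq_Rintegral => y _; rewrite d1 mulN1r.
  by rewrite RintegralZl ?mulN1r//; exact: integrable_pow.
rewrite lim in h.
apply: DeriveDef.
  by apply/cvg_ex; exists (- mom j.+1 t); under eq_fun do rewrite scaler1.
by rewrite -derive1E /derive1; exact: (cvg_lim _ h).
Qed.

Let e4_lt (t : R) : `|t| < e / 4 -> `|t| < e.
Proof. by move/lt_trans; apply; have := e0; lra. Qed.

Let near_small (t : R) : `|t| < e / 4 -> \forall u \near t, `|u| < e / 4.
Proof.
move=> te; have : I t by apply/I_norm.
move=> It; near=> u; apply/I_norm; near: u.
exact: (near_in_itvoo It).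
Unshelve. all: by end_near. Qed.

Let mom0E (t : R) : `|t| < e / 4 -> mom 0 t = phi t.
Proof.
move=> te; rewrite /mom /Rintegral; under eq_integral do rewrite expr0 mul1r.
by rewrite mgf// e4_lt.
Qed.

Let mom1E (t : R) : `|t| < e / 4 -> mom 1 t = - phi1 t.
Proof.
move=> te; have d1 := mom_derive (leq0n 1) te.
have d2 : is_derive t 1 (mom 0) (phi1 t).
  apply: near_eq_is_derive (dphi (e4_lt te)).
  by near=> u; rewrite mom0E//; near: u; exact: near_small.
have [_ <-] := d2; have [_ ->] := d1; by rewrite opprK.
Unshelve. all: by end_near. Qed.

Let norm0e : `|0 : R| < e / 4.
Proof. by rewrite normr0 divr_gt0. Qed.

Let mom2E : mom 2 0 = kappa.
Proof.
have d1 := mom_derive (leqnn 1) norm0e.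
have d2 : is_derive (0 : R) 1 (mom 1) (- kappa).
  apply: near_eq_is_derive (is_deriveN dphi1).
  by near=> u; rewrite mom1E//; near: u; exact: near_small.
apply: oppr_inj; have [_ <-] := d2; have [_ ->] := d1; by [].
Unshelve. all: by end_near. Qed.

(** Two powers of [X] are absorbed by a small exponential rate. *)
Lemma Lfun2_of_mgf : X \in Lfun P 2%:E.
Proof.
have /integrableP[_ h] := integrable_pow (leqnn 2) norm0e.
rewrite inE; apply/andP; split; rewrite inE//=.
rewrite /finite_norm unlock /Lnorm; apply: poweR_lty.
under eq_integral => x _.
  rewrite /= (_ : `|X x| `^ 2 = `|X x ^+ 2 * expR (- (0 * X x))|); first over.
  by rewrite mul0r oppr0 expR0 mulr1 normrX powR_mulrn.
exact: h.
Qed.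

(** The first two moments are the derivatives at 0 of the moment generating function. *)
Lemma variance_of_mgf : variance P X = (kappa - phi1 0 ^+ 2)%:E.
Proof.
rewrite varianceE ?Lfun2_of_mgf//.
have i1 := integrable_pow (leqnSn 1) norm0e.
have i2 := integrable_pow (leqnn 2) norm0e.
have E1 : ('E_P[X] = (- phi1 0)%:E)%E.
  rewrite -mom1E// /mom /Rintegral fineK; last exact: integrable_fin_num.
  by rewrite unlock; apply: eq_integral => x _; rewrite mul0r oppr0 expR0 mulr1 expr1.
have E2 : ('E_P[X ^+ 2] = kappa%:E)%E.
  rewrite -mom2E /mom /Rintegral fineK; last exact: integrable_fin_num.
  by rewrite unlock; apply: eq_integral => x _; rewrite mul0r oppr0 expR0 mulr1.
by rewrite E1 E2 -EFin_expe -EFinB sqrrN.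
Qed.

End moments.

(** * Derivatives of the pivots along a line *)

Section jets.
Context {R : realType}.
Implicit Types (al be zd zo : nat -> R) (t : R).

Definition line al zd t : nat -> R := fun j => al j + t * zd j.

(** First and second derivatives of [elim_gain] when [al] and [be] move with
velocities [zd] and [zo]: see [is_derive_elim_gain]. *)
Fixpoint gain1 al be zd zo (j : nat) : R :=
  if j is i.+1 then
    let c := be i / pivot al be i in
    2 * c * zo i - c ^+ 2 * (zd i - gain1 al be zd zo i)
  else 0.

Definition pivot1 al be zd zo j : R := zd j - gain1 al be zd zo j.

Fixpoint gain2 al be zd zo (j : nat) : R :=
  if j is i.+1 then
    let c := be i / pivot al be i in
    2 * (zo i - c * pivot1 al be zd zo i) ^+ 2 / pivot al be i
      + c ^+ 2 * gain2 al be zd zo i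
  else 0.

(** Minus the second derivative of the logarithm of the pivot: see
[is_derive_ln_pivot] and [is_derive_pivot_ratio]. *)
Definition log_curv al be zd zo j : R :=
  gain2 al be zd zo j / pivot al be j + (pivot1 al be zd zo j / pivot al be j) ^+ 2.

Lemma is_derive_fM (f g : R -> R) t df dg :
  is_derive t 1 f df -> is_derive t 1 g dg ->
  is_derive t 1 (fun x => f x * g x) (f t * dg + g t * df).
Proof. by move=> hf hg; exact: is_deriveM. Qed.

Lemma is_derive_fD (f g : R -> R) t df dg :
  is_derive t 1 f df -> is_derive t 1 g dg ->
  is_derive t 1 (fun x => f x + g x) (df + dg).
Proof. by move=> hf hg; exact: is_deriveD. Qed.

Lemma is_derive_fN (f : R -> R) t df :
  is_derive t 1 f df -> is_derive t 1 (fun x => - f x) (- df).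
Proof. by move=> hf; exact: is_deriveN. Qed.

Lemma is_derive_fB (f g : R -> R) t df dg :
  is_derive t 1 f df -> is_derive t 1 g dg ->
  is_derive t 1 (fun x => f x - g x) (df - dg).
Proof. by move=> hf hg; apply: is_derive_fD => //; exact: is_derive_fN. Qed.

Lemma is_derive_fC (c t : R) : is_derive t 1 (fun _ : R => c) 0.
Proof. exact: is_derive_cst. Qed.

Lemma is_derive_fdiv (f g : R -> R) t df dg :
  is_derive t 1 f df -> is_derive t 1 g dg -> g t != 0 ->
  is_derive t 1 (fun x => f x / g x) ((df - f t / g t * dg) / g t).
Proof.
move=> hf hg g0.
have := is_derive_fM hf (is_deriveV g0 hg); rewrite /GRing.scale /=.
rewrite (_ : _ + _ = (df - f t / g t * dg) / g t)//.
by rewrite -exprVn; field.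
Qed.

Lemma is_derive_line al zd j t :
  is_derive t 1 (fun t => line al zd t j) (zd j).
Proof.
have := is_derive_fD (is_derive_fC (al j) t)
  (is_derive_fM (is_derive_id t 1) (is_derive_fC (zd j) t)).
by rewrite mulr0 mulr1 !add0r.
Qed.

Lemma is_derive_ord_sum c (f : 'I_c -> R -> R) (df : 'I_c -> R) t :
  (forall j, is_derive t 1 (f j) (df j)) ->
  is_derive t 1 (fun x => \sum_(j < c) f j x) (\sum_(j < c) df j).
Proof.
elim: c f df => [|c IH] f df h.
  rewrite big_ord0 (_ : (fun _ => _) = (fun _ : R => 0)); last first.
    by apply/funext => x; rewrite big_ord0.
  exact: is_derive_fC.
rewrite big_ord_recl (_ : (fun _ => _) =
  (fun x => f ord0 x + \sum_(j < c) f (lift ord0 j) x)).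
  exact: is_derive_fD (h _) (IH _ _ (fun j => h _)).
by apply/funext => x; rewrite big_ord_recl.
Qed.

Lemma is_derive_elim_gain al be zd zo t j :
  (forall i, (i < j)%N -> pivot (line al zd t) (line be zo t) i != 0) ->
  is_derive t 1 (fun t => elim_gain (line al zd t) (line be zo t) j)
    (gain1 (line al zd t) (line be zo t) zd zo j) /\
  is_derive t 1 (fun t => gain1 (line al zd t) (line be zo t) zd zo j)
    (gain2 (line al zd t) (line be zo t) zd zo j).
Proof.
elim: j => [|j IH] p0; first by split; exact: is_derive_fC.
have [h1 h2] := IH (fun i ij => p0 i (ltnW ij)).
have pj : line al zd t j - elim_gain (line al zd t) (line be zo t) j != 0.
  by have := p0 j (ltnSn j).
have dp := is_derive_fB (is_derive_line al zd j t) h1.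
have db := is_derive_line be zo j t.
have dc := is_derive_fdiv db dp pj.
have dp1 := is_derive_fB (is_derive_fC (zd j) t) h2.
split.
- have := is_derive_fdiv (is_derive_fM db db) dp pj.
  rewrite [X in is_derive _ _ _ X](_ : _ =
    gain1 (line al zd t) (line be zo t) zd zo j.+1) => [|/=].
    by under eq_fun do rewrite -expr2.
  rewrite /pivot; move: pj; set p := _ - _ => pj; by field.
- have := is_derive_fB (is_derive_fM (is_derive_fM (is_derive_fC 2 t) dc) (is_derive_fC (zo j) t))
   (is_derive_fM (is_derive_fM dc dc) dp1).
  rewrite [X in is_derive _ _ _ X](_ : _ =
    gain2 (line al zd t) (line be zo t) zd zo j.+1) => [|/=].
    by under eq_fun do rewrite -expr2.
  rewrite /pivot1 /pivot; move: pj; set p := _ - _ => pj; by field.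
Qed.

Lemma is_derive_ln_pivot al be zd zo t j :
  (forall i, (i <= j)%N -> 0 < pivot (line al zd t) (line be zo t) i) ->
  is_derive t 1 (fun t => ln (pivot (line al zd t) (line be zo t) j))
    (pivot1 (line al zd t) (line be zo t) zd zo j / pivot (line al zd t) (line be zo t) j).
Proof.
move=> p0.
have [h1 _] := @is_derive_elim_gain al be zd zo t j
  (fun i ij => lt0r_neq0 (p0 i (ltnW ij))).
have dp := is_derive_fB (is_derive_line al zd j t) h1.
by rewrite mulrC; apply: (is_derive1_comp _ dp); exact: is_derive1_ln (p0 _ (leqnn j)).
Qed.

Lemma is_derive_pivot_ratio al be zd zo t j :
  (forall i, (i <= j)%N -> 0 < pivot (line al zd t) (line be zo t) i) ->
  is_derive t 1 (fun t => pivot1 (line al zd t) (line be zo t) zd zo j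
     / pivot (line al zd t) (line be zo t) j)
    (- log_curv (line al zd t) (line be zo t) zd zo j).
Proof.
move=> p0.
have [h1 h2] := @is_derive_elim_gain al be zd zo t j
  (fun i ij => lt0r_neq0 (p0 i (ltnW ij))).
have pj := lt0r_neq0 (p0 _ (leqnn j)).
have dp := is_derive_fB (is_derive_line al zd j t) h1.
have dp1 := is_derive_fB (is_derive_fC (zd j) t) h2.
have := is_derive_fdiv dp1 dp pj.
rewrite [X in is_derive _ _ _ X](_ : _ =
  - log_curv (line al zd t) (line be zo t) zd zo j)//.
rewrite /log_curv /pivot1 /pivot in pj *; move: pj.
set p := _ - elim_gain _ _ _ => pj; by field.
Qed.

Lemma near_pos_derivable (f : R -> R) (df : R) :
  is_derive (0 : R) 1 f df -> 0 < f 0 -> \forall t \near (0 : R), 0 < f t.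
Proof.
move=> [df0 _] f0.
have /differentiable_continuous cf : differentiable f 0 by apply/derivable1_diffP.
exact: (cvgr_gt _ cf).
Qed.

Lemma line0 al zd : line al zd 0 = al.
Proof. by apply/funext => j; rewrite /line mul0r addr0. Qed.

(** As long as the earlier pivots do not vanish the next one is differentiable, so it
stays positive near 0. *)
Lemma near_pos_pivot al be zd zo J :
  (forall j, (j < J)%N -> 0 < pivot al be j) ->
  \forall t \near (0 : R), forall j, (j < J)%N ->
    0 < pivot (line al zd t) (line be zo t) j.
Proof.
elim: J => [|J IH] p0; first by near=> t.
have h1 := IH (fun j jJ => p0 j (ltnW jJ)).
have pJ i : (i < J)%N -> pivot (line al zd 0) (line be zo 0) i != 0.
  by rewrite !line0 => iJ; rewrite lt0r_neq0// p0// ltnW.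
have [dh _] := is_derive_elim_gain pJ.
have dp := is_derive_fB (is_derive_line al zd J 0) dh.
have p00 : 0 < line al zd 0 J - elim_gain (line al zd 0) (line be zo 0) J.
  by rewrite !line0; exact: p0.
have h2 := near_pos_derivable dp p00.
near=> t.
have ht1 : forall j, (j < J)%N -> 0 < pivot (line al zd t) (line be zo t) j by near: t.
have ht2 : 0 < pivot (line al zd t) (line be zo t) J by near: t.
by move=> j; rewrite ltnS leq_eqVlt => /predU1P[->|/ht1].
Unshelve. all: by end_near. Qed.

End jets.

(** * Elimination along a chain of vertices *)

Section bilinear.
Context {R : realType} {n : nat}.
Implicit Types (A Y z : 'M[R]_n) (u v w : 'cV[R]_n).

Definition bil A u v : R := (u^T *m A *m v) 0 0.

Lemma bilDl A u u' v : bil A (u + u') v = bil A u v + bil A u' v.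
Proof. by rewrite /bil linearD /= !mulmxDl mxE. Qed.

Lemma bilNl A u v : bil A (- u) v = - bil A u v.
Proof. by rewrite /bil linearN /= !mulNmx mxE. Qed.

Lemma bilBl A u u' v : bil A (u - u') v = bil A u v - bil A u' v.
Proof. by rewrite bilDl bilNl. Qed.

Lemma bilZl A a u v : bil A (a *: u) v = a * bil A u v.
Proof. by rewrite /bil linearZ /= -!scalemxAl mxE. Qed.

Lemma bilDr A u v v' : bil A u (v + v') = bil A u v + bil A u v'.
Proof. by rewrite /bil mulmxDr mxE. Qed.

Lemma bilNr A u v : bil A u (- v) = - bil A u v.
Proof. by rewrite /bil mulmxN mxE. Qed.

Lemma bilBr A u v v' : bil A u (v - v') = bil A u v - bil A u v'.
Proof. by rewrite bilDr bilNr. Qed.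

Lemma bilZr A a u v : bil A u (a *: v) = a * bil A u v.
Proof. by rewrite /bil -scalemxAr mxE. Qed.

Lemma bil0r A u : bil A u 0 = 0.
Proof. by rewrite /bil mulmx0 mxE. Qed.

Lemma bilC A u v : A^T = A -> bil A u v = bil A v u.
Proof.
move=> AT; rewrite /bil -[RHS](_ : ((v^T *m A *m u)^T) 0 0 = _); last by rewrite mxE.
by rewrite !trmx_mul trmxK AT mulmxA.
Qed.

Definition evec (i : 'I_n) : 'cV[R]_n := delta_mx i 0.

Lemma bil_evec A i j : bil A (evec i) (evec j) = A i j.
Proof. by rewrite /bil /evec trmx_delta -rowE -colE !mxE. Qed.

Lemma outer_mul w z u : (w *m w^T) *m z *m u = bil z w u *: w.
Proof.
rewrite -!mulmxA (_ : w^T *m (z *m u) = (bil z w u)%:M).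
  by rewrite mul_mx_scalar.
by rewrite [LHS]mx11_scalar /bil mulmxA.
Qed.

Lemma rank1_mul Y a w z u :
  (Y + a *: (w *m w^T)) *m z *m u = Y *m z *m u + (a * bil z w u) *: w.
Proof. by rewrite !mulmxDl -!scalemxAl outer_mul scalerA. Qed.

Lemma bilM z Y u v : z^T = z -> bil (z *m Y *m z) u v = bil z u (Y *m z *m v).
Proof. by move=> _; rewrite /bil !mulmxA. Qed.

Definition quad_tr z Y : R := \tr (z *m Y *m z *m Y).

Lemma tr_outer A w : \tr (A *m (w *m w^T)) = bil A w w.
Proof.
by rewrite mulmxA mxtrace_mulC mulmxA /bil /mxtrace big_ord1.
Qed.

Lemma quad_tr0 z : quad_tr z 0 = 0.
Proof. by rewrite /quad_tr mulmx0 mxtrace0. Qed.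

(** The effect of bordering on tr(z Y z Y); [z] is symmetric, so that the two mixed
terms agree. *)
Lemma quad_tr_add z Y w a : z^T = z ->
  quad_tr z (Y + a *: (w *m w^T)) =
  quad_tr z Y + 2 * a * bil z w (Y *m z *m w) + (a * bil z w w) ^+ 2.
Proof.
move=> zT; rewrite /quad_tr !mulmxDr !mulmxDl !linearD /=.
rewrite -!scalemxAr -!scalemxAl -?scalemxAr !linearZ /=.
rewrite !tr_outer.
have -> : \tr (z *m (w *m w^T) *m z *m Y) = bil z w (Y *m z *m w).
  by rewrite -bilM// -tr_outer -[in LHS](mulmxA _ z Y) [LHS]mxtrace_mulC !mulmxA.
rewrite (_ : bil (z *m Y *m z) w w = bil z w (Y *m z *m w)); last exact: bilM.
have -> : bil (z *m (w *m w^T) *m z) w w = bil z w w ^+ 2.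
  by rewrite bilM// outer_mul bilZr expr2.
ring.
Qed.

Lemma sym_entry z i j : z^T = z -> z i j = z j i.
Proof. by move=> zT; rewrite -[in LHS]zT mxE. Qed.

End bilinear.

Section chain.
Context {R : realType} {n : nat}.
Variables (f : nat -> 'I_n) (J : nat) (y : 'M[R]_n).
Implicit Types (z : 'M[R]_n).

Definition chain_mx z : Prop := z^T = z /\
  forall i j, (i < J)%N -> (j < J)%N -> (i.+1 < j)%N -> z (f i) (f j) = 0.

Notation diag z := (fun j => z (f j) (f j)).
Notation off z := (fun j => z (f j) (f j.+1)).
Notation e j := (evec (f j) : 'cV[R]_n).

Local Notation al := (diag y).
Local Notation be := (off y).
Local Notation piv := (pivot al be).

(** [wvec j] is the vector e_j + (combination of e_0, .., e_(j-1)) which is orthogonal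
to e_0, .., e_(j-1) for the form of [y] ([chain_bil_near]), and [Ymx j] inverts
[y] on these vertices ([Ymx_id]). *)
Fixpoint wvec (j : nat) : 'cV[R]_n :=
  if j is i.+1 then e i.+1 - (be i / piv i) *: wvec i else e 0%N.

Fixpoint Ymx (j : nat) : 'M[R]_n :=
  if j is i.+1 then Ymx i + (piv i)^-1 *: (wvec i *m (wvec i)^T) else 0.

(** [wvec j] has coefficient 1 at [f j], and [f i] is not adjacent to the rest of its
support. *)
Lemma chain_bil_far z i j : chain_mx z -> (i < J)%N -> (j < i)%N ->
  bil z (e i) (wvec j) = z (f i) (f j).
Proof.
move=> [zT z0] iJ; elim: j => [|j IH] ji /=; first by rewrite bil_evec.
rewrite bilBr bilZr bil_evec IH; last exact: ltnW.
have ij : (j < J)%N by rewrite (ltn_trans _ iJ)// ltnW.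
by rewrite [z (f i) (f j)]sym_entry// [z (f j) (f i)]z0// mulr0 subr0.
Qed.

Hypothesis cy : chain_mx y.
Let yT : y^T = y := cy.1.

Lemma chain_bil_diag j : (j < J)%N -> bil y (e j) (wvec j) = piv j.
Proof.
case: j => [|j] jJ /=; first by rewrite bil_evec /pivot subr0.
rewrite bilBr bilZr bil_evec chain_bil_far//.
by rewrite [y (f j.+1) (f j)]sym_entry// /pivot /=; ring.
Qed.

Lemma chain_bil_near i j : (j < J)%N -> (forall k, (k < j)%N -> piv k != 0) ->
  (i < j)%N -> bil y (e i) (wvec j) = 0.
Proof.
move=> + + ij; elim: j ij => [//|j IH] ij jJ p0 /=.
rewrite bilBr bilZr bil_evec; move: ij; rewrite ltnS leq_eqVlt => /predU1P[->|ij].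
  by rewrite chain_bil_diag 1?ltnW// divfK ?subrr// p0.
rewrite IH//; [|exact: ltnW|by move=> k kj; exact/p0/ltnW].
have iJ : (i < J)%N by exact: ltn_trans ij (ltnW jJ).
by rewrite mulr0 subr0; apply: (cy.2 _ _ iJ jJ); rewrite ltnS.
Qed.

Lemma chain_wvec_orth i j : (j < J)%N -> (forall k, (k < j)%N -> piv k != 0) ->
  (i < j)%N -> bil y (wvec i) (wvec j) = 0.
Proof.
move=> jJ p0; elim: i => [|i IH] ij /=; first exact: chain_bil_near.
by rewrite bilBl bilZl chain_bil_near// IH ?mulr0 ?subr0// ltnW.
Qed.

Lemma chain_wvec_norm j : (j < J)%N -> (forall k, (k < j)%N -> piv k != 0) ->
  bil y (wvec j) (wvec j) = piv j.
Proof.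
case: j => [|j] jJ p0; first exact: chain_bil_diag.
rewrite [X in bil _ X _]/= bilBl bilZl chain_bil_diag//.
by rewrite chain_wvec_orth ?mulr0 ?subr0.
Qed.

Hypothesis f_inj : forall i j, (i < J)%N -> (j < J)%N -> f i = f j -> i = j.

Lemma wvec_coord i j : (i < J)%N -> (j <= i)%N -> wvec j (f i) 0 = (i == j)%:R.
Proof.
move=> iJ; elim: j => [|j IH] ji; rewrite /= /evec !mxE !eqxx andbT.
  congr (_%:R); case: eqP => [/f_inj ->//|ne]; first by rewrite (leq_ltn_trans _ iJ).
  by case: eqP => // i0; rewrite i0 in ne.
rewrite IH 1?ltnW// gtn_eqF// mulr0 subr0.
congr (_%:R); case: eqP => [/f_inj ->//|ne]; first by rewrite eqxx.
  by rewrite (leq_ltn_trans ji).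
by case: eqP => // i0; rewrite i0 in ne.
Qed.

(** The pivot is the value of the form of [y] at [wvec j], whose entry at [f j] is 1. *)
Lemma chain_piv_gt0 : posdef y -> forall j, (j < J)%N -> 0 < piv j.
Proof.
move=> [_ py] j; elim/ltn_ind: j => j IH jJ.
have p0 k : (k < j)%N -> piv k != 0.
  by move=> kj; rewrite lt0r_neq0// IH// (ltn_trans kj).
rewrite -(chain_wvec_norm jJ p0).
have := py (wvec j)^T; rewrite trmxK; apply.
apply/eqP => /(congr1 trmx); rewrite trmxK trmx0 => /matrixP/(_ (f j) 0).
by rewrite wvec_coord// eqxx mxE => /eqP; rewrite oner_eq0.
Qed.

Lemma Ymx_far z j k : chain_mx z -> (k < J)%N -> (j < k)%N ->
  Ymx j *m z *m e k = 0.
Proof.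
move=> cz kJ; elim: j => [|j IH] jk; first by rewrite !mul0mx.
rewrite /= !mulmxDl IH 1?ltnW// add0r -!scalemxAl outer_mul.
rewrite bilC; last exact: cz.1.
rewrite chain_bil_far//; last exact: ltnW.
rewrite sym_entry; last exact: cz.1.
have jJ : (j < J)%N by exact: ltn_trans (ltnW jk) kJ.
by rewrite (cz.2 _ _ jJ kJ jk) scale0r scaler0.
Qed.

Hypothesis piv_neq0 : forall j, (j < J)%N -> piv j != 0.

(** What elimination subtracts from the basis vector of the next vertex. *)
Lemma Ymx_next j : (j < J)%N -> Ymx j *m y *m e j = e j - wvec j.
Proof.
case: j => [|j] jJ; first by rewrite !mul0mx subrr.
rewrite [Ymx _]/= !mulmxDl Ymx_far// add0r -!scalemxAl outer_mul bilC//.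
rewrite chain_bil_far// scalerA [y (f j.+1) (f j)]sym_entry// /=.
by rewrite opprB addrC subrK mulrC.
Qed.

Lemma Ymx_id j k : (j <= J)%N -> (k < j)%N -> Ymx j *m y *m e k = e k.
Proof.
elim: j => [//|j IH] jJ; rewrite ltnS leq_eqVlt [Ymx _]/= !mulmxDl -!scalemxAl
  outer_mul bilC//.
move=> /predU1P[->|kj].
  rewrite Ymx_next// chain_bil_diag// scalerA mulVf ?scale1r ?subrK//.
  exact: piv_neq0.
rewrite IH ?(ltnW jJ)// chain_bil_near ?scale0r ?scaler0 ?addr0//.
by move=> i ij; apply: piv_neq0; rewrite (ltn_trans ij).
Qed.

Lemma tr_Ymx j : (Ymx j)^T = Ymx j.
Proof.
elim: j => [|j IH]; first by rewrite trmx0.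
by rewrite /= linearD /= IH linearZ /= trmx_mul trmxK.
Qed.

Lemma wvec_supp j x : (forall i, (i <= j)%N -> x != f i) -> wvec j x 0 = 0.
Proof.
elim: j => [|j IH] h /=; rewrite /evec !mxE eqxx andbT (negbTE (h _ (leqnn _)))//.
by rewrite IH ?mulr0 ?subr0// => i ij; apply: h; exact: leqW.
Qed.

Lemma Ymx_supp j x x' : (forall i, (i < j)%N -> x != f i) -> Ymx j x x' = 0.
Proof.
elim: j => [|j IH] h /=; first by rewrite mxE.
rewrite mxE IH; last by move=> i ij; apply: h; exact: leqW.
by rewrite !mxE big_ord1 wvec_supp// mul0r mulr0 addr0.
Qed.

Lemma chain_pivot1 z j : chain_mx z -> (j < J)%N ->
  bil z (wvec j) (wvec j) = pivot1 al be (diag z) (off z) j.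
Proof.
move=> cz; elim: j => [|j IH] jJ; first by rewrite /pivot1 /= bil_evec subr0.
rewrite /= !bilBl !bilBr !bilZl !bilZr bil_evec IH 1?ltnW//.
rewrite [bil z (wvec j) _]bilC; last exact: cz.1.
rewrite chain_bil_far// [z (f j.+1) (f j)]sym_entry ?/pivot1 /=; last exact: cz.1.
by rewrite -/(pivot1 _ _ _ _ _); ring.
Qed.

(** Both sides satisfy the recursion obtained from w_(j+1) = e_(j+1) - c w_j, since
[Ymx j] annihilates [z] applied to e_(j+1). *)
Lemma chain_gain2 z j : chain_mx z -> (j < J)%N ->
  2 * bil z (wvec j) (Ymx j *m z *m wvec j) = gain2 al be (diag z) (off z) j.
Proof.
move=> cz; have zT := cz.1; elim: j => [|j IH] jJ; first by rewrite /= !mul0mx bil0r mulr0.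
set c := be j / piv j.
have nextw : Ymx j.+1 *m z *m wvec j.+1 =
    - c *: (Ymx j *m z *m wvec j) +
    ((piv j)^-1 * (z (f j) (f j.+1) - c * bil z (wvec j) (wvec j))) *: wvec j.
  rewrite [Ymx _]/= !mulmxDl -!scalemxAl outer_mul; congr (_ + _).
    by rewrite /= mulmxBr Ymx_far// sub0r -scalemxAr scaleNr.
  rewrite scalerA; congr (_ * _ *: _); rewrite /= bilBr bilZr.
  by rewrite bilC// chain_bil_far// sym_entry.
rewrite nextw bilDr !bilZr /= -/c !bilBl !bilZl -/c.
have -> : bil z (e j.+1) (Ymx j *m z *m wvec j) = 0.
  rewrite -bilM// bilC; last by rewrite !trmx_mul tr_Ymx zT mulmxA.
  by rewrite bilM// Ymx_far// bil0r.
rewrite chain_bil_far// [z (f j.+1) (f j)]sym_entry// chain_pivot1 1?ltnW//.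
rewrite -IH 1?ltnW// /c; ring.
Qed.

(** The increase is 2 w^T z Y z w / p + (w^T z w / p)^2, where the first term is -p''/p
by [chain_gain2] and the second is (p'/p)^2 by [chain_pivot1]. *)
Lemma chain_quad z j : chain_mx z -> (j < J)%N ->
  quad_tr z (Ymx j.+1) - quad_tr z (Ymx j) = log_curv al be (diag z) (off z) j.
Proof.
move=> cz jJ; rewrite [Ymx _.+1]/= quad_tr_add; last exact: cz.1.
rewrite chain_pivot1// /log_curv -chain_gain2//.
set p := piv j; ring.
Qed.

End chain.

(** * Padded inverses, the covariance operators and the root vertex *)

Section padded_inverse.
Context {R : realType} {n : nat}.

(** A matrix supported on [B] that inverts [y] there restricts to the inverse of the
submatrix. *)
Lemma pad0_invmx (B : {set 'I_n}) (Y y : 'M[R]_n) :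
  Y^T = Y -> (forall i j, i \notin B -> Y i j = 0) ->
  (forall b, b \in B -> Y *m y *m evec b = evec b) ->
  pad0 (invmx (psubmx B y)) = Y.
Proof.
move=> YT Y0 Yy.
have Y0' i j : j \notin B -> Y i j = 0 by move=> jB; rewrite sym_entry// Y0.
have YyB : psubmx B Y *m psubmx B y = 1%:M.
  apply/matrixP => a b; rewrite !mxE.
  transitivity ((Y *m y) (enum_val a) (enum_val b)); last first.
    have := Yy _ (enum_valP b) => /matrixP/(_ (enum_val a) 0).
    rewrite /evec -colE !mxE eqxx andbT => ->.
    by rewrite (inj_eq enum_val_inj).
  rewrite mxE [RHS](bigID (fun x => x \in B)) /= [X in _ + X]big1 ?addr0.
    by rewrite [RHS]big_enum_val; apply: eq_bigr => c _; rewrite !mxE.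
  by move=> x xB; rewrite Y0' ?mul0r.
have uB : psubmx B y \in unitmx by have [] := mulmx1_unit YyB.
have -> : invmx (psubmx B y) = psubmx B Y.
  by rewrite -[LHS]mul1mx -YyB mulmxK.
rewrite [RHS]matrix_sum_delta /pad0.
rewrite [RHS](bigID (fun x => x \in B)) /= [X in _ = _ + X]big1 ?addr0; last first.
  by move=> i iB; apply: big1 => j _; rewrite Y0 ?scale0r.
rewrite [RHS]big_enum_val; apply: eq_bigr => a _.
rewrite [RHS](bigID (fun x => x \in B)) /= [X in _ = _ + X]big1 ?addr0; last first.
  by move=> j jB; rewrite Y0' ?scale0r.
by rewrite [RHS]big_enum_val; apply: eq_bigr => b _; rewrite !mxE.
Qed.

Lemma invmx_evec (Y y : 'M[R]_n) :
  (forall b, Y *m y *m evec b = evec b) -> invmx y = Y.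
Proof.
move=> Yy; have Yy1 : Y *m y = 1%:M.
  apply/matrixP => a b; have := Yy b => /matrixP/(_ a 0).
  by rewrite /evec -colE !mxE eqxx andbT => ->.
have uy : y \in unitmx by have [] := mulmx1_unit Yy1.
by rewrite -[LHS]mul1mx -Yy1 mulmxK.
Qed.

End padded_inverse.

Section pairing_linear.
Context {R : realType} {N : nat}.
Notation n := N.+1.
Implicit Types (y z : 'M[R]_n) (eta : I_G R n).

Lemma rV_atD p (u v : 'rV[R]_p) i : rV_at (u + v) i = rV_at u i + rV_at v i.
Proof.
case: i => [|i]; first by rewrite /rV_at addr0.
have [ip|pi] := ltnP i p; last by rewrite !rV_at_ge ?addr0.
by rewrite !(rV_at_ord _ (Ordinal ip)) mxE.
Qed.

Lemma rV_atZ p a (u : 'rV[R]_p) i : rV_at (a *: u) i = a * rV_at u i.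
Proof.
case: i => [|i]; first by rewrite /rV_at mulr0.
have [ip|pi] := ltnP i p; last by rewrite !rV_at_ge ?mulr0.
by rewrite !(rV_at_ord _ (Ordinal ip)) mxE.
Qed.

Lemma ientD eta eta' i j : ient (eta + eta') i j = ient eta i j + ient eta' i j.
Proof.
by rewrite /ient !linearD !rV_atD; do !case: ifP => _ //; rewrite addr0.
Qed.

Lemma ientZ a eta i j : ient (a *: eta) i j = a * ient eta i j.
Proof.
by rewrite /ient !linearZ !rV_atZ; do !case: ifP => _ //; rewrite mulr0.
Qed.

Lemma pairingDr z eta eta' : pairing z (eta + eta') = pairing z eta + pairing z eta'.
Proof.
rewrite /pairing -big_split; apply: eq_bigr => i _ /=.
by rewrite -big_split; apply: eq_bigr => j _ /=; rewrite !mxE ientD mulrDr.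
Qed.

Lemma pairingZr a z eta : pairing z (a *: eta) = a * pairing z eta.
Proof.
rewrite /pairing mulr_sumr; apply: eq_bigr => i _.
by rewrite mulr_sumr; apply: eq_bigr => j _; rewrite !mxE ientZ mulrCA.
Qed.

Lemma pairing0r z : pairing z (0 : I_G R n) = 0.
Proof. by rewrite -[0 : I_G R n](scale0r (0 : I_G R n)) pairingZr mul0r. Qed.

Lemma pairing_sumr (a b : nat) z (F : nat -> I_G R n) :
  pairing z (\sum_(a <= i < b) F i) = \sum_(a <= i < b) pairing z (F i).
Proof.
by apply: (big_morph (pairing z)); [exact: pairingDr|exact: pairing0r].
Qed.

Lemma pairingDl y z eta : pairing (y + z) eta = pairing y eta + pairing z eta.
Proof.
rewrite /pairing -big_split; apply: eq_bigr => i _ /=.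
by rewrite -big_split; apply: eq_bigr => j _ /=; rewrite !mxE mulrDl.
Qed.

Lemma pairingZl a z eta : pairing (a *: z) eta = a * pairing z eta.
Proof.
rewrite /pairing mulr_sumr; apply: eq_bigr => i _.
by rewrite mulr_sumr; apply: eq_bigr => j _; rewrite !mxE mulrA.
Qed.

Lemma ient_proj (A : 'M[R]_n) (i j : 'I_n) : A^T = A -> pathE i j ->
  ient (proj_IG A) i.+1 j.+1 = A i j.
Proof.
move=> AT; rewrite pathE_cases.
have dg (l : 'I_n) : ient (proj_IG A) l.+1 l.+1 = A l l.
  rewrite /ient eqxx /proj_IG row_mxKl (rV_at_ord _ l) mxE//.
have up (l l' : 'I_n) : l' = l.+1 :> nat -> ient (proj_IG A) l.+1 l'.+1 = A l l'.
  move=> ll; have lN : (l < N)%N by have := ltn_ord l'; rewrite ll ltnS.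
  rewrite /ient ll ltn_eqF// eqxx /proj_IG row_mxKr (rV_at_ord _ (Ordinal lN)) mxE.
  by congr (A _ _); apply/val_inj => //=; rewrite ll.
move=> /or3P[/eqP/val_inj->|/eqP|/eqP]; first exact: dg.
- exact: up.
- by move=> ij; rewrite ientC up// sym_entry.
Qed.

(** The entries of [z] off the edges vanish, so the pairing is a full trace. *)
Lemma pairing_quadP z (u Y : 'M[R]_n) : Z_G z -> u^T = u -> Y^T = Y ->
  pairing z (quadP Y u) = \tr (z *m (Y *m u *m Y)).
Proof.
move=> [zT z0] uT YT.
have AT : (Y *m u *m Y)^T = Y *m u *m Y by rewrite !trmx_mul uT YT mulmxA.
rewrite /quadP /pairing /mxtrace; apply: eq_bigr => i _.
rewrite mxE [RHS](bigID (fun j => pathE i j)) /= [X in _ = _ + X]big1 ?addr0; last first.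
  by move=> j /z0 ->; rewrite mul0r.
apply: eq_bigr => j ij; rewrite mxE ient_proj//.
by congr (_ * _); rewrite sym_entry.
Qed.

Lemma pairing_quadPC z u (Y : 'M[R]_n) : Z_G z -> Z_G u -> Y^T = Y ->
  pairing z (quadP Y u) = pairing u (quadP Y z).
Proof.
move=> Zz Zu YT; rewrite !pairing_quadP ?Zu.1 ?Zz.1//.
by rewrite !mulmxA mxtrace_mulC !mulmxA mxtrace_mulC !mulmxA.
Qed.

Lemma pairing_quadP_diag z (Y : 'M[R]_n) : Z_G z -> Y^T = Y ->
  pairing z (quadP Y z) = quad_tr z Y.
Proof. by move=> Zz YT; rewrite pairing_quadP ?Zz.1// /quad_tr !mulmxA. Qed.

End pairing_linear.

Section root_vertex.
Context {R : realType} (m k : nat).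
Notation n := (m + k).+1.
Variable y : 'M[R]_n.
Hypothesis Zy : Z_G y.
Hypothesis py : posdef y.

Definition fL (j : nat) : 'I_n := inord j.
Definition fR (j : nat) : 'I_n := inord (m + k - j).

Let fL_inj i j : (i < n)%N -> (j < n)%N -> fL i = fL j -> i = j.
Proof. by move=> iN jN /(congr1 val); rewrite /= !inordK. Qed.

Let fR_inj i j : (i < n)%N -> (j < n)%N -> fR i = fR j -> i = j.
Proof. by move=> iN jN /(congr1 val); rewrite /= !inordK; lia. Qed.

Lemma chain_left (z : 'M[R]_n) : Z_G z -> chain_mx fL n z.
Proof.
move=> [zT z0]; split=> // i j iN jN ij; apply: z0.
by rewrite pathE_cases !inordK//; lia.
Qed.

Lemma chain_right (z : 'M[R]_n) : Z_G z -> chain_mx fR n z.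
Proof.
move=> [zT z0]; split=> // i j iN jN ij; apply: z0.
by rewrite pathE_cases !inordK//; lia.
Qed.

Let cL := chain_left Zy.
Let cR := chain_right Zy.

Lemma left_pivot_gt0 j : (j < n)%N -> 0 < pivot (ydiag y) (yoff y) j.
Proof. exact: (chain_piv_gt0 cL fL_inj py). Qed.

Lemma right_pivot_gt0 j : (j < n)%N -> 0 < pivot (rdiag y) (roff y) j.
Proof. exact: (chain_piv_gt0 cR fR_inj py). Qed.

Let pL0 j : (j < n)%N -> pivot (ydiag y) (yoff y) j != 0.
Proof. by move=> jn; rewrite lt0r_neq0// left_pivot_gt0. Qed.

Let pR0 j : (j < n)%N -> pivot (rdiag y) (roff y) j != 0.
Proof. by move=> jn; rewrite lt0r_neq0// right_pivot_gt0. Qed.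

Definition YL : nat -> 'M[R]_n := Ymx fL y.
Definition YR : nat -> 'M[R]_n := Ymx fR y.
Definition wL : nat -> 'cV[R]_n := wvec fL y.
Definition wR : nat -> 'cV[R]_n := wvec fR y.

Lemma YL_pad0 j : (j <= n)%N ->
  pad0 (invmx (psubmx (interval_set n 1 j) y)) = YL j.
Proof.
move=> jn; apply: pad0_invmx; first exact: tr_Ymx.
- move=> x x'; rewrite inE => xj; apply: Ymx_supp => i ij.
  by apply: contra xj => /eqP ->; rewrite inordK//; lia.
- move=> b; rewrite inE /= => bj.
  have -> : b = fL b by rewrite /fL inord_val.
  by apply: (Ymx_id cL pL0).
Qed.

Lemma YR_pad0 i : (0 < i <= n)%N ->
  pad0 (invmx (psubmx (interval_set n i n) y)) = YR (n.+1 - i).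
Proof.
move=> i0; apply: pad0_invmx; first exact: tr_Ymx.
- move=> x x'; rewrite inE => xj; apply: Ymx_supp => l ij.
  by apply: contra xj => /eqP ->; rewrite inordK//; lia.
- move=> b; rewrite inE /= => bj.
  have bn := ltn_ord b.
  have -> : b = fR (m + k - b).
    by apply: val_inj; rewrite /= inordK; lia.
  by apply: (Ymx_id cR pR0); lia.
Qed.

Let eM : 'cV[R]_n := evec (fL m).
Let wroot : 'cV[R]_n := wL m + wR k - eM.
Let mn : (m < n)%N. Proof. by rewrite ltnS leq_addr. Qed.
Let kn : (k < n)%N. Proof. by rewrite ltnS leq_addl. Qed.

Let fRk : fR k = fL m. Proof. by rewrite /fR addnK. Qed.

Let fR_left i : (i < m)%N -> fL i = fR (m + k - i).
Proof. by move=> im; rewrite /fL /fR; congr inord; lia. Qed.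

Let fR_fL j : (j < k)%N -> fR j = fL (m + k - j).
Proof. by []. Qed.

Let YR_left (z : 'M[R]_n) i : Z_G z -> (i < m)%N -> YR k *m z *m evec (fL i) = 0.
Proof.
move=> Zz im; rewrite (fR_left im).
by apply: (Ymx_far y (chain_right Zz)); lia.
Qed.

Let YL_right (z : 'M[R]_n) j : Z_G z -> (j < k)%N -> YL m *m z *m evec (fR j) = 0.
Proof.
move=> Zz jk; rewrite (fR_fL jk).
by apply: (Ymx_far y (chain_left Zz)); lia.
Qed.

Let YL_root : YL m *m y *m eM = eM - wL m.
Proof. exact: (Ymx_next cL). Qed.

Let YR_root : YR k *m y *m eM = eM - wR k.
Proof. by rewrite /eM -fRk; exact: (Ymx_next cR). Qed.

Let bil_left_root i : (i < m)%N -> bil y (evec (fL i)) wroot = 0.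
Proof.
move=> im; rewrite /wroot bilBr bilDr.
rewrite (chain_bil_near cL)//; last by move=> l lm; apply: pL0; lia.
rewrite (fR_left im) (chain_bil_far y cR); [|lia|lia].
by rewrite bil_evec fRk add0r subrr.
Qed.

Let bil_right_root j : (j < k)%N -> bil y (evec (fR j)) wroot = 0.
Proof.
move=> jk; rewrite /wroot bilBr bilDr.
rewrite (chain_bil_near cR)//; last by move=> l lm; apply: pR0; lia.
rewrite (fR_fL jk) (chain_bil_far y cL); [|lia|lia].
by rewrite bil_evec addr0 subrr.
Qed.

Let bil_root : bil y eM wroot = root_pivot y.
Proof.
have h1 : bil y eM (wL m) = pivot (ydiag y) (yoff y) m by exact: (chain_bil_diag cL).
have h2 : bil y eM (wR k) = pivot (rdiag y) (roff y) k.
  by rewrite /eM -fRk; exact: (chain_bil_diag cR).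
have h3 : rdiag y k = ydiag y m by rewrite /rdiag addnK.
rewrite /wroot bilBr bilDr h1 h2 bil_evec /root_pivot /pivot h3.
rewrite -[y (fL m) (fL m)]/(ydiag y m); ring.
Qed.

Let root_orth (j : nat) : (j <= m)%N -> bil y (wL j) wroot = if j == m then root_pivot y else 0.
Proof.
elim: j => [|j IH] jm.
  case: eqP => [j0|/eqP j0]; last by apply: bil_left_root; lia.
  by rewrite /wL /= (_ : evec _ = eM) ?bil_root// /eM; congr (evec (fL _)).
rewrite /wL /= bilBl bilZl -/(wL j) IH 1?ltnW// [j == m]ltn_eqF// mulr0 subr0.
case: eqP => [->|/eqP jm']; first exact: bil_root.
by apply: bil_left_root; rewrite ltn_neqAle jm'.
Qed.

Let root_orthR (j : nat) : (j <= k)%N -> bil y (wR j) wroot = if j == k then root_pivot y else 0.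
Proof.
elim: j => [|j IH] jk.
  case: eqP => [j0|/eqP j0]; last by apply: bil_right_root; lia.
  by rewrite /wR /= (_ : evec _ = eM) ?bil_root// /eM -fRk; congr (evec (fR _)).
rewrite /wR /= bilBl bilZl -/(wR j) IH 1?ltnW// [j == k]ltn_eqF// mulr0 subr0.
case: eqP => [->|/eqP jk']; first by rewrite fRk; exact: bil_root.
by apply: bil_right_root; rewrite ltn_neqAle jk'.
Qed.

Let wroot_coord : wroot (fL m) 0 = 1.
Proof.
have a : wL m (fL m) 0 = 1 by rewrite (wvec_coord y fL_inj)// eqxx.
have b : wR k (fL m) 0 = 1 by rewrite -fRk (wvec_coord y fR_inj)// eqxx.
by rewrite /wroot !mxE a b !eqxx addrK.
Qed.

(** The root pivot is the value of the form of [y] at [wroot], whose entry at the root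
is 1. *)
Lemma root_pivot_gt0 : 0 < root_pivot y.
Proof.
have <- : bil y wroot wroot = root_pivot y.
  rewrite {1}/wroot bilBl bilDl root_orth// root_orthR// bil_root.
  by rewrite !eqxx addrK.
have := py.2 wroot^T; rewrite trmxK; apply.
apply/eqP => /(congr1 trmx); rewrite trmxK trmx0 => /matrixP/(_ (fL m) 0).
by rewrite wroot_coord mxE => /eqP; rewrite oner_eq0.
Qed.

Let Yroot : 'M[R]_n := YL m + YR k + (root_pivot y)^-1 *: (wroot *m wroot^T).

(** Bordering at the root: as the arms are not adjacent, the inverse on the union of
the arms is the sum of their inverses. *)
Lemma invmx_root : invmx y = Yroot.
Proof.
apply: invmx_evec => b.
have yT := Zy.1.
rewrite /Yroot rank1_mul [bil _ wroot _]bilC// [(YL m + _) *m y]mulmxDl mulmxDl.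
have [bm|bm|bm] := ltngtP b m.
- have -> : b = fL b by rewrite /fL inord_val.
  rewrite bil_left_root// mulr0 scale0r addr0 YR_left// addr0.
  by apply: (Ymx_id cL pL0) => //; exact: ltnW.
- have bn := ltn_ord b.
  have -> : b = fR (m + k - b) by apply: val_inj; rewrite /= inordK; lia.
  have bk : (m + k - b < k)%N by lia.
  rewrite bil_right_root// mulr0 scale0r addr0 YL_right// add0r.
  by apply: (Ymx_id cR pR0) => //; exact: ltnW.
- have -> : evec b = eM by rewrite /eM; congr evec; apply: val_inj; rewrite /= inordK.
  rewrite bil_root YL_root YR_root mulVf ?lt0r_neq0 ?root_pivot_gt0//.
  rewrite scale1r /wroot.
  by apply/matrixP => i j; rewrite !mxE; ring.
Qed.

Definition root_curv (z : 'M[R]_n) : R :=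
  (gain2 (ydiag y) (yoff y) (ydiag z) (yoff z) m
   + gain2 (rdiag y) (roff y) (rdiag z) (roff z) k) / root_pivot y +
  ((ydiag z m - gain1 (ydiag y) (yoff y) (ydiag z) (yoff z) m
    - gain1 (rdiag y) (roff y) (rdiag z) (roff z) k) / root_pivot y) ^+ 2.

(** The same computation as in [chain_quad]; the mixed terms between the two arms
vanish because the arms are not adjacent. *)
Lemma root_quad z : Z_G z ->
  quad_tr z (invmx y) - quad_tr z (YL m) - quad_tr z (YR k) = root_curv z.
Proof.
move=> Zz; have zT := Zz.1; have yT := Zy.1.
have czL := chain_left Zz; have czR := chain_right Zz.
have [vL vLd] : exists v, v = eM - wL m by exists (eM - wL m).
have [vR vRd] : exists v, v = eM - wR k by exists (eM - wR k).
have YLwR j : (j < k)%N -> YL m *m z *m wR j = 0.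
  elim: j => [|j IH] jk; first by rewrite /wR /= YL_right.
  rewrite /wR /= mulmxBr YL_right// -scalemxAr -/(wR j) IH ?scaler0 ?subr0//.
  exact: ltnW.
have YRwL j : (j < m)%N -> YR k *m z *m wL j = 0.
  elim: j => [|j IH] jm; first by rewrite /wL /= YR_left.
  rewrite /wL /= mulmxBr YR_left// -scalemxAr -/(wL j) IH ?scaler0 ?subr0//.
  exact: ltnW.
have vLE : vL = YL m *m y *m eM by rewrite YL_root.
have vRE : vR = YR k *m y *m eM by rewrite YR_root.
have YLYR j : (j <= k)%N -> YL m *m z *m YR j = 0.
  elim: j => [|j IH] jk; first by rewrite mulmx0.
  rewrite /YR /= mulmxDr IH 1?ltnW// add0r -scalemxAr mulmxA.
  by rewrite -/(wR j) YLwR// mul0mx scaler0.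
have YLvR : YL m *m z *m vR = 0 by rewrite vRE !mulmxA YLYR// !mul0mx.
have trY f j : (Ymx f y j)^T = Ymx f y j by exact: tr_Ymx.
have YRYL : YR k *m z *m YL m = 0.
  have := congr1 trmx (YLYR k (leqnn k)).
  by rewrite !trmx_mul !trY zT trmx0 mulmxA.
have YRvL : YR k *m z *m vL = 0 by rewrite vLE !mulmxA YRYL !mul0mx.
have vLvR : bil z vL vR = 0.
  rewrite vLE /bil !trmx_mul trY yT -!mulmxA [YL m *m _]mulmxA YLvR.
  by rewrite !mulmx0 mxE.
have wrL : wroot = wL m - vR by rewrite /wroot vRd opprB addrA addrAC.
have wrR : wroot = wR k - vL.
  by rewrite /wroot vLd opprB addrA [wR k + _]addrC.
have p1L : bil z (wL m) (wL m) = pivot1 (ydiag y) (yoff y) (ydiag z) (yoff z) m.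
  exact: (chain_pivot1 y czL).
have p1R : bil z (wR k) (wR k) = pivot1 (rdiag y) (roff y) (rdiag z) (roff z) k.
  exact: (chain_pivot1 y czR).
have g2L : 2 * bil z (wL m) (YL m *m z *m wL m) =
    gain2 (ydiag y) (yoff y) (ydiag z) (yoff z) m by exact: (chain_gain2 y czL).
have g2R : 2 * bil z (wR k) (YR k *m z *m wR k) =
    gain2 (rdiag y) (roff y) (rdiag z) (roff z) k by exact: (chain_gain2 y czR).
have eMM : bil z eM eM = ydiag z m by rewrite bil_evec.
have rdm : rdiag z k = ydiag z m by rewrite /rdiag addnK.
(* With wL = eM - vL, wR = eM - vR, wroot = eM - vL - vR and vL orthogonal to vR,
   the squares give |wroot|^2 = |wL|^2 + |wR|^2 - |eM|^2 for the form of [z]. *)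
have ww : bil z wroot wroot = ydiag z m
    - gain1 (ydiag y) (yoff y) (ydiag z) (yoff z) m
    - gain1 (rdiag y) (roff y) (rdiag z) (roff z) k.
  have wLE : wL m = eM - vL by rewrite vLd opprB addrC subrK.
  have wRE : wR k = eM - vR by rewrite vRd opprB addrC subrK.
  have -> : bil z wroot wroot = bil z (wL m) (wL m) + bil z (wR k) (wR k) - ydiag z m.
    rewrite wrL wLE wRE !(bilBl, bilBr) vLvR [bil z vR vL]bilC// vLvR eMM.
    by rewrite [bil z vL eM]bilC// [bil z vR eM]bilC//; ring.
  by rewrite p1L p1R /pivot1 rdm; ring.
have YLw : YL m *m z *m wroot = YL m *m z *m wL m.
  by rewrite wrL mulmxBr YLvR subr0.
have YRw : YR k *m z *m wroot = YR k *m z *m wR k.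
  by rewrite wrR mulmxBr YRvL subr0.
have symL : (z *m YL m *m z)^T = z *m YL m *m z by rewrite !trmx_mul trY zT mulmxA.
have symR : (z *m YR k *m z)^T = z *m YR k *m z by rewrite !trmx_mul trY zT mulmxA.
have wYLw : bil z wroot (YL m *m z *m wroot) = bil z (wL m) (YL m *m z *m wL m).
  rewrite YLw {1}wrL bilBl -[bil z vR _]bilM// [bil _ vR _]bilC// bilM//.
  by rewrite YLvR bil0r subr0.
have wYRw : bil z wroot (YR k *m z *m wroot) = bil z (wR k) (YR k *m z *m wR k).
  rewrite YRw {1}wrR bilBl -[bil z vL _]bilM// [bil _ vL _]bilC// bilM//.
  by rewrite YRvL bil0r subr0.
have qLR : quad_tr z (YL m + YR k) = quad_tr z (YL m) + quad_tr z (YR k).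
  have e1 : z *m YL m *m z *m YR k = 0.
    by rewrite -!mulmxA [YL m *m (z *m YR k)]mulmxA YLYR// mulmx0.
  have e2 : z *m YR k *m z *m YL m = 0.
    by rewrite -!mulmxA [YR k *m (z *m YL m)]mulmxA YRYL mulmx0.
  rewrite /quad_tr [z *m (YL m + YR k)]mulmxDr mulmxDl mulmxDr !mulmxDl.
  by rewrite e1 e2 addr0 add0r linearD.
rewrite invmx_root quad_tr_add// qLR [(YL m + _) *m z]mulmxDl mulmxDl bilDr wYLw wYRw ww /root_curv -g2L -g2R.
ring.
Qed.

End root_vertex.

(** * Probability measures with a density *)

Section density.
Context {d} {T : measurableType d} {R : realType}.
Variable mu : {sigma_finite_measure set T -> \bar R}.
Variable f : T -> R.
Hypothesis mf : measurable_fun setT f.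
Hypothesis f0 : forall x, 0 <= f x.

Let mfE (D : set T) : measurable_fun D (EFin \o f).
Proof. by apply/measurable_EFinP; exact: measurable_funTS. Qed.

(** Such a density is almost everywhere the Radon-Nikodym derivative of [nu]. *)
Lemma ge0_integral_density (nu : {finite_measure set T -> \bar R}) (h : T -> \bar R) :
  (forall A, measurable A -> nu A = \int[mu]_(x in A) (f x)%:E)%E ->
  measurable_fun setT h -> (forall x, (0 <= h x)%E) ->
  (\int[nu]_x h x = \int[mu]_x (h x * (f x)%:E))%E.
Proof.
move=> nuE mh h0.
have numu : nu `<< mu.
  apply/null_content_dominatesP => A mA muA0.
  by rewrite nuE//; apply: null_set_integral => //; exact: mfE.
pose g := Radon_Nikodym_SigmaFinite.f nu mu.
have gi := Radon_Nikodym_SigmaFinite.f_integrable numu.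
rewrite -(Radon_Nikodym_SigmaFinite.change_of_variables numu h0 measurableT mh).
have mg : measurable_fun setT g := measurable_int _ gi.
have gf : ae_eq mu setT g (EFin \o f).
  apply: integral_ae_eq => //.
  move=> E _ mE; rewrite -nuE//.
  by rewrite -(Radon_Nikodym_SigmaFinite.f_integral numu).
apply: ge0_ae_eq_integral => //.
- exact: emeasurable_funM.
- exact: emeasurable_funM.
- by move=> x _; rewrite mule_ge0// Radon_Nikodym_SigmaFinite.f_ge0.
- by move=> x _; rewrite mule_ge0// lee_fin.
- move: gf; apply: filterS => x + _ => /(_ I).
  by rewrite /g => ->.
Qed.

Hypothesis f1 : (\int[mu]_x (f x)%:E = 1)%E.

Definition density (A : set T) : \bar R := (\int[mu]_(x in A) (f x)%:E)%E.

Let density_set0 : density set0 = 0%E.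
Proof. exact: integral_set0. Qed.

Let density_ge0 A : (0 <= density A)%E.
Proof. by apply: integral_ge0 => x _; rewrite lee_fin. Qed.

Let density_sigma_additive : semi_sigma_additive density.
Proof.
move=> A mA tA mUA; rewrite /density ge0_integral_bigcup//.
- apply: is_cvg_ereal_nneg_natsum_cond => n _ _; exact: density_ge0.
- by move=> x _; rewrite lee_fin.
Qed.

Let density_measure : {measure set T -> \bar R} :=
  HB.pack density (isMeasure.Build _ _ _ density
    density_set0 density_ge0 density_sigma_additive).

Definition density_probability : probability T R :=
  HB.pack density (Measure.on density_measure)
    (@Measure_isProbability.Build _ _ R density_measure f1).

Lemma density_probabilityE A :
  density_probability A = (\int[mu]_(x in A) (f x)%:E)%E.
Proof. by []. Qed.

End density.

(** * The logarithm of the Laplace transform along a line *)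

Section log_laplace.
Context {R : realType} (m k : nat).
Notation n := (m + k).+1.
Implicit Types (y z : 'M[R]_n) (s : 'rV[R]_n).

Notation sL s := (fun j => rV_at s j.+1).
Notation sR s := (fun j => rV_at s (m + k - j).+1).

Definition log_laplace s y : R :=
  - (\sum_(j < m) rV_at s j.+1 * ln (pivot (ydiag y) (yoff y) j) +
     rV_at s m.+1 * ln (root_pivot y) +
     \sum_(j < k) rV_at s (m + k - j).+1 * ln (pivot (rdiag y) (roff y) j)).

Definition laplace_cst s : R :=
  \prod_(j < m) arm_cst (rV_at s j.+1) *
  (root_cst (rV_at s m.+1) * \prod_(j < k) arm_cst (rV_at s (m + k - j).+1)).

Lemma laplace_cst_gt0 s : shape_ok s -> 0 < laplace_cst s.
Proof.
move=> [hL hR hr]; rewrite mulr_gt0 ?prodr_gt0// => [j _|].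
  by rewrite arm_cst_gt0// hL.
rewrite mulr_gt0 ?fine_gammaI_gt0 ?prodr_gt0// => j _.
by rewrite arm_cst_gt0// hR.
Qed.

Lemma laplace_wishartE s y : pos_pivots y ->
  laplace_wishart s y = laplace_cst s * expR (log_laplace s y).
Proof.
move=> [pL pR pr].
have arm c al be sg : (forall j, (j < c)%N -> 0 < pivot al be j) ->
    \prod_(j < c) arm_factor al be sg j =
    \prod_(j < c) arm_cst (sg j) * expR (- \sum_(j < c) sg j * ln (pivot al be j)).
  move=> p0; rewrite -sumrN -prod_expR -big_split; apply: eq_bigr => j _.
  by rewrite /arm_factor powR_expR ?p0// mulNr.
rewrite /laplace_wishart !arm// powR_expR// /log_laplace /laplace_cst !opprD !expRD.
by rewrite mulNr; ring.
Qed.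

Variables (y z : 'M[R]_n).
Hypothesis py : pos_pivots y.

(** The parameter of the distribution tilted by [expR (- (t * <z, eta>))]. *)
Definition tilted (t : R) : 'M[R]_n := y + t *: z.

Lemma ydiag_line t : ydiag (tilted t) = line (ydiag y) (ydiag z) t.
Proof. by apply/funext => j; rewrite /ydiag /tilted /line !mxE. Qed.
Lemma yoff_line t : yoff (tilted t) = line (yoff y) (yoff z) t.
Proof. by apply/funext => j; rewrite /yoff /tilted /line !mxE. Qed.
Lemma rdiag_line t : rdiag (tilted t) = line (rdiag y) (rdiag z) t.
Proof. by apply/funext => j; rewrite /rdiag ydiag_line. Qed.
Lemma roff_line t : roff (tilted t) = line (roff y) (roff z) t.
Proof. by apply/funext => j; rewrite /roff /tilted /line !mxE. Qed.

Lemma tilted0 : tilted 0 = y.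
Proof. by rewrite /tilted scale0r addr0. Qed.

Definition root1 y : R :=
  ydiag z m - gain1 (ydiag y) (yoff y) (ydiag z) (yoff z) m
  - gain1 (rdiag y) (roff y) (rdiag z) (roff z) k.

Lemma is_derive_root t :
  (forall j, (j < m)%N -> 0 < pivot (ydiag (tilted t)) (yoff (tilted t)) j) ->
  (forall j, (j < k)%N -> 0 < pivot (rdiag (tilted t)) (roff (tilted t)) j) ->
  is_derive t 1 (fun t => root_pivot (tilted t)) (root1 (tilted t)) /\
  is_derive t 1 (fun t => root1 (tilted t))
   (- (gain2 (ydiag (tilted t)) (yoff (tilted t)) (ydiag z) (yoff z) m
   + gain2 (rdiag (tilted t)) (roff (tilted t)) (rdiag z) (roff z) k)).
Proof.
rewrite /root1 /root_pivot.
under [in X in _ -> _ -> X /\ _]eq_fun do rewrite ydiag_line yoff_line rdiag_line roff_line.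
under [in X in _ -> _ -> _ /\ X]eq_fun do rewrite ydiag_line yoff_line rdiag_line roff_line.
rewrite ydiag_line yoff_line rdiag_line roff_line => pL pR.
have [l1 l2] := is_derive_elim_gain (fun j jm => lt0r_neq0 (pL j jm)).
have [r1 r2] := is_derive_elim_gain (fun j jm => lt0r_neq0 (pR j jm)).
split.
  exact: is_derive_fB (is_derive_fB (is_derive_line _ _ _ _) l1) r1.
have := is_derive_fB (is_derive_fB (is_derive_fC (ydiag z m) t) l2) r2.
by rewrite sub0r -opprD.
Qed.

Lemma near_pos_pivots : \forall t \near (0 : R), pos_pivots (tilted t).
Proof.
have [pL pR pr] := py.
have nL := near_pos_pivot (ydiag z) (yoff z) pL.
have nR := near_pos_pivot (rdiag z) (roff z) pR.
have [dr _] : is_derive (0 : R) 1 (fun t => root_pivot (tilted t)) (root1 (tilted 0)) /\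
    is_derive (0 : R) 1 (fun t => root1 (tilted t))
   (- (gain2 (ydiag (tilted 0)) (yoff (tilted 0)) (ydiag z) (yoff z) m
   + gain2 (rdiag (tilted 0)) (roff (tilted 0)) (rdiag z) (roff z) k)).
  by apply: is_derive_root; rewrite tilted0.
have pr0 : 0 < root_pivot (tilted 0) by rewrite tilted0.
have nr := near_pos_derivable dr pr0.
near=> t; split.
- by rewrite ydiag_line yoff_line; near: t.
- by rewrite rdiag_line roff_line; near: t.
- by near: t.
Unshelve. all: by end_near. Qed.

Definition log_laplace1 s y : R :=
  - (\sum_(j < m) rV_at s j.+1 *
       (pivot1 (ydiag y) (yoff y) (ydiag z) (yoff z) j / pivot (ydiag y) (yoff y) j) +
     rV_at s m.+1 * (root1 y / root_pivot y) +
     \sum_(j < k) rV_at s (m + k - j).+1 *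
       (pivot1 (rdiag y) (roff y) (rdiag z) (roff z) j / pivot (rdiag y) (roff y) j)).

Definition log_laplace2 s y : R :=
  \sum_(j < m) rV_at s j.+1 * log_curv (ydiag y) (yoff y) (ydiag z) (yoff z) j +
  rV_at s m.+1 * root_curv y z +
  \sum_(j < k) rV_at s (m + k - j).+1 *
     log_curv (rdiag y) (roff y) (rdiag z) (roff z) j.

Lemma is_derive_log_laplace s t : pos_pivots (tilted t) ->
  is_derive t 1 (fun t => log_laplace s (tilted t)) (log_laplace1 s (tilted t)) /\
  is_derive t 1 (fun t => log_laplace1 s (tilted t)) (log_laplace2 s (tilted t)).
Proof.
move=> [pL pR pr]; have [r1 r2] := is_derive_root pL pR.
have lnr : is_derive t 1 (fun t => ln (root_pivot (tilted t)))
    (root1 (tilted t) / root_pivot (tilted t)).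
  by rewrite mulrC; apply: (is_derive1_comp _ r1); exact: is_derive1_ln.
have ratr : is_derive t 1 (fun t => root1 (tilted t) / root_pivot (tilted t))
    (- root_curv (tilted t) z).
  have := is_derive_fdiv r2 r1 (lt0r_neq0 pr).
  rewrite [X in is_derive _ _ _ X](_ : _ = - root_curv (tilted t) z)//.
  by rewrite /root_curv -/(root1 (tilted t)); move: (lt0r_neq0 pr) => pr0; field.
move: pL pR; rewrite /log_laplace /log_laplace1 /log_laplace2.
rewrite ydiag_line yoff_line rdiag_line roff_line => pL pR.
have pL' j : (j < m)%N -> forall i, (i <= j)%N ->
    0 < pivot (line (ydiag y) (ydiag z) t) (line (yoff y) (yoff z) t) i.
  by move=> jm i ij; rewrite pL// (leq_ltn_trans ij).
have pR' j : (j < k)%N -> forall i, (i <= j)%N ->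
    0 < pivot (line (rdiag y) (rdiag z) t) (line (roff y) (roff z) t) i.
  by move=> jm i ij; rewrite pR// (leq_ltn_trans ij).
have wsum c (a : nat -> R) (f : nat -> R -> R) (df : nat -> R) :
    (forall j, (j < c)%N -> is_derive t 1 (f j) (df j)) ->
    is_derive t 1 (fun x => \sum_(j < c) a j * f j x) (\sum_(j < c) a j * df j).
  move=> h; have := @is_derive_ord_sum _ c (fun j x => a j * f j x) (fun j => a j * df j) t.
  apply => j; have := is_derive_fM (is_derive_fC (a j) t) (h j (ltn_ord j)).
  by rewrite mulr0 addr0.
have scal (a : R) f df : is_derive t 1 f df -> is_derive t 1 (fun x => a * f x) (a * df).
  move=> h; have := is_derive_fM (is_derive_fC a t) h.
  by rewrite mulr0 addr0.
split.
- under eq_fun do rewrite ydiag_line yoff_line rdiag_line roff_line.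
  apply: is_derive_fN.
  exact: (is_derive_fD (is_derive_fD
    (wsum m (fun j => rV_at s j.+1) _ _ (fun j jm => is_derive_ln_pivot (pL' j jm)))
    (scal (rV_at s m.+1) _ _ lnr))
    (wsum k (fun j => rV_at s (m + k - j).+1) _ _
       (fun j jm => is_derive_ln_pivot (pR' j jm)))).
- under eq_fun do rewrite ydiag_line yoff_line rdiag_line roff_line.
  have := is_derive_fN (is_derive_fD (is_derive_fD
    (wsum m (fun j => rV_at s j.+1) _ _ (fun j jm => is_derive_pivot_ratio (pL' j jm)))
    (scal (rV_at s m.+1) _ _ ratr))
    (wsum k (fun j => rV_at s (m + k - j).+1) _ _
       (fun j jm => is_derive_pivot_ratio (pR' j jm)))).
  have neg c (a b : 'I_c -> R) : \sum_(j < c) a j * - b j = - \sum_(j < c) a j * b j.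
    by rewrite -sumrN; apply: eq_bigr => j _; rewrite mulrN.
  by rewrite !neg mulrN !opprD !opprK.
Qed.

End log_laplace.

(** * The covariance of the Wishart family *)

Section summation_by_parts.
Context {R : realType}.

Lemma sum_by_parts (a q : nat -> R) c : q 0%N = 0 ->
  \sum_(j < c) a j.+1 * (q j.+1 - q j) - a c.+1 * q c =
  \sum_(j < c) (a j.+1 - a j.+2) * q j.+1.
Proof.
move=> q0; elim: c => [|c IH]; first by rewrite !big_ord0 q0 mulr0 subr0.
by rewrite !big_ord_recr /= -IH; ring.
Qed.

(** Brings the right arm, numbered from its leaf, back to the labels of the vertices. *)
Lemma sum_nat_rev (F : nat -> R) a c :
  \sum_(a <= i < a + c) F i = \sum_(j < c) F (a + c - j.+1)%N.
Proof.
rewrite sum_nat_shift (reindex_inj rev_ord_inj) /=.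
by apply: eq_bigr => j _; congr F; have := ltn_ord j; lia.
Qed.

End summation_by_parts.

Section covariance.
Context {R : realType} (m k : nat).
Notation n := (m + k).+1.
Variables (s : 'rV[R]_n) (y : 'M[R]_n).
Hypothesis shape_s : shape_ok s.
Hypothesis Py : P_G y.

Let Zy : Z_G y := Py.1.
Let py : posdef y := Py.2.
Let yT : y^T = y := Zy.1.
Let mu := d_eta R n.

Let ppy : pos_pivots y.
Proof.
split.
- by move=> j jm; apply: left_pivot_gt0 => //; lia.
- by move=> j jm; apply: right_pivot_gt0 => //; lia.
- exact: root_pivot_gt0.
Qed.

Let L := laplace_wishart s y.

Let L_gt0 : 0 < L.
Proof. by rewrite /L laplace_wishartE// mulr_gt0 ?laplace_cst_gt0 ?expR_gt0. Qed.

Let integral_weight_set (A : set (I_G R n)) : 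
  (\int[mu]_(eta in A `&` @Q_G R n) (wishart_weight m.+1 s y eta)%:E =
   \int[mu]_(eta in A) (tree_weight s y eta)%:E)%E.
Proof.
rewrite integral_mkcond [RHS]integral_mkcond; apply: eq_integral => eta _.
rewrite !patchE in_setI.
case: (boolP (eta \in A)) => //= _; case: (boolP (eta \in @Q_G R n)) => [|/negP].
  by rewrite inE => Qe; rewrite tree_weight_expR.
rewrite inE => nQ; congr EFin; apply/esym/eqP; apply: contra_notT nQ.
exact: tree_weight_region.
Qed.

Let f (eta : I_G R n) : R := L^-1 * tree_weight s y eta.

Let f0 eta : 0 <= f eta.
Proof. by rewrite mulr_ge0 ?tree_weight_ge0// invr_ge0 ltW. Qed.

Let mf : measurable_fun setT f.
Proof. by apply: measurable_funM => //; exact: measurable_tree_weight. Qed.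

Let integral_f (A : set (I_G R n)) : measurable A ->
  (\int[mu]_(eta in A) (f eta)%:E = L^-1%:E * \int[mu]_(eta in A) (tree_weight s y eta)%:E)%E.
Proof.
move=> mA; rewrite -ge0_integralZl//.
- by apply/measurable_EFinP/measurable_funTS; exact: measurable_tree_weight.
- by move=> eta _; rewrite lee_fin tree_weight_ge0.
- by rewrite lee_fin invr_ge0 ltW.
Qed.

Let integral_f1 : (\int[mu]_eta (f eta)%:E = 1)%E.
Proof.
rewrite integral_f// integral_tree_weight// -/L -EFinM mulVf// gt_eqF//.
Qed.

Lemma wishart_exists : exists gamma : probability (I_G R n) R, is_wishart m.+1 s y gamma.
Proof.
exists (density_probability mf f0 integral_f1); exists L^-1 => A mA.
by rewrite density_probabilityE integral_f// integral_weight_set.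
Qed.

Section wishart.
Variable gamma : probability (I_G R n) R.
Hypothesis wgamma : is_wishart m.+1 s y gamma.

Let gammaE (A : set (I_G R n)) : measurable A ->
  (gamma A = \int[mu]_(eta in A) (f eta)%:E)%E.
Proof.
move=> mA; have [c cE] := wgamma.
(* The total mass determines the constant [c] of the definition. *)
have : c = L^-1.
  have := cE setT measurableT; rewrite probability_setT integral_weight_set.
  rewrite integral_tree_weight// -/L -EFinM => -[cL].
  by rewrite -[c](mulfK (lt0r_neq0 L_gt0)) -cL mul1r.
by move=> cL; rewrite cE// integral_weight_set cL integral_f.
Qed.

Lemma measurable_pairing (z : 'M[R]_n) : Z_G z -> measurable_fun setT (@pairing R n z).
Proof.
move=> Zz; rewrite (_ : pairing z = fun eta =>
   \sum_(i < n) ydiag z i * ediag eta i + 2 * \sum_(i < (m + k)) yoff z i * eoff eta i).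
  apply: measurable_funD.
    by apply: measurable_sum => i; apply: measurable_funM => //; exact: measurable_ediag.
  apply: measurable_funM => //.
  by apply: measurable_sum => i; apply: measurable_funM => //; exact: measurable_eoff.
by apply/funext => eta; exact: pairing_sum.
Qed.

Let Z_G_line (z : 'M[R]_n) t : Z_G z -> Z_G (tilted y z t).
Proof.
move=> [zT z0]; split; first by rewrite /tilted linearD linearZ /= yT zT.
by move=> i j ij; rewrite !mxE Zy.2// z0// mulr0 addr0.
Qed.

Let tree_weight_line (z : 'M[R]_n) t eta : Z_G z ->
  expR (- (t * pairing z eta)) * tree_weight s y eta = tree_weight s (tilted y z t) eta.
Proof.
move=> Zz; have Zt := Z_G_line t Zz.
have [Qe|nQ] := pselect (Q_G eta).
  rewrite !tree_weight_expR// /wishart_weight !mulrA -expRD.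
  by rewrite /tilted pairingDl pairingZl opprD addrC.
have z0 y' : tree_weight s y' eta = 0.
  by apply/eqP; apply: contra_notT nQ; exact: tree_weight_region.
by rewrite !z0 mulr0.
Qed.

Let mgf (z : 'M[R]_n) t : Z_G z -> pos_pivots (tilted y z t) ->
  (\int[gamma]_eta (expR (- (t * pairing z eta)))%:E =
   (expR (log_laplace s (tilted y z t) - log_laplace s y))%:E)%E.
Proof.
move=> Zz pt.
have me : measurable_fun setT (fun eta : I_G R n => expR (- (t * pairing z eta))).
  apply: measurable_expRc; apply: measurable_funN; apply: measurable_funM => //.
  exact: measurable_pairing.
rewrite (ge0_integral_density mf f0 gammaE); last 2 first.
- exact/measurable_EFinP.
- by move=> eta; rewrite lee_fin expR_ge0.
transitivity (\int[mu]_eta (L^-1%:E * (tree_weight s (tilted y z t) eta)%:E))%E.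
  apply: eq_integral => eta _; rewrite -tree_weight_line// -!EFinM.
  by congr EFin; rewrite /f mulrCA.
rewrite ge0_integralZl//.
- rewrite integral_tree_weight//; last by have [] := Z_G_line t Zz.
  rewrite -EFinM; congr EFin; rewrite /L !laplace_wishartE// expRD expRN.
  have c0 := lt0r_neq0 (laplace_cst_gt0 shape_s).
  have e0 : expR (log_laplace s y) != 0 by rewrite gt_eqF ?expR_gt0.
  by field; rewrite c0 e0.
- by apply/measurable_EFinP; exact: measurable_tree_weight.
- by move=> eta _; rewrite lee_fin tree_weight_ge0.
- by rewrite lee_fin invr_ge0 ltW.
Qed.

(** The moment generating function is the quotient of two Laplace transforms with the
same constant, hence the exponential of a difference of [log_laplace]. *)
Lemma wishart_variance (z : 'M[R]_n) : Z_G z ->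
  (pairing z : I_G R n -> R) \in Lfun gamma 2%:E /\
  variance gamma (pairing z) = (log_laplace2 z s y)%:E.
Proof.
move=> Zz.
have [e /= e0 he] : \forall t \near (0 : R), pos_pivots (tilted y z t).
  exact: near_pos_pivots.
pose G t := log_laplace s (tilted y z t) - log_laplace s y.
pose g t := log_laplace1 z s (tilted y z t).
have pe (t : R) : `|t| < e -> pos_pivots (tilted y z t).
  by move=> te; apply: he; rewrite /= sub0r normrN.
have dG (t : R) : `|t| < e -> is_derive t 1 (fun t => expR (G t)) (expR (G t) * g t).
  move=> te; apply: is_derive1_comp.
  have [d1 _] := is_derive_log_laplace s (pe t te).
  by have := is_derive_fB d1 (is_derive_fC (log_laplace s y) t); rewrite subr0.
have n0 : `|0 : R| < e by rewrite normr0.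
have G0 : G 0 = 0 by rewrite /G tilted0 subrr.
have dg : is_derive (0 : R) 1 (fun t => expR (G t) * g t) (log_laplace2 z s y + g 0 ^+ 2).
  have [_ d2] := is_derive_log_laplace s (pe 0 n0).
  have := is_derive_fM (dG 0 n0) d2.
  rewrite [X in is_derive _ _ _ X](_ : _ = log_laplace2 z s y + g 0 ^+ 2)//.
  by rewrite G0 expR0 !mul1r /g tilted0 expr2.
have mX := measurable_pairing Zz.
have mgfE (t : R) : `|t| < e -> (\int[gamma]_eta (expR (- (t * pairing z eta)))%:E = (expR (G t))%:E)%E.
  by move=> te; exact: mgf Zz (pe t te).
split; first exact: (Lfun2_of_mgf mX e0 mgfE).
by rewrite (variance_of_mgf mX e0 mgfE dG dg) G0 expR0 mul1r addrK.
Qed.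

End wishart.

Notation cov_formula u :=
  (\sum_(1 <= i < m.+1) (rV_at s i - rV_at s i.+1) *:
      quadP (pad0 (invmx (psubmx (interval_set n 1 i) y))) u
   + rV_at s m.+1 *: quadP (invmx y) u
   + \sum_(m.+2 <= i < n.+1) (rV_at s i - rV_at s i.-1) *:
      quadP (pad0 (invmx (psubmx (interval_set n i n) y))) u).

Lemma pairing_cov_formula (z u : 'M[R]_n) :
  pairing z (cov_formula u) =
  \sum_(j < m) (rV_at s j.+1 - rV_at s j.+2) * pairing z (quadP (YL y j.+1) u)
  + rV_at s m.+1 * pairing z (quadP (invmx y) u)
  + \sum_(j < k) (rV_at s (m + k - j).+1 - rV_at s (m + k - j)) *
       pairing z (quadP (YR y j.+1) u).
Proof.
rewrite !pairingDr !pairing_sumr pairingZr; congr (_ + _ + _).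
- rewrite big_add1 /= big_mkord; apply: eq_bigr => j _.
  by rewrite pairingZr YL_pad0//; have := ltn_ord j; lia.
- rewrite -[n.+1]/(m.+2 + k)%N sum_nat_rev; apply: eq_bigr => j _.
  have jk := ltn_ord j.
  rewrite pairingZr YR_pad0//; last by lia.
  have -> : (m.+2 + k - j.+1 = (m + k - j).+1)%N by lia.
  by have -> : ((m + k).+2 - (m + k - j).+1 = j.+1)%N by lia.
Qed.

(** Summation by parts along each arm.  The boundary terms carry the weight s_M and
combine with the inverse of [y] into the contribution of the root. *)
Lemma pairing_cov_formula_diag (z : 'M[R]_n) : Z_G z ->
  pairing z (cov_formula z) = log_laplace2 z s y.
Proof.
move=> Zz; rewrite pairing_cov_formula.
have iT : (invmx y)^T = invmx y by rewrite trmx_inv yT.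
pose qL j := quad_tr z (YL y j); pose qR j := quad_tr z (YR y j).
have -> : \sum_(j < m) (rV_at s j.+1 - rV_at s j.+2) * pairing z (quadP (YL y j.+1) z) =
    \sum_(j < m) (rV_at s j.+1 - rV_at s j.+2) * qL j.+1.
  by apply: eq_bigr => j _; rewrite pairing_quadP_diag// tr_Ymx.
have -> : \sum_(j < k) (rV_at s (m + k - j).+1 - rV_at s (m + k - j)) *
       pairing z (quadP (YR y j.+1) z) =
    \sum_(j < k) (rV_at s ((m + k).+2 - j.+1) - rV_at s ((m + k).+2 - j.+2)) * qR j.+1.
  apply: eq_bigr => j _; rewrite pairing_quadP_diag ?tr_Ymx//.
  have jk := ltn_ord j; congr ((rV_at s _ - rV_at s _) * _); lia.
rewrite -(sum_by_parts (rV_at s) m (quad_tr0 z)).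
rewrite -(sum_by_parts (fun j => rV_at s ((m + k).+2 - j)) k (quad_tr0 z)).
rewrite pairing_quadP_diag// /log_laplace2 -root_quad//.
have -> : \sum_(j < m) rV_at s j.+1 * log_curv (ydiag y) (yoff y) (ydiag z) (yoff z) j =
    \sum_(j < m) rV_at s j.+1 * (qL j.+1 - qL j).
  apply: eq_bigr => j _; congr (_ * _).
  by rewrite /qL (chain_quad y (chain_left Zz))//; have := ltn_ord j; lia.
have -> : \sum_(j < k) rV_at s (m + k - j).+1 * log_curv (rdiag y) (roff y) (rdiag z) (roff z) j =
    \sum_(j < k) rV_at s ((m + k).+2 - j.+1) * (qR j.+1 - qR j).
  apply: eq_bigr => j _; have jk := ltn_ord j; congr (rV_at s _ * _); first lia.
  by rewrite /qR (chain_quad y (chain_right Zz))//; lia.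
have -> : ((m + k).+2 - k.+1 = m.+1)%N by lia.
rewrite /qL /qR; ring.
Qed.

Lemma pairing_cov_formulaC (z u : 'M[R]_n) : Z_G z -> Z_G u ->
  pairing z (cov_formula u) = pairing u (cov_formula z).
Proof.
move=> Zz Zu; rewrite !pairing_cov_formula.
have iT : (invmx y)^T = invmx y by rewrite trmx_inv yT.
have sym Y : Y^T = Y -> pairing z (quadP Y u) = pairing u (quadP Y z).
  by move=> YT; exact: pairing_quadPC.
have eL (c : nat -> R) : \sum_(j < m) c j * pairing z (quadP (YL y j.+1) u) =
    \sum_(j < m) c j * pairing u (quadP (YL y j.+1) z).
  by apply: eq_bigr => j _; rewrite sym// tr_Ymx.
have eR (c : nat -> R) : \sum_(j < k) c j * pairing z (quadP (YR y j.+1) u) =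
    \sum_(j < k) c j * pairing u (quadP (YR y j.+1) z).
  by apply: eq_bigr => j _; rewrite sym// tr_Ymx.
rewrite (sym _ iT) (eL (fun j => rV_at s j.+1 - rV_at s j.+2)).
by rewrite (eR (fun j => rV_at s (m + k - j).+1 - rV_at s (m + k - j))).
Qed.

(** Polarisation: the variances at [z], [z'] and [z + z'] determine the covariance, and
the pairing with the operator is symmetric and bilinear. *)
Lemma wishart_covariance (gamma : probability (I_G R n) R) :
  is_wishart m.+1 s y gamma ->
  is_covariance_operator gamma (fun u => cov_formula u).
Proof.
move=> wg; split; first by move=> z /(wishart_variance wg)[].
move=> z z' Zz Zz'.
have Zzz : Z_G (z + z').
  split; first by rewrite linearD /= Zz.1 Zz'.1.
  by move=> i j ij; rewrite mxE Zz.2// Zz'.2// addr0.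
have [L1 V1] := wishart_variance wg Zz.
have [L2 V2] := wishart_variance wg Zz'.
have [_ V3] := wishart_variance wg Zzz.
have DE : (pairing (z + z') : I_G R n -> R) = pairing z \+ pairing z'.
  by apply/funext => eta; rewrite pairingDl.
have Pfin : gamma setT \is a fin_num := fin_num_measure gamma _ measurableT.
have Cfin : covariance gamma (pairing z) (pairing z') \is a fin_num.
  by apply: covariance_fin_num; [exact: Lfun_subset12|exact: Lfun_subset12|
    exact: Lfun2_mul_Lfun1].
have := varianceD L1 L2; rewrite -DE V1 V2 V3.
rewrite -!pairing_cov_formula_diag// -(fineK Cfin) -EFinM -!EFinD => -[E].
congr EFin; move: E; rewrite !pairingDl.
have lin w : Z_G w -> pairing w (cov_formula (z + z')) =
    pairing w (cov_formula z) + pairing w (cov_formula z').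
  move=> Zw; rewrite (pairing_cov_formulaC Zw Zzz) pairingDl.
  by rewrite (pairing_cov_formulaC Zz Zw) (pairing_cov_formulaC Zz' Zw).
rewrite !lin// (pairing_cov_formulaC Zz Zz').
move: (fine _) (pairing z' _) (pairing z _) (pairing z' _) => c b a b'.
lra.
Qed.

End covariance.

Unset Implicit Arguments.

Theorem proposition5 (R : realType) (n M : nat) (s : 'rV[R]_n) :
  (1 <= n)%N -> (1 <= M <= n)%N ->
  (forall i, (1 <= i <= n)%N -> i != M -> 1 / 2 < rV_at s i) ->
  0 < rV_at s M ->
  forall y : 'M[R]_n, P_G y ->
  (exists gamma, is_wishart M s y gamma) /\
  forall gamma, is_wishart M s y gamma ->
  is_covariance_operator gamma
    (fun u =>
       \sum_(1 <= i < M) (rV_at s i - rV_at s i.+1) *: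
          quadP (pad0 (invmx (psubmx (interval_set n 1 i) y))) u
       + rV_at s M *: quadP (invmx y) u
       + \sum_(M.+1 <= i < n.+1) (rV_at s i - rV_at s i.-1) *:
          quadP (pad0 (invmx (psubmx (interval_set n i n) y))) u).
Proof.
move=> n1 Mn sh sM y Py.
have [m [k [Mm nk]]] : exists m k, M = m.+1 /\ n = (m + k).+1.
  by exists M.-1, (n - M)%N; lia.
subst M n.
have shape_s : shape_ok s.
  split=> [j jm|j jk|//]; apply: sh; lia.
split; first exact: wishart_exists.
by move=> gamma; exact: wishart_covariance.
Qed.
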